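(* Let $\Omega\subset\mathbb{C}^d$ be a nonempty bounded open set such that $\mathbb{C}[z_1,\dots,z_d]$ is dense in the Bergman space $L_a^2(\Omega)$. Let $\mathbf{T}=(M_{z_1},\dots,M_{z_d})$ be the tuple of coordinate multiplication operators $M_{z_i}f=z_if$ on $L_a^2(\Omega)$, and let $\{\lambda_k\}$ be the sequence of nonzero eigenvalues of $L_{\mathbf{T},1}$ (counted with multiplicity, in non-increasing order). Then $$\lim_{k\to\infty}\frac{\ln k}{\ln\ln(1/\lambda_k)}=d.$$
   Context: Let $m$ be Lebesgue measure on $\mathbb{C}^d$. The Bergman space $L_a^2(\Omega)$ consists of all holomorphic functions on $\Omega$ that are square integrable with respect to $m$, with the $L^2$ inner product. The Fock space $F^2$ is the space of entire functions $f$ on $\mathbb{C}^d$ with $\|f\|_{F^2}^2=\int|f|^2\,\pi^{-d}e^{-|z|^2}\,dm(z)<\infty$. For a tuple $\mathbf{T}$ of commuting bounded operators on a Hilbert space $\mathcal{H}$ with cyclic vector $h$ (that is, $\{p(\mathbf{T})h: p\in\mathbb{C}[z_1,\dots,z_d]\}$ is dense in $\mathcal{H}$), define $\iota:F^2\to\mathcal{H}$, $\iota f=f(\mathbf{T})h$ (where $f(\mathbf{T})=\sum_\alpha a_\alpha\mathbf{T}^\alpha$ for $f=\sum_\alpha a_\alpha z^\alpha$); this is a compact operator, and $L_{\mathbf{T},h}=\iota^*\iota$. In the present situation $h=1$ (the constant function), and $L_{\mathbf{T},1}$ is the operator on $F^2$ determined by $\langle L_{\mathbf{T},1}f,g\rangle_{F^2}=\int_\Omega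 f\bar g\,dm$ for all $f,g\in F^2$. *)

(* Defs.v *)
From HB Require Import structures.
From mathcomp Require Import all_boot all_order all_algebra.
From mathcomp Require Import -(notations) mpoly.
From mathcomp Require Import all_classical all_reals all_analysis.
From mathcomp Require Export complex.

Set Implicit Arguments.
Unset Strict Implicit.
Unset Printing Implicit Defensive.

Import Order.TTheory GRing.Theory Num.Theory numFieldNormedType.Exports.
Local Open Scope classical_set_scope.
Local Open Scope ring_scope.
Local Open Scope complex_scope.

(* The library attaches the topology of a numFieldType K to the alias K^o;
   R[i] itself needs it, so that 'rV[R[i]]_d is a normed C-space on which
   [differentiable] means complex (Frechet) differentiable. *)
HB.instance Definition _ (R : realType) := NormedModule.copy R[i] R[i]^o.

Section transport.
Context d1 d2 (T1 : measurableType d1) (T2 : measurableType d2)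
  (R : realType) (mu : {sigma_finite_measure set T1 -> \bar R})
  (f : T1 -> T2) (g : T2 -> T1).
Hypotheses (mf : measurable_fun setT f) (mg : measurable_fun setT g)
  (fK : cancel f g).

(* pushforward mu f; the proofs are arguments so that the measure instance can
   be inferred *)
Definition transport of measurable_fun setT f & measurable_fun setT g
  & cancel f g := pushforward mu f.

Let m := transport mf mg fK.
Let p := measure_function_pushforward__canonical__measure_function_Measure
  mu mf.

Let transport0 : m set0 = 0%E.
Proof. exact: (measure0 p). Qed.

Let transport_ge0 A : (0 <= m A)%E.
Proof. exact: (measure_ge0 p). Qed.

Let transport_sigma_additive : semi_sigma_additive m.
Proof. exact: (@measure_semi_sigma_additive _ _ _ p). Qed.

HB.instance Definition _ := isMeasure.Build _ _ _ m
  transport0 transport_ge0 transport_sigma_additive.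

Let transport_sigma_finite : sigma_finite setT m.
Proof.
have [F FT Ffin] := sigma_finiteT mu.
exists (fun k => g @^-1` F k).
  by rewrite -preimage_bigcup -FT preimage_setT.
move=> k; have [mF Foo] := Ffin k; split.
  by rewrite -[X in measurable X]setTI; exact: mg.
rewrite /m /transport /pushforward -comp_preimage.
by rewrite (_ : _ \o _ = id) //; apply/funext => x; exact: fK.
Qed.

HB.instance Definition _ := Measure_isSigmaFinite.Build _ _ _ m
  transport_sigma_finite.

End transport.

Section tuple_cons.
Context d (T : measurableType d) (n : nat).

Definition tuple_cons (x : T * n.-tuple T) : n.+1.-tuple T :=
  [the n.+1.-tuple T of x.1 :: x.2].

Definition tuple_uncons (t : n.+1.-tuple T) : T * n.-tuple T :=
  (thead t, [tuple of behead t]).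

Lemma tuple_consK : cancel tuple_cons tuple_uncons.
Proof.
move=> [x t]; rewrite /tuple_uncons /tuple_cons /=; congr pair.
exact/val_inj.
Qed.

Lemma measurable_tuple_cons : measurable_fun setT tuple_cons.
Proof. exact: measurable_cons. Qed.

Lemma measurable_tuple_uncons : measurable_fun setT tuple_uncons.
Proof.
apply/measurable_fun_pairP; split => /=.
- exact: measurable_tnth.
- exact: measurable_behead.
Qed.

End tuple_cons.

Section prod_measure.
Context d1 d2 (T1 : measurableType d1) (T2 : measurableType d2) (R : realType)
  (m1 : {sigma_finite_measure set T1 -> \bar R})
  (m2 : {sigma_finite_measure set T2 -> \bar R}).

(* The library makes m1 \x m2 a sigma-finite measure, but inference finds
   that instance only for (sub)probabilities; hence this alias. *)
Definition prod_measure : set (T1 * T2)%type -> \bar R := (m1 \x m2)%E.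

HB.instance Definition _ := Measure.copy prod_measure (m1 \x m2)%E.

Let prod_measure_sigma_finite : sigma_finite setT prod_measure.
Proof.
have /sigma_finiteP[F [TF ndF Foo]] := sigma_finiteT m1.
have /sigma_finiteP[G [TG ndG Goo]] := sigma_finiteT m2.
exists (fun n => F n `*` G n).
  rewrite -setXTT TF TG predeqE => -[x y]; split.
    move=> [/= [n _ Fnx] [k _ Gky]]; exists (maxn n k) => //; split.
    - by move: x Fnx; exact/subsetPset/ndF/leq_maxl.
    - by move: y Gky; exact/subsetPset/ndG/leq_maxr.
  by move=> [n _ []/= ? ?]; split; exists n.
move=> k; have [? ?] := Foo k; have [? ?] := Goo k.
split; first exact: measurableX.
rewrite /prod_measure product_measure1E// lte_mul_pinfty//.
by rewrite ge0_fin_numE.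
Qed.

HB.instance Definition _ := Measure_isSigmaFinite.Build _ _ _ prod_measure
  prod_measure_sigma_finite.

End prod_measure.

Fixpoint power_measure d (T : measurableType d) (R : realType)
    (mu : {sigma_finite_measure set T -> \bar R}) (n : nat) :
    {sigma_finite_measure set (n.-tuple T) -> \bar R} :=
  if n is k.+1 then
    transport (prod_measure mu (power_measure mu k))
      (@measurable_tuple_cons _ T k) (@measurable_tuple_uncons _ T k)
      (@tuple_consK _ T k)
  else @dirac _ (0.-tuple T) [tuple] R.

Notation Cspace R d := 'rV[(R : realType)[i]]_d.

Section Cspace_measurable.
Context (R : realType) (d : nat).

Definition Ccoord (i : 'I_d) (z : Cspace R d) : R * R :=
  (complex.Re (z ord0 i), complex.Im (z ord0 i)).

Let cs0 : g_sigma_preimage Ccoord set0.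
Proof. exact: sigma_algebra0. Qed.

Let csC A : g_sigma_preimage Ccoord A -> g_sigma_preimage Ccoord (~` A).
Proof. exact: sigma_algebraC. Qed.

Let cs_bigcup (F : _^nat) : (forall i, g_sigma_preimage Ccoord (F i)) ->
  g_sigma_preimage Ccoord (\bigcup_i (F i)).
Proof. exact: sigma_algebra_bigcup. Qed.

HB.instance Definition _ := @isMeasurable.Build default_measure_display
  (Cspace R d) (g_sigma_preimage Ccoord) cs0 csC cs_bigcup.

End Cspace_measurable.

Section lebesgue_Cspace.
Context (R : realType) (d : nat).

Definition Cspace_of_tuple (t : d.-tuple (R * R)) : Cspace R d :=
  \row_i ((tnth t i).1 +i* (tnth t i).2).

Definition tuple_of_Cspace (z : Cspace R d) : d.-tuple (R * R) :=
  [tuple Ccoord i z | i < d].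

Lemma Cspace_of_tupleK : cancel Cspace_of_tuple tuple_of_Cspace.
Proof.
move=> t; apply: eq_from_tnth => i.
by rewrite tnth_mktuple /Ccoord mxE /=; case: (tnth t i).
Qed.

Lemma measurable_Ccoord i : measurable_fun setT (@Ccoord R d i).
Proof.
move=> _ Y mY; rewrite setTI; apply: sub_sigma_algebra => /=.
rewrite -bigcup_seq/=; exists i => /=; first by rewrite mem_index_enum.
by exists Y => //; rewrite setTI.
Qed.

Lemma measurable_tuple_of_Cspace : measurable_fun setT tuple_of_Cspace.
Proof.
apply/measurable_fun_tnthP => i.
rewrite (_ : _ \o _ = @Ccoord R d i); first exact: measurable_Ccoord.
by apply/funext => z /=; rewrite tnth_mktuple.
Qed.

Lemma measurable_Cspace_of_tuple : measurable_fun setT Cspace_of_tuple.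
Proof.
move=> _ Y mY; rewrite setTI.
suff: g_sigma_preimage (@Ccoord R d) `<=`
    [set A | measurable (Cspace_of_tuple @^-1` A)] by exact.
apply: smallest_sub.
  split => /=.
  - by rewrite preimage_set0.
  - by move=> A mA; rewrite setTD preimage_setC; exact: measurableC.
  - by move=> F mF; rewrite preimage_bigcup; exact: bigcupT_measurable.
rewrite -bigcup_seq => A [i _] [B mB <-] /=.
rewrite setTI -comp_preimage.
rewrite (_ : _ \o _ = @tnth d (R * R) ^~ i).
  by rewrite -[X in measurable X]setTI; exact: measurable_tnth.
by apply/funext => t /=; rewrite /Ccoord mxE /=; case: (tnth t i).
Qed.

Definition lebesgue_Cspace : {sigma_finite_measure set (Cspace R d) -> \bar R} :=
  transport
    (power_measure (prod_measure (@lebesgue_measure R) (@lebesgue_measure R)) d)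
    measurable_Cspace_of_tuple measurable_tuple_of_Cspace Cspace_of_tupleK.

End lebesgue_Cspace.

Section function_spaces.
Context {R : realType} {d : nat}.
Implicit Types (f g : Cspace R d -> R[i]) (z : Cspace R d).

Definition Cintegral (D : set (Cspace R d)) f : R[i] :=
  (\int[lebesgue_Cspace R d]_(z in D) complex.Re (f z))
    +i* (\int[lebesgue_Cspace R d]_(z in D) complex.Im (f z)).

Definition holomorphic (D : set (Cspace R d)) f :=
  forall z, D z -> differentiable f z.

(* Values of f outside D are irrelevant: f represents its restriction to D. *)
Definition bergman (D : set (Cspace R d)) : set (Cspace R d -> R[i]) :=
  [set f | holomorphic D f /\
    (\int[lebesgue_Cspace R d]_(z in D) (Normc.normc (f z) ^+ 2)%:E < +oo)%E].

Definition bergman_ip (D : set (Cspace R d)) f g : R[i] :=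
  Cintegral D (fun z => f z * (g z)^*).

Definition fock_weight z : R :=
  pi ^- d * expR (- \sum_(i < d) Normc.normc (z ord0 i) ^+ 2).

Definition fock : set (Cspace R d -> R[i]) :=
  [set f | holomorphic setT f /\
    (\int[lebesgue_Cspace R d]_z (Normc.normc (f z) ^+ 2 * fock_weight z)%:E
       < +oo)%E].

Definition fock_ip f g : R[i] :=
  Cintegral setT (fun z => f z * (g z)^* * (fock_weight z)%:C).

(* p : {mpoly R[i][d]}, whose notation clashes with mathcomp-analysis *)
Definition poly_fun (p : mpoly d R[i]) : Cspace R d -> R[i] :=
  fun z => meval (fun i => z ord0 i) p.

Definition Mz (i : 'I_d) f : Cspace R d -> R[i] := fun z => z ord0 i * f z.

(* f = \sum_alpha a_alpha z^alpha on all of C^d, absolutely convergent;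
   [bmultinom d n] is the finite type of multi-indices of degree < n. *)
Definition entire_expansion f (a : multinom d -> R[i]) := forall z,
  (\esum_(al in [set: multinom d])
     (Normc.normc (a al * mmap1 (fun i => z ord0 i) al))%:E < +oo)%E /\
  (fun n => \sum_(al : bmultinom d n) a al * mmap1 (fun i => z ord0 i) al)
    @ \oo --> f z.

End function_spaces.

Section operator_L.
Context {R : realType} {d : nat} {V : lmodType R[i]}.
Implicit Types (T : 'I_d -> V -> V) (h u v : V) (ip : V -> V -> R[i])
  (H : set V) (iota : (Cspace R d -> R[i]) -> V).

Definition ip_norm ip v : R := Num.sqrt (complex.Re (ip v v)).

(* T^alpha h; the order of the factors is immaterial when the T_i commute *)
Definition opow T (al : multinom d) h : V :=
  foldr (fun i v => iter (al i) (T i) v) h (enum 'I_d).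

(* u = f(T) h = \sum_alpha a_alpha T^alpha h in the norm of ip *)
Definition is_funcalc ip T h (f : Cspace R d -> R[i]) u :=
  exists2 a : multinom d -> R[i], entire_expansion f a &
    (fun n => ip_norm ip
       (\sum_(al : bmultinom d n) a al *: opow T al h - u)) @ \oo --> (0 : R).

(* The Hilbert space is the set H of vectors of V with the form ip. As V is a
   function space below, ip may be degenerate on V: vectors at distance 0 are
   identified. *)
Definition is_iota H ip T h iota := forall f, fock f ->
  H (iota f) /\ is_funcalc ip T h f (iota f).

Definition is_adjoint H ip iota (iotas : V -> Cspace R d -> R[i]) :=
  forall u, H u -> fock (iotas u) /\
    forall f, fock f -> ip (iota f) u = fock_ip f (iotas u).

(* L_{T,h} = iota^* iota. Only the restriction of L to the Fock space is
   constrained; boundedness and commutation of the T_i and cyclicity of h are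
   properties of the data (H, ip, T, h), not part of the definition. *)
Definition is_L H ip T h (L : (Cspace R d -> R[i]) -> Cspace R d -> R[i]) :=
  exists iota iotas, [/\ is_iota H ip T h iota, is_adjoint H ip iota iotas &
    forall f, fock f -> L f = iotas (iota f)].

End operator_L.

Section eigenvalues.
Context {R : realType}.

Definition has_dim (V : lmodType R[i]) (E : set V) (n : nat) :=
  exists2 b : 'I_n -> V, (forall i, E (b i)) &
    forall v, E v -> exists! c : {ffun 'I_n -> R[i]}, v = \sum_i c i *: b i.

Definition fock_eigenspace d (L : (Cspace R d -> R[i]) -> Cspace R d -> R[i])
    (mu : R[i]) : set (Cspace R d -> R[i]) :=
  [set f | fock f /\ L f = mu *: f].

(* lambda 0, lambda 1, ... lists the nonzero eigenvalues of L in non-increasing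
   order: each mu <> 0 occurs exactly dim ker (L - mu) times, hence not at all
   when mu is not an eigenvalue. *)
Definition is_eigenvalue_seq d
    (L : (Cspace R d -> R[i]) -> Cspace R d -> R[i]) (lambda : R^nat) :=
  [/\ nonincreasing_seq lambda, forall k, lambda k != 0 &
    forall mu : R[i], mu != 0 -> exists2 n,
      has_dim (fock_eigenspace L mu) n &
      ([set k | (lambda k)%:C = mu] #= `I_n)%card].

End eigenvalues.

(* Main.v *)
(* Let e_0, e_1, ... be eigenvectors for lambda_0 >= lambda_1 >= ..., and note
   that <L f, g> is the inner product of f and g in L^2(Omega).

   Upper bound: if K >= N^d, there are more vectors e_0, ..., e_K than
   multi-indices of degree < N, so some nonzero combination f of them has no
   Taylor coefficient of degree < N.  The Cauchy estimates give
   |f| = O(2^-N) ||f|| on the bounded set Omega, whence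
   lambda_K ||f||^2 <= <L f, f> = O(4^-N) ||f||^2.

   Lower bound: fix a in Omega.  If K < N^d, some nonzero polynomial
   P = sum b_al (z - a)^al, with al in {0, ..., N-1}^d, is orthogonal to
   e_0, ..., e_(K-1).  Integrating |P|^2 over a polyannulus around a contained
   in Omega isolates each coefficient, while Gaussian moments bound ||P|| from
   above, so <L P, P> >= (Q N)^-4dN ||P||^2 for a constant Q.  By Montel's
   theorem the Rayleigh quotient attains its maximum on the orthogonal of
   e_0, ..., e_(K-1), at an eigenvector; so lambda_K >= (Q N)^-4dN.

   Taking N^d <= K < (N+1)^d, ln (1 / lambda_K) lies between constant multiples
   of N and N ln N, and ln K ~ d ln N. *)
From HB Require Import structures.
From mathcomp Require Import all_boot all_order all_algebra.
From mathcomp Require Import -(notations) mpoly.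
From mathcomp Require Import all_classical all_reals all_analysis.
From mathcomp Require Import measurable_realfun.
From mathcomp Require Import ring lra.
Require Import Defs.

Set Implicit Arguments.
Unset Strict Implicit.
Unset Printing Implicit Defensive.

Import Order.TTheory GRing.Theory Num.Theory numFieldNormedType.Exports.
Local Open Scope classical_set_scope.
Local Open Scope ring_scope.

(** * Rotation invariance of Lebesgue measure *)

(** All power series come from [hL]: [is_iota] asks every Fock function for an entire expansion, and
    this also yields measurability, boundedness on [Omega] and the vector space structure of the
    Fock space. Coefficients are isolated without contour integrals. Rotating the coordinates about
    a point multiplies each monomial by a number of modulus 1, and averaging a sum with a suitable
    rotation of itself cancels one monomial. By convexity this does not increase the norm over a
    rotation-invariant set, so a single term is bounded by the whole sum. The same argument serves
    at the centre 0, where it gives the Cauchy estimates, and at a point of [Omega], where it gives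
    the lower bound; about the measure it asks only for rotation invariance and for polyannuli of
    positive finite volume. The Bergman form does not see values outside [Omega], so forms are
    treated as positive semidefinite and null vectors are handled by Cauchy-Schwarz. The spectral
    argument is abstract: [B_compact], supplied by Montel's theorem, takes the place of
    completeness, and eigenvectors need be orthogonal only across distinct eigenvalues. *)

Section preserves.
Context d (T : measurableType d) (R : realType).

(** Invariance is stated through integrals of nonnegative functions, the form in which it composes
    and passes through iterated integrals. *)
Definition preserves (mu : set T -> \bar R) (psi : T -> T) :=
  measurable_fun setT psi /\
  forall G : T -> \bar R, measurable_fun setT G -> (forall x, 0 <= G x)%E ->
    (\int[mu]_x G (psi x) = \int[mu]_x G x)%E.

Lemma preserves_comp mu psi1 psi2 : preserves mu psi1 -> preserves mu psi2 ->
  preserves mu (psi1 \o psi2).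
Proof.
move=> [m1 i1] [m2 i2]; split; first exact: measurableT_comp.
move=> G mG G0 /=.
rewrite (i2 (G \o psi1) (measurableT_comp mG m1) (fun=> G0 _)).
exact: i1.
Qed.

End preserves.

Section prod_measure_tonelli.
Context d1 d2 (T1 : measurableType d1) (T2 : measurableType d2) (R : realType).
Variables (m1 : {sigma_finite_measure set T1 -> \bar R})
  (m2 : {sigma_finite_measure set T2 -> \bar R}) (G : T1 * T2 -> \bar R).
Hypotheses (mG : measurable_fun setT G) (G0 : forall x, (0 <= G x)%E).

Lemma prod_measure_tonelli1 :
  (\int[prod_measure m1 m2]_x G x = \int[m1]_x \int[m2]_y G (x, y))%E.
Proof. exact: fubini_tonelli1. Qed.

Lemma prod_measure_tonelli2 :
  (\int[prod_measure m1 m2]_x G x = \int[m2]_y \int[m1]_x G (x, y))%E.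
Proof. exact: fubini_tonelli2. Qed.

End prod_measure_tonelli.

Section plane.
Context {R : realType}.
Local Notation mu := (@lebesgue_measure R).
Local Notation mu2 := (prod_measure mu mu).

Lemma lebesgue_measure_shift (c : R) (A : set R) : measurable A ->
  mu ((fun x => x + c) @^-1` A) = mu A.
Proof.
move=> mA.
have mf : measurable_fun setT (fun x : measurableTypeR R => x + c : measurableTypeR R).
  exact: measurable_funD.
pose nu := measure_function_pushforward__canonical__measure_function_Measure mu mf.
(* Lebesgue measure is determined by its values on half-open intervals, so the translated measure is
   compared with it there. *)
rewrite [RHS](@lebesgue_measure_unique R nu _ A mA) //.
move=> _ [[a b] _ <-] /=.
rewrite /pushforward (_ : _ @^-1` _ = `]a - c, b - c]%classic).
  rewrite !lebesgue_measure_itv/= !lte_fin ltrD2r; case: ifPn => // _.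
  by rewrite !EFinN -!EFinB; congr EFin; ring.
by apply/seteqP; split => x /=; rewrite !in_itv/= ltrBlDr lerBrDr.
Qed.

Lemma ge0_integral_shift (c : R) (f : R -> \bar R) :
  measurable_fun setT f -> (forall x, 0 <= f x)%E ->
  (\int[mu]_x f (x + c)%R = \int[mu]_x f x)%E.
Proof.
move=> mf f0.
have ms : measurable_fun setT (fun x : measurableTypeR R => x + c : measurableTypeR R).
  exact: measurable_funD.
rewrite [RHS](@eq_measure_integral _ _ _ setT
  (measure_function_pushforward__canonical__measure_function_Measure mu ms))/=.
  by rewrite [RHS]ge0_integral_pushforward// => x _; exact: f0.
move=> A mA _; exact/esym/(lebesgue_measure_shift c).
Qed.

Local Notation preserves2 := (preserves mu2).

(** For a fixed second coordinate the shear is a translation of the first, so Tonelli reduces the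
    claim to translation invariance on the line. *)
Lemma preserves2_shear1 (t c : R) :
  preserves2 (fun x => (x.1 + (t * x.2 + c), x.2)).
Proof.
have mpsi : measurable_fun setT (fun x : R * R => (x.1 + (t * x.2 + c), x.2)).
  apply: measurable_fun_pair => //.
  by do 2 apply: measurable_funD => //; apply: measurable_funM.
split=> // G mG G0.
have mGpsi := measurableT_comp mG mpsi.
apply: (etrans (prod_measure_tonelli2 mu mu mGpsi (fun=> G0 _))).
apply: (etrans _ (esym (prod_measure_tonelli2 mu mu mG G0))).
apply: eq_integral => y _ /=.
apply: (@ge0_integral_shift (t * y + c) (fun x => G (x, y))) => //.
exact: measurableT_comp.
Qed.

Lemma preserves2_shear2 (t c : R) :
  preserves2 (fun x => (x.1, x.2 + (t * x.1 + c))).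
Proof.
have mpsi : measurable_fun setT (fun x : R * R => (x.1, x.2 + (t * x.1 + c))).
  apply: measurable_fun_pair => //.
  by do 2 apply: measurable_funD => //; apply: measurable_funM.
split=> // G mG G0.
have mGpsi := measurableT_comp mG mpsi.
apply: (etrans (prod_measure_tonelli1 mu mu mGpsi (fun=> G0 _))).
apply: (etrans _ (esym (prod_measure_tonelli1 mu mu mG G0))).
apply: eq_integral => x _ /=.
apply: (@ge0_integral_shift (t * x + c) (fun y => G (x, y))) => //.
exact: measurableT_comp.
Qed.

Definition rotation (a : R * R) (c s : R) (x : R * R) : R * R :=
  (a.1 + (c * (x.1 - a.1) - s * (x.2 - a.2)),
   a.2 + (c * (x.2 - a.2) + s * (x.1 - a.1))).

(* A rotation of angle other than pi is a product of three shears. *)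
Lemma preserves2_rotation a c s : c ^+ 2 + s ^+ 2 = 1 ->
  preserves2 (rotation a c s).
Proof.
have gen (c' s' : R) : c' ^+ 2 + s' ^+ 2 = 1 -> c' != -1 -> preserves2 (rotation a c' s').
  move=> cs c1; have c1' : 1 + c' != 0 by rewrite addrC -[1]opprK subr_eq0.
  (* For the angle [theta] with cosine [c'] and sine [s'], this is the tangent of [theta / 2], the
     slope of the two outer shears. *)
  pose t := s' / (1 + c').
  have := preserves_comp (preserves2_shear1 (- t) (t * a.2))
    (preserves_comp (preserves2_shear2 s' (- s' * a.1))
       (preserves2_shear1 (- t) (t * a.2))).
  set F := (X in preserves2 X); suff -> : F = rotation a c' s' by [].
  apply/funext => -[x y]; rewrite /F /rotation /=.
  have st : s' * t = 1 - c'.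
    apply: (mulIf c1'); rewrite /t mulrA mulfVK//; move: cs; rewrite !expr2; lra.
  have tc : t * (1 + c') = s' by rewrite /t mulfVK.
  congr pair.
    transitivity (x + (- t * y + t * a.2) - t * (y - a.2) - s' * t * (x - a.1 - t * (y - a.2))); first by ring.
    rewrite st; have -> : s' = t * (1 + c') by []. ring.
  transitivity (y + s' * (x - a.1) - s' * t * (y - a.2)); first by ring.
  by rewrite st; ring.
have [->|c1] := eqVneq c (-1); last by move=> ?; exact: gen.
move=> cs; have s0 : s = 0.
  by apply/eqP; rewrite -sqrf_eq0; apply/eqP; move: cs; rewrite sqrrN expr1n; lra.
(* The remaining half turn is the square of a quarter turn. *)
have g01 : preserves2 (rotation a 0 1).
  by apply: gen; [rewrite expr0n expr1n add0r|rewrite eq_sym oppr_eq0 oner_eq0].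
have := preserves_comp g01 g01.
set F := (X in preserves2 X); suff -> : F = rotation a (-1) s by [].
by apply/funext => -[x y]; rewrite /F /rotation s0/=; congr pair; ring.
Qed.

End plane.

Lemma ge0_integral_transport d1 d2 (T1 : measurableType d1)
    (T2 : measurableType d2) (R : realType)
    (mu : {sigma_finite_measure set T1 -> \bar R}) (f : T1 -> T2) (g : T2 -> T1)
    (mf : measurable_fun setT f) (mg : measurable_fun setT g)
    (fK : cancel f g) (F : T2 -> \bar R) :
  measurable_fun setT F -> (forall z, 0 <= F z)%E ->
  (\int[transport mu mf mg fK]_y F y = \int[mu]_x F (f x))%E.
Proof. by move=> mF F0; rewrite [LHS]ge0_integral_pushforward. Qed.

Section power_measure.
Context d (T : measurableType d) (R : realType).
Variable mu : {sigma_finite_measure set T -> \bar R}.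

Lemma ge0_integral_power_measureS n (G : n.+1.-tuple T -> \bar R) :
  measurable_fun setT G -> (forall x, 0 <= G x)%E ->
  (\int[power_measure mu n.+1]_t G t =
   \int[mu]_x \int[power_measure mu n]_t G (tuple_cons (x, t)))%E.
Proof.
move=> mG G0; have mc := @measurable_tuple_cons _ T n.
rewrite -(prod_measure_tonelli1 mu (power_measure mu n)
  (measurableT_comp mG mc) (fun=> G0 _)).
exact: (ge0_integral_transport (prod_measure mu (power_measure mu n)) mc
  (@measurable_tuple_uncons _ T n) (@tuple_consK _ T n) mG G0).
Qed.

Lemma integral_power_measure0 (G : 0.-tuple T -> \bar R) :
  measurable_fun setT G -> (\int[power_measure mu 0]_t G t = G [tuple])%E.
Proof. by move=> mG; rewrite [LHS]integral_dirac// diracT mul1e. Qed.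

(** Induction on [n]: Tonelli splits off the first coordinate, [psi ord0] acts on the partial
    integral [H] over the other coordinates, and the induction hypothesis acts inside [H]. *)
Lemma power_measure_preserves n (psi : 'I_n -> T -> T) :
  (forall i, preserves mu (psi i)) ->
  preserves (power_measure mu n)
    (fun t => [tuple psi i (tnth t i) | i < n]).
Proof.
elim: n psi => [|n IHn] psi ppsi.
  split=> [|G mG G0].
    apply/measurable_fun_tnthP => -[] //.
  rewrite !integral_power_measure0//; first by congr G; apply/val_inj; case: mktuple => -[].
  have -> : (fun t : 0.-tuple T => G [tuple psi i (tnth t i) | i < 0]) = G.
    by apply/funext => t; congr G; rewrite [LHS]tuple0 [RHS]tuple0.
  exact: mG.
have mpsi : measurable_fun setT
    (fun t : n.+1.-tuple T => [tuple psi i (tnth t i) | i < n.+1]).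
  apply/measurable_fun_tnthP => i.
  rewrite (_ : _ \o _ = fun t => psi i (tnth t i)); last first.
    by apply/funext => t /=; rewrite tnth_mktuple.
  by apply: measurableT_comp (measurable_tnth i); case: (ppsi i).
split=> // G mG G0.
rewrite (ge0_integral_power_measureS (measurableT_comp mG mpsi) (fun=> G0 _)).
rewrite ge0_integral_power_measureS//.
have mc := @measurable_tuple_cons _ T n.
pose Gc x := G (tuple_cons x).
have mGc : measurable_fun setT Gc by exact: measurableT_comp.
pose H x := (\int[power_measure mu n]_t Gc (x, t))%E.
have mH : measurable_fun setT H.
  apply: (measurable_fun_fubini_tonelli_F (m2 := power_measure mu n) Gc) => //.
  by move=> ?; exact: G0.
have H0 x : (0 <= H x)%E by apply: integral_ge0 => t _; exact: G0.
have [m0 i0] := ppsi ord0.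
rewrite -/(Gc _) -(i0 H mH H0); apply: eq_integral => x _.
have [_ i1] := IHn (fun i => psi (lift ord0 i)) (fun i => ppsi _).
have mGx : measurable_fun setT (fun t => Gc (psi ord0 x, t)).
  exact: measurableT_comp.
rewrite /H -(i1 _ mGx (fun=> G0 _)).
apply: eq_integral => t _; rewrite /Gc /=; congr G.
apply: eq_from_tnth => i; rewrite tnth_mktuple.
case: (unliftP ord0 i) => [j ->|->].
  by rewrite !tnthS tnth_mktuple.
by rewrite !tnth0.
Qed.

Lemma ge0_integral_power_measure_prod n (g : 'I_n -> T -> R) (I : 'I_n -> R) :
  (forall i, measurable_fun setT (g i)) -> (forall i x, 0 <= g i x) ->
  (forall i, \int[mu]_x (g i x)%:E = (I i)%:E)%E ->
  (\int[power_measure mu n]_t (\prod_(i < n) g i (tnth t i))%:E =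
   (\prod_(i < n) I i)%:E)%E.
Proof.
have mprod m (h : 'I_m -> T -> R) : (forall i, measurable_fun setT (h i)) ->
    measurable_fun setT (fun t : m.-tuple T => (\prod_(i < m) h i (tnth t i))).
  move=> mh; apply: measurable_prod => i _.
  exact: measurableT_comp (mh i) (measurable_tnth i).
elim: n g I => [|n IHn] g I mg g0 gI.
  rewrite integral_power_measure0 ?big_ord0//.
  by apply/measurable_EFinP; exact: mprod.
have mE := proj2 (measurable_EFinP _ _) (mprod n.+1 g mg).
have {}IHn := IHn (fun i => g (lift ord0 i)) (fun i => I (lift ord0 i))
  (fun i => mg _) (fun i => g0 _) (fun i => gI _).
have pr0 (t : n.-tuple T) : 0 <= \prod_(i < n) g (lift ord0 i) (tnth t i).
  by apply: prodr_ge0.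
have mE' := mprod n (fun i => g (lift ord0 i)) (fun i => mg _).
rewrite (ge0_integral_power_measureS mE); last first.
  by move=> t; rewrite lee_fin prodr_ge0.
transitivity (\int[mu]_x ((g ord0 x)%:E * (\prod_i I (lift ord0 i))%:E))%E; last first.
  rewrite ge0_integralZr//; first by rewrite gI big_ord_recl EFinM.
  - exact/measurable_EFinP.
  - by move=> x _; rewrite lee_fin.
  - by rewrite -IHn; apply: integral_ge0 => t _; rewrite lee_fin.
apply: eq_integral => x _; rewrite -IHn -ge0_integralZl//.
- apply: eq_integral => t _; rewrite -EFinM /= big_ord_recl; congr (_ * _)%:E.
  by apply: eq_bigr => i _; rewrite tnthS.
- exact/measurable_EFinP.
- by move=> t _; rewrite lee_fin.
- by rewrite lee_fin.
Qed.

End power_measure.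

Local Open Scope complex_scope.

(** * The modulus of a complex number *)

Section normc.
Context {R : realType}.
Implicit Types x y : R[i].
Local Notation nm := (@Normc.normc R).
Local Notation Re := (@complex.Re R).
Local Notation Im := (@complex.Im R).

Lemma normrE_normc x : `|x| = (nm x)%:C.
Proof. by case: x. Qed.

Lemma normc_ge0 x : 0 <= nm x.
Proof. by case: x => a b; exact: sqrtr_ge0. Qed.

Lemma normc_triangle x y : nm (x + y) <= nm x + nm y.
Proof. exact: le_normcD. Qed.

Lemma normc_opp x : nm (- x) = nm x.
Proof. exact: normcN. Qed.

Lemma normc_subC x y : nm (x - y) = nm (y - x).
Proof. by rewrite -normc_opp opprB. Qed.

Lemma normcX x n : nm (x ^+ n) = nm x ^+ n.
Proof.
by elim: n => [|n IHn]; rewrite ?expr0 ?Normc.normc1// !exprS Normc.normcM IHn.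
Qed.

Lemma normc_real (r : R) : nm r%:C = `|r|.
Proof. by rewrite /= expr0n addr0 sqrtr_sqr. Qed.

Lemma normc_sqr x : nm x ^+ 2 = Re x ^+ 2 + Im x ^+ 2.
Proof. by case: x => a b /=; rewrite sqr_sqrtr// addr_ge0 ?sqr_ge0. Qed.

Lemma mulr_conj x : x * x^* = (nm x ^+ 2)%:C.
Proof. by rewrite -sqr_normc normrE_normc rmorphXn. Qed.

Lemma normc_conj x : nm x^* = nm x.
Proof. by case: x => a b /=; rewrite sqrrN. Qed.

Lemma normc_prod (I : Type) (r : seq I) (P : pred I) (F : I -> R[i]) :
  nm (\prod_(i <- r | P i) F i) = \prod_(i <- r | P i) nm (F i).
Proof.
by apply: (big_morph nm); [exact: Normc.normcM|exact: Normc.normc1].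
Qed.

Lemma normc_sum (I : Type) (r : seq I) (P : pred I) (F : I -> R[i]) :
  nm (\sum_(i <- r | P i) F i) <= \sum_(i <- r | P i) nm (F i).
Proof.
elim/big_ind2: _ => [|x1 x2 y1 y2 h1 h2|//]; first by rewrite Normc.normc0.
by rewrite (le_trans (normc_triangle _ _))// lerD.
Qed.

Lemma normc_Re x : `|Re x| <= nm x.
Proof.
by case: x => a b /=; rewrite -sqrtr_sqr ler_wsqrtr// lerDl sqr_ge0.
Qed.

Lemma normc_Im x : `|Im x| <= nm x.
Proof.
by case: x => a b /=; rewrite -sqrtr_sqr ler_wsqrtr// lerDr sqr_ge0.
Qed.

Lemma normc_le_ReIm x : nm x <= `|Re x| + `|Im x|.
Proof.
have -> : x = (Re x)%:C + 'i * (Im x)%:C by rewrite {1}(complexE x) mulrC.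
rewrite (le_trans (normc_triangle _ _))// Normc.normcM !normc_real.
by rewrite [nm 'i]/= expr0n expr1n add0r sqrtr1 mul1r; case: x => ? ? /=; rewrite !(mul0r,mul1r,mulr0,addr0,add0r,subr0,oppr0).
Qed.

Lemma ReD x y : Re (x + y) = Re x + Re y. Proof. by case: x; case: y. Qed.
Lemma ImD x y : Im (x + y) = Im x + Im y. Proof. by case: x; case: y. Qed.
Lemma ReN x : Re (- x) = - Re x. Proof. by case: x. Qed.
Lemma ImN x : Im (- x) = - Im x. Proof. by case: x. Qed.
Lemma ReJ x : Re x^* = Re x. Proof. by case: x. Qed.
Lemma ReM x y : Re (x * y) = Re x * Re y - Im x * Im y.
Proof. by case: x; case: y. Qed.
Lemma ImM x y : Im (x * y) = Re x * Im y + Im x * Re y.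
Proof. by case: x; case: y. Qed.

Lemma conj_real (r : R) : Num.conj (r%:C : R[i]) = r%:C.
Proof. exact: conjc_real. Qed.

Lemma normc_sqrD x y : nm (x + y) ^+ 2 <= 2 * nm x ^+ 2 + 2 * nm y ^+ 2.
Proof.
rewrite (@le_trans _ _ ((nm x + nm y) ^+ 2))//.
  by rewrite lerXn2r ?nnegrE ?normc_ge0 ?normc_triangle// addr_ge0 ?normc_ge0.
have := sqr_ge0 (nm x - nm y); rewrite !expr2; lra.
Qed.

End normc.

(** * Coordinate rotations and product integrals on C^d *)

Section Cspace_measure.
Context {R : realType} {d : nat}.
Local Notation C := R[i].
Local Notation nm := (@Normc.normc R).
Local Notation leb := (lebesgue_Cspace R d).
Local Notation mu := (@lebesgue_measure R).
Local Notation mu2 := (prod_measure mu mu).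

Lemma ge0_integral_Cspace (F : Cspace R d -> \bar R) :
  measurable_fun setT F -> (forall z, 0 <= F z)%E ->
  (\int[leb]_z F z = \int[power_measure mu2 d]_t F (Cspace_of_tuple t))%E.
Proof.
exact: (ge0_integral_transport (power_measure mu2 d)
  (@measurable_Cspace_of_tuple R d) (@measurable_tuple_of_Cspace R d)
  (@Cspace_of_tupleK R d)).
Qed.

Definition rotC (a : Cspace R d) (w : 'I_d -> C) (z : Cspace R d) : Cspace R d :=
  \row_j (a ord0 j + w j * (z ord0 j - a ord0 j)).

Lemma preserves_rotC a w : (forall j, nm (w j) = 1) -> preserves leb (rotC a w).
Proof.
move=> w1.
pose psi j := rotation (Ccoord j a) (complex.Re (w j)) (complex.Im (w j)).
have ppsi j : preserves mu2 (psi j).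
  by apply: preserves2_rotation; rewrite -normc_sqr w1 expr1n.
have [mrot rot] := power_measure_preserves ppsi.
have rotE t : rotC a w (Cspace_of_tuple t) =
    Cspace_of_tuple [tuple psi i (tnth t i) | i < d].
  apply/rowP => j; rewrite !mxE tnth_mktuple /psi /rotation /Ccoord.
  by case: (a ord0 j) (w j) (tnth t j) => [? ?] [? ?] [? ?].
have mR : measurable_fun setT (rotC a w).
  rewrite (_ : rotC a w = @Cspace_of_tuple R d \o
    (fun t => [tuple psi i (tnth t i) | i < d]) \o @tuple_of_Cspace R d).
    apply: measurableT_comp; last exact: measurable_tuple_of_Cspace.
    by apply: measurableT_comp => //; exact: measurable_Cspace_of_tuple.
  apply/funext => z /=; rewrite -rotE; congr rotC.
  by apply/rowP => j; rewrite mxE tnth_mktuple /Ccoord; case: (z ord0 j).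
split => // G mG G0.
rewrite (ge0_integral_Cspace (measurableT_comp mG mR) (fun=> G0 _)).
rewrite (ge0_integral_Cspace mG G0).
rewrite -(rot _ (measurableT_comp mG (@measurable_Cspace_of_tuple R d)) (fun=> G0 _)).
by apply: eq_integral => t _ /=; rewrite rotE.
Qed.

Lemma ge0_integral_Cspace_prod (g : 'I_d -> R * R -> R) (I : 'I_d -> R) :
  (forall i, measurable_fun setT (g i)) -> (forall i x, 0 <= g i x) ->
  (forall i, \int[mu2]_x (g i x)%:E = (I i)%:E)%E ->
  (\int[leb]_z (\prod_(i < d) g i (Ccoord i z))%:E = (\prod_i I i)%:E)%E.
Proof.
move=> mg g0 gI; rewrite ge0_integral_Cspace.
- rewrite -(@ge0_integral_power_measure_prod _ _ _ mu2 d g I mg g0 gI).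
  apply: eq_integral => t _; congr EFin; apply: eq_bigr => i _; congr g.
  by rewrite -[in RHS](Cspace_of_tupleK t) tnth_mktuple.
- apply/measurable_EFinP; apply: measurable_prod => i _.
  exact: measurableT_comp (mg i) (measurable_Ccoord i).
- by move=> z; rewrite lee_fin prodr_ge0.
Qed.

End Cspace_measure.

(** * Measurable complex-valued functions *)

Section cmeasurable.
Context {d0} {T : measurableType d0} {R : realType}.
Local Notation nm := (@Normc.normc R).
Implicit Types (D : set T) (f g : T -> R[i]).

(** The two parts are kept separate because [Cintegral] integrates them separately. *)
Definition cmeasurable D f := measurable_fun D (fun z => complex.Re (f z)) /\
  measurable_fun D (fun z => complex.Im (f z)).

Lemma cmeasurable_cst D c : cmeasurable D (fun=> c).
Proof. by split; exact: measurable_cst. Qed.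

Lemma cmeasurableS D D' f : measurable D' -> D `<=` D' ->
  cmeasurable D' f -> cmeasurable D f.
Proof. by move=> mD DD' [m1 m2]; split; exact: measurable_funS m1 || exact: measurable_funS m2. Qed.

Lemma cmeasurableD D f g : cmeasurable D f -> cmeasurable D g ->
  cmeasurable D (fun z => f z + g z).
Proof.
move=> [f1 f2] [g1 g2]; split.
  under eq_fun do rewrite ReD; exact: measurable_funD.
under eq_fun do rewrite ImD; exact: measurable_funD.
Qed.

Lemma cmeasurableN D f : cmeasurable D f -> cmeasurable D (fun z => - f z).
Proof.
move=> [f1 f2]; split.
  under eq_fun do rewrite ReN; exact: measurable_funN.
under eq_fun do rewrite ImN; exact: measurable_funN.
Qed.

Lemma cmeasurableB D f g : cmeasurable D f -> cmeasurable D g ->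
  cmeasurable D (fun z => f z - g z).
Proof. by move=> mf mg; apply: cmeasurableD => //; exact: cmeasurableN. Qed.

Lemma cmeasurableM D f g : cmeasurable D f -> cmeasurable D g ->
  cmeasurable D (fun z => f z * g z).
Proof.
move=> [f1 f2] [g1 g2]; split.
  under eq_fun do rewrite ReM; by apply: measurable_funB; exact: measurable_funM.
under eq_fun do rewrite ImM; by apply: measurable_funD; exact: measurable_funM.
Qed.

Lemma cmeasurable_conj D f : cmeasurable D f -> cmeasurable D (fun z => (f z)^*).
Proof.
move=> [f1 f2]; split.
  by rewrite (_ : (fun z => complex.Re (f z)^*) = (fun z => complex.Re (f z)))//; apply/funext => z; case: (f z).
rewrite (_ : (fun z => complex.Im (f z)^*) = (fun z => - complex.Im (f z))).
  exact: measurable_funN.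
by apply/funext => z; case: (f z).
Qed.

Lemma cmeasurable_real D (f : T -> R) : measurable_fun D f ->
  cmeasurable D (fun z => (f z)%:C).
Proof. by move=> mf; split => //=; exact: measurable_cst. Qed.

Lemma cmeasurable_sum D (I : Type) (s : seq I) (P : pred I) (F : I -> T -> R[i]) :
  (forall i, cmeasurable D (F i)) ->
  cmeasurable D (fun z => \sum_(i <- s | P i) F i z).
Proof.
move=> mF; elim: s => [|i s IHs].
  under eq_fun do rewrite big_nil; exact: cmeasurable_cst.
under eq_fun do rewrite big_cons.
by case: (P i) => //; exact: cmeasurableD.
Qed.

Lemma cmeasurable_prod D (I : Type) (s : seq I) (P : pred I) (F : I -> T -> R[i]) :
  (forall i, cmeasurable D (F i)) ->
  cmeasurable D (fun z => \prod_(i <- s | P i) F i z).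
Proof.
move=> mF; elim: s => [|i s IHs].
  under eq_fun do rewrite big_nil; exact: cmeasurable_cst.
under eq_fun do rewrite big_cons.
by case: (P i) => //; exact: cmeasurableM.
Qed.

Lemma cmeasurableX D f n : cmeasurable D f -> cmeasurable D (fun z => f z ^+ n).
Proof.
move=> mf; elim: n => [|n IHn].
  under eq_fun do rewrite expr0; exact: cmeasurable_cst.
by under eq_fun do rewrite exprS; exact: cmeasurableM.
Qed.

Lemma measurable_normc_sqr D f : cmeasurable D f ->
  measurable_fun D (fun z => nm (f z) ^+ 2).
Proof.
move=> [f1 f2]; under eq_fun do rewrite normc_sqr.
by apply: measurable_funD; exact: measurable_funX.
Qed.

Lemma cmeasurable_cvg D (h : nat -> T -> R[i]) f :
  (forall n, cmeasurable D (h n)) ->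
  (forall z, D z -> (fun n => nm (h n z - f z)) @ \oo --> (0 : R)) ->
  cmeasurable D f.
Proof.
move=> mh hf; split.
  apply: (measurable_fun_cvg (h := fun n z => complex.Re (h n z))) => [n|z Dz].
    by case: (mh n).
  apply/cvgrPdist_le => e e0.
  have /cvgrPdist_le/(_ e e0) := hf z Dz; apply: filterS => n.
  rewrite sub0r normrN (ger0_norm (normc_ge0 _)) distrC; apply: le_trans.
  by rewrite -ReN -ReD normc_Re.
apply: (measurable_fun_cvg (h := fun n z => complex.Im (h n z))) => [n|z Dz].
  by case: (mh n).
apply/cvgrPdist_le => e e0.
have /cvgrPdist_le/(_ e e0) := hf z Dz; apply: filterS => n.
rewrite sub0r normrN (ger0_norm (normc_ge0 _)) distrC; apply: le_trans.
by rewrite -ImN -ImD normc_Im.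
Qed.

End cmeasurable.

(** * Open sets, polydiscs and measurability in C^d *)

Section Cspace_topology.
Context {R : realType} {d : nat}.
Local Notation nm := (@Normc.normc R).
Implicit Types (z w : Cspace R d) (U : set (Cspace R d)).

Lemma cmeasurable_coord D (i : 'I_d) :
  cmeasurable D (fun z : Cspace R d => z ord0 i).
Proof.
have m := @measurable_Ccoord R d i.
by split; apply: (measurable_funS measurableT) => //;
  [have := measurableT_comp (@measurable_fst _ _ R R) m
  |have := measurableT_comp (@measurable_snd _ _ R R) m].
Qed.

(** The norm of a normed space over [R[i]] takes its values in [R[i]]; its real part brings it back
    to [R]. *)
Lemma normr_rowE z : `|z| = (complex.Re `|z|)%:C.
Proof. by rewrite RRe_real// normr_real. Qed.

Lemma Re_normr_ge0 z : 0 <= complex.Re `|z|.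
Proof. by rewrite -lecR -normr_rowE; exact: (normr_ge0 z). Qed.

Lemma normr_row_le z (e : R) : 0 <= e ->
  (forall i, nm (z ord0 i) <= e) -> `|z| <= e%:C.
Proof.
move=> e0 ze; have e0' : (0 : R[i]) <= e%:C by rewrite lecR.
have -> : `|z| = mx_norm z by [].
rewrite mx_normE -[e%:C]/((NngNum e0')%:num) num_le; apply/bigmax_leP.
split=> [|[i j] _]; first by rewrite -num_le.
by rewrite -num_le/= normrE_normc (ord1 i) lecR.
Qed.

Lemma normc_coord_le z i : nm (z ord0 i) <= complex.Re `|z|.
Proof.
rewrite -lecR -normr_rowE -normrE_normc.
have -> : `|z| = mx_norm z by [].
rewrite mx_normE.
set B := (X in X%:num).
have : B <= B by exact: lexx.
by move=> /bigmax_leP[_ /(_ (ord0, i) isT)]; rewrite -num_le.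
Qed.

Definition polyball z (e : R) : set (Cspace R d) :=
  [set w | forall i, nm (w ord0 i - z ord0 i) < e].

Lemma nbhs_polyball z U : nbhs z U -> exists2 e : R, 0 < e & polyball z e `<=` U.
Proof.
move=> /nbhs_normP[e /= e0 eU].
have er : e = (complex.Re e)%:C by rewrite RRe_real// gtr0_real.
have re0 : 0 < complex.Re e by rewrite -ltcR -er.
exists (complex.Re e / 2); first by rewrite divr_gt0.
move=> w wz; apply: eU => /=; rewrite er.
have /le_lt_trans : `|z - w| <= (complex.Re e / 2)%:C.
  apply: normr_row_le => [|i]; first by rewrite divr_ge0// ltW.
  by rewrite !mxE normc_subC ltW.
by apply; rewrite ltcR ltr_pdivrMr// ltr_pMr// ltr1n.
Qed.

(** The sigma-algebra is generated by the coordinates, not by the open sets. A set that is open in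
    the sense of the hypothesis is the union of the boxes [rball] inside it, which have rational
    centres and radii [1 / (n + 1)] and so are countably many. *)
Lemma polyball_measurable U :
  (forall z, U z -> exists2 e : R, 0 < e & polyball z e `<=` U) -> measurable U.
Proof.
move=> Uopen.
pose rball (q : {ffun 'I_d -> rat * rat}) (n : nat) : set (Cspace R d) :=
  [set w | forall i, `|complex.Re (w ord0 i) - ratr (q i).1| < n.+1%:R^-1 /\
                    `|complex.Im (w ord0 i) - ratr (q i).2| < n.+1%:R^-1].
have mball (q : {ffun 'I_d -> rat * rat}) (n : nat) : measurable (rball q n).
  have mb (f : Cspace R d -> R) (a e : R) : measurable_fun setT f ->
      measurable [set w | `|f w - a| < e].
    move=> mf; rewrite -[X in measurable X]setTI.
    have -> : [set w | `|f w - a| < e] = f @^-1` `]a - e, a + e[%classic.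
      by apply/seteqP; split => w /=; rewrite in_itv/= ltr_distl.
    by apply: mf => //; exact: measurable_itv.
  rewrite (_ : rball q n = \bigcap_(i in [set: 'I_d])
    ([set w | `|complex.Re (w ord0 i) - ratr (q i).1| < n.+1%:R^-1] `&`
     [set w | `|complex.Im (w ord0 i) - ratr (q i).2| < n.+1%:R^-1])).
    apply: fin_bigcap_measurable => // i _.
    by have [? ?] := cmeasurable_coord setT i; apply: measurableI; exact: mb.
  by apply/seteqP; split => w => [h i _|h i]; [exact: (h i)|exact: (h i I)].
pose I := ({ffun 'I_d -> rat * rat} * nat)%type.
pose F (p : I) := if `[<rball p.1 p.2 `<=` U>] then rball p.1 p.2 else set0.
suff -> : U = \bigcup_p F p.
  apply: countable_bigcupT_measurable => [|p]; first exact: countableP.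
  by rewrite /F; case: ifP.
apply/seteqP; split => [z Uz|z [p _]]; last first.
  by rewrite /F; case: ifPn => // /asboolP pU /pU.
have [e e0 eU] := Uopen z Uz.
(* Going from [z] to [w] through the centre of the box costs two radii in the real part and two in
   the imaginary part. *)
have [n ne] : exists n : nat, 4 * n.+1%:R^-1 < e.
  exists (Num.truncn (4 / e)); rewrite ltr_pdivrMr// mulrC -ltr_pdivrMr//.
  exact: truncnS_gt.
have n0 : 0 < n.+1%:R^-1 :> R by rewrite invr_gt0.
have appr (x : R) : exists q : rat, `|x - ratr q| < n.+1%:R^-1.
  have lt : x - n.+1%:R^-1 < x + n.+1%:R^-1.
    by rewrite ltrBlDr -addrA ltrDl addr_gt0.
  have [q] := rat_in_itvoo lt.
  by rewrite in_itv/= => ?; exists q; rewrite distrC ltr_distl.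
have [app appP] := choice appr.
pose q := [ffun i => (app (complex.Re (z ord0 i)), app (complex.Im (z ord0 i)))].
have zq : rball q n z by move=> i; rewrite /q ffunE.
exists (q, n) => //; rewrite /F ifT//; apply/asboolP => w wq.
apply: eU => i; rewrite (le_lt_trans _ ne)// (le_trans (normc_le_ReIm _))//.
rewrite ReD ImD ReN ImN.
have [h1 h2] := zq i; have [h3 h4] := wq i.
have := ler_distD (ratr (q i).1) (complex.Re (w ord0 i)) (complex.Re (z ord0 i)).
have := ler_distD (ratr (q i).2) (complex.Im (w ord0 i)) (complex.Im (z ord0 i)).
rewrite distrC in h1; rewrite distrC in h2.
move: h1 h2 h3 h4 => /=; set t := n.+1%:R^-1; clearbody t; lra.
Qed.

Lemma open_Cspace_measurable U : open U -> measurable U.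
Proof.
by move=> oU; apply: polyball_measurable => z Uz; apply: nbhs_polyball; exact: open_nbhs_nbhs.
Qed.

Lemma bounded_set_Cspace U : bounded_set U ->
  exists2 M : R, 0 < M & forall z, U z -> forall i, nm (z ord0 i) <= M.
Proof.
move=> /ex_strict_bound_gt0[M M0 UM].
have er : M = (complex.Re M)%:C by rewrite RRe_real// gtr0_real.
exists (complex.Re M); first by rewrite -ltcR -er.
move=> z Uz i; rewrite (le_trans (normc_coord_le z i))// -lecR -normr_rowE -er.
by apply/ltW; exact: UM.
Qed.

Lemma holomorphic_cmeasurable U f : open U -> holomorphic U f -> cmeasurable U f.
Proof.
move=> oU hf.
(* Real and imaginary part are both 1-Lipschitz, so one argument covers them: by continuity of [f]
   at the points of [U], the preimage in [U] of an open ray contains a polydisc around each of its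
   points. *)
have key (g : R[i] -> R) : (forall x y, `|g x - g y| <= nm (x - y)) ->
    measurable_fun U (fun z => g (f z)).
  move=> gL; apply: (measurability _ (RGenOInfty.measurableE R)) => //.
  move=> /= _ [_ [c ->] <-]; apply: polyball_measurable => z [Uz]; rewrite /= in_itv/= andbT => cz.
  have /differentiable_continuous/cvgrPdist_lt fz := hf z Uz.
  have e0 : 0 < (g (f z) - c)%:C by rewrite ltcR subr_gt0.
  have /nbhs_polyball[e1 e10 e1P] := fz _ e0.
  have /nbhs_polyball[e2 e20 e2P] : nbhs z U by exact: open_nbhs_nbhs.
  exists (Num.min e1 e2); first by rewrite lt_min e10.
  move=> w wz; split.
    by apply: e2P => i; rewrite (lt_le_trans (wz i))// ge_min lexx orbT.
  have /e1P/= : polyball z e1 w.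
    by move=> i; rewrite (lt_le_trans (wz i))// ge_min lexx.
  rewrite in_itv/= andbT normrE_normc ltcR => /(le_lt_trans (gL _ _)).
  by rewrite ltr_distlC => /andP[]; rewrite subKr.
by split; apply: key => x y; [rewrite -ReN -ReD normc_Re|rewrite -ImN -ImD normc_Im].
Qed.

Lemma cvgC_normc (u : nat -> R[i]) (l : R[i]) : u @ \oo --> l ->
  (fun n => nm (u n - l)) @ \oo --> (0 : R).
Proof.
move=> /cvgrPdist_lt ul; apply/cvgrPdist_lt => e e0.
have e0' : 0 < e%:C by rewrite ltcR.
have := ul _ e0'; apply: filterS => n.
by rewrite sub0r normrN (ger0_norm (normc_ge0 _)) normrE_normc ltcR normc_subC.
Qed.

End Cspace_topology.

(** * Monomials on polyannuli *)

Section annulus.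
Context {R : realType} {d : nat}.
Local Notation nm := (@Normc.normc R).
Local Notation leb := (lebesgue_Cspace R d).
Local Notation mu := (@lebesgue_measure R).
Local Notation mu2 := (prod_measure mu mu).

Definition annulus2 (a : R * R) (r : R) : set (R * R) :=
  [set x | r ^+ 2 <= (x.1 - a.1) ^+ 2 + (x.2 - a.2) ^+ 2 < (2 * r) ^+ 2].

Lemma annulus2_measurable a r : measurable (annulus2 a r).
Proof.
pose f (x : R * R) := (x.1 - a.1) ^+ 2 + (x.2 - a.2) ^+ 2.
have mf : measurable_fun setT f.
  by apply: measurable_funD; apply: measurable_funX; apply: measurable_funB.
rewrite -[X in measurable X]setTI.
have -> : annulus2 a r = f @^-1` `[r ^+ 2, (2 * r) ^+ 2[%classic.
  by apply/seteqP; split => x /=; rewrite in_itv.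
by apply: mf => //; exact: measurable_itv.
Qed.

(** Only positivity and finiteness matter, so the annulus is compared with an inscribed rectangle of
    sides [r / 2] and [r] and with a circumscribed square of side [4 * r]. *)
Lemma annulus2_volume a r : 0 < r ->
  exists2 V : R, 0 < V & mu2 (annulus2 a r) = V%:E.
Proof.
move=> r0.
have len (x y : R) : x <= y -> mu `[x, y]%classic = (y - x)%:E.
  move=> xy; rewrite lebesgue_measure_itv/= lte_fin.
  by case: ltgtP xy => // ->; rewrite subrr.
have rect (x y u v : R) : x <= y -> u <= v ->
    mu2 (`[x, y]%classic `*` `[u, v]%classic) = ((y - x) * (v - u))%:E.
  move=> xy uv; rewrite EFinM -(len _ _ xy) -(len _ _ uv).
  exact: (@product_measure1E _ _ _ _ R mu mu _ _ (measurable_itv `[x, y]) (measurable_itv `[u, v])).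
have mA := annulus2_measurable a r.
have mrect (x y u v : R) : measurable (`[x, y]%classic `*` `[u, v]%classic : set (R * R)).
  by apply: measurableX; exact: measurable_itv.
have le_up : (mu2 (annulus2 a r) <= (4 * r * (4 * r))%:E)%E.
  have <- : ((a.1 + 2 * r - (a.1 - 2 * r)) * (a.2 + 2 * r - (a.2 - 2 * r))) = 4 * r * (4 * r) by ring.
  rewrite -rect; [|lra|lra].
  apply: le_measure; rewrite ?inE//; first exact: mrect.
  move=> [x y] /=; rewrite /annulus2 /= => /andP[_ h].
  have [hx hy] : `|x - a.1| <= 2 * r /\ `|y - a.2| <= 2 * r.
    split; rewrite -(@ler_pXn2r _ 2)// ?nnegrE ?normr_ge0 ?mulr_ge0 ?(ltW r0)// real_normK ?num_real//;
      rewrite (le_trans _ (ltW h))// ?lerDl ?lerDr sqr_ge0//.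
  move: hx hy; rewrite !ler_distl !in_itv/= => /andP[-> ->] /andP[-> ->] //.
have le_lo : ((r / 2 * r)%:E <= mu2 (annulus2 a r))%E.
  have <- : ((a.1 + 3 / 2 * r - (a.1 + r)) * (a.2 + r - a.2)) = r / 2 * r by field.
  rewrite -rect; [|lra|lra].
  apply: le_measure; rewrite ?inE//; first exact: mrect.
  move=> [x y] /=; rewrite !in_itv/= => -[/andP[x1 x2] /andP[y1 y2]].
  rewrite /annulus2/=; set u := x - a.1; set v := y - a.2.
  have [u1 u2] : r <= u /\ u <= 3 / 2 * r by split; rewrite /u; lra.
  have [v1 v2] : 0 <= v /\ v <= r by split; rewrite /v; lra.
  clearbody u v; apply/andP; split; nra.
have fin : mu2 (annulus2 a r) \is a fin_num.
  by rewrite ge0_fin_numE// (le_lt_trans le_up)// ltry.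
exists (fine (mu2 (annulus2 a r))); last by rewrite fineK.
rewrite -lte_fin fineK// (lt_le_trans _ le_lo)// lte_fin mulr_gt0// divr_gt0//.
Qed.

(** Annuli instead of discs keep every coordinate of [z - a] away from 0, so that monomials are
    bounded from below; rotations about [a] preserve the set. *)
Definition polyannulus (a : Cspace R d) (r : R) : set (Cspace R d) :=
  [set z | forall i, r <= nm (z ord0 i - a ord0 i) < 2 * r].

Lemma polyannulusE a r : 0 < r -> polyannulus a r =
  \bigcap_(i in [set: 'I_d]) (Ccoord i @^-1` annulus2 (Ccoord i a) r).
Proof.
move=> r0.
have E (z : Cspace R d) i : (r <= nm (z ord0 i - a ord0 i) < 2 * r) =
    (r ^+ 2 <= (complex.Re (z ord0 i) - complex.Re (a ord0 i)) ^+ 2 +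
      (complex.Im (z ord0 i) - complex.Im (a ord0 i)) ^+ 2 < (2 * r) ^+ 2).
  rewrite -!(ReN, ImN) -ReD -ImD -normc_sqr.
  by rewrite ler_pXn2r ?nnegrE ?normc_ge0 ?(ltW r0)// ltr_pXn2r ?nnegrE ?normc_ge0 ?mulr_ge0 ?(ltW r0).
apply/seteqP; split => z h i; first by move=> _; rewrite /= /annulus2 /= -E; exact: h.
by rewrite E; exact: (h i I).
Qed.

Lemma polyannulus_measurable a r : 0 < r -> measurable (polyannulus a r).
Proof.
move=> r0; rewrite polyannulusE//; apply: fin_bigcap_measurable => // i _.
rewrite -[X in measurable X]setTI; apply: measurable_Ccoord => //.
exact: annulus2_measurable.
Qed.

Lemma polyannulus_volume a r : 0 < r ->
  exists2 V : R, 0 < V & leb (polyannulus a r) = V%:E.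
Proof.
move=> r0.
have /choice[V VP] i : exists V : R, 0 < V /\ mu2 (annulus2 (Ccoord i a) r) = V%:E.
  by have [V ? ?] := annulus2_volume (@Ccoord R d i a) r0; exists V.
pose g i : R * R -> R := \1_(annulus2 (@Ccoord R d i a) r).
have := @ge0_integral_Cspace_prod R d g V.
have mg i : measurable_fun setT (g i).
  by apply: measurable_indic; exact: annulus2_measurable.
move=> /(_ mg) H; exists (\prod_i V i).
  by apply: prodr_gt0 => i _; case: (VP i).
rewrite -H.
- transitivity (\int[leb]_z (\1_(polyannulus a r) z)%:E)%E.
    have mP := polyannulus_measurable a r0.
    by rewrite integral_indic ?setIT.
  apply: eq_integral => z _; congr EFin.
  rewrite polyannulusE// indicE; case: (asboolP ((\bigcap_(i in [set: 'I_d]) (Ccoord i @^-1` annulus2 (Ccoord i a) r)) z)) => h.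
    rewrite mem_set// big1// => i _; rewrite /g indicE mem_set//; exact: h.
  rewrite memNset//; apply/esym/eqP; rewrite prodf_seq_eq0.
  apply/hasP; apply: contrapT => h'; apply: h => i _ /=; apply: contrapT => nai; apply: h'.
  exists i; first by rewrite mem_index_enum.
  by rewrite /g indicE memNset//= eqxx.
- move=> i x; by rewrite /g indicE ler0n.
- move=> i; have mA := annulus2_measurable (@Ccoord R d i a) r.
  by rewrite /g integral_indic ?setIT//; case: (VP i).
Qed.

Lemma polyannulus_rotC a r w : (forall j, nm (w j) = 1) ->
  rotC a w @^-1` polyannulus a r = polyannulus a r.
Proof.
move=> w1; apply/seteqP; split => z /= h i; have := h i;
  by rewrite mxE [a ord0 i + _]addrC addrK Normc.normcM w1 mul1r.
Qed.

End annulus.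

Section monomials.
Context {R : realType} {d : nat}.
Local Notation C := R[i].
Local Notation nm := (@Normc.normc R).
Local Notation leb := (lebesgue_Cspace R d).
Implicit Types (a z : Cspace R d) (al be : multinom d).

Definition mon a al z : C := mmap1 (fun i => z ord0 i - a ord0 i) al.

Lemma mon0E al z : mon 0 al z = mmap1 (fun i => z ord0 i) al.
Proof. by apply: eq_bigr => i _; rewrite mxE subr0. Qed.

Lemma cmeasurable_mon D a al : cmeasurable D (mon a al).
Proof.
apply: cmeasurable_prod => i; apply: cmeasurableX; apply: cmeasurableB.
  exact: cmeasurable_coord.
exact: cmeasurable_cst.
Qed.

Lemma normc_mon a al z : nm (mon a al z) = \prod_i nm (z ord0 i - a ord0 i) ^+ al i.
Proof. by rewrite normc_prod; apply: eq_bigr => i _; rewrite normcX. Qed.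

Lemma prod_const_mdeg (K : comPzRingType) (x : K) al : \prod_i x ^+ al i = x ^+ mdeg al.
Proof. by rewrite prodrXr mdegE. Qed.

Lemma normc_mon_le a al z (r : R) :
  (forall i, nm (z ord0 i - a ord0 i) <= r) -> nm (mon a al z) <= r ^+ mdeg al.
Proof.
move=> h; rewrite normc_mon -prod_const_mdeg; apply: ler_prod => i _.
rewrite exprn_ge0 ?normc_ge0//=.
by rewrite lerXn2r ?nnegrE ?normc_ge0// (le_trans _ (h i)) ?normc_ge0.
Qed.

Lemma normc_mon_ge a al z (r : R) : 0 <= r ->
  (forall i, r <= nm (z ord0 i - a ord0 i)) -> r ^+ mdeg al <= nm (mon a al z).
Proof.
move=> r0 h; rewrite normc_mon -prod_const_mdeg; apply: ler_prod => i _.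
by rewrite exprn_ge0//= lerXn2r ?nnegrE ?normc_ge0.
Qed.

Lemma mon_rotC a al w z :
  mon a al (rotC a w z) = (\prod_i w i ^+ al i) * mon a al z.
Proof.
rewrite -big_split/=; apply: eq_bigr => i _.
by rewrite mxE [a ord0 i + _]addrC addrK exprMn.
Qed.

Lemma root_of_m1 (m : nat) : (0 < m)%N ->
  exists2 w : C, nm w = 1 & w ^+ m = -1.
Proof.
move=> m0; exists (m.-root (-1)); last exact: rootCK.
apply/eqP; rewrite -(@pexpr_eq1 _ _ m) ?normc_ge0//.
by rewrite -normcX rootCK// normc_opp Normc.normc1.
Qed.

(** Rotate one coordinate in which the exponents differ by [m > 0], using an [m]-th root of -1. The
    two monomials are then multiplied by opposite factors, which makes one of them cancel in an
    average. *)
Lemma separating_rotC al be : al != be -> exists w : 'I_d -> C,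
  (forall j, nm (w j) = 1) /\
  \prod_i w i ^+ be i = - \prod_i w i ^+ al i.
Proof.
move=> ab.
have [i abi] : exists i, al i != be i.
  apply: contrapT => h; move/negP: ab; apply; apply/eqP/mnmP => i.
  by apply/eqP; apply: contrapT => /negP ?; apply: h; exists i.
have gen (u v : multinom d) : (u i < v i)%N -> exists w : 'I_d -> C,
    (forall j, nm (w j) = 1) /\ \prod_j w j ^+ v j = - \prod_j w j ^+ u j.
  move=> uv; have uv0 : (0 < v i - u i)%N by rewrite subn_gt0.
  have [w w1 wm] := root_of_m1 uv0.
  exists (fun j => if j == i then w else 1); split.
    by move=> j; case: ifP => // _; exact: Normc.normc1.
  rewrite (bigD1 i)//= [in RHS](bigD1 i)//= eqxx !big1 ?mulr1.
  - by rewrite -(subnK (ltnW uv)) exprD wm mulN1r.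
  - by move=> j /negbTE ->; rewrite expr1n.
  - by move=> j /negbTE ->; rewrite expr1n.
have [/gen//|/gen[w [w1 wE]]|] := ltngtP (al i) (be i); last by move/eqP: abi.
by exists w; split => //; rewrite wE opprK.
Qed.

Local Notation N2 D f := (\int[leb]_(z in D) (nm (f z) ^+ 2)%:E)%E.

Lemma integral_rotC a w D f : (forall j, nm (w j) = 1) ->
  measurable D -> rotC a w @^-1` D = D -> cmeasurable setT f ->
  N2 D (f \o rotC a w) = N2 D f.
Proof.
move=> w1 mD DD mf.
have [mr pr] := preserves_rotC a w1.
have mf2 : measurable_fun D (fun z => (nm (f z) ^+ 2)%:E).
  apply/measurable_EFinP; apply: (measurable_funS measurableT) => //.
  exact: measurable_normc_sqr.
rewrite integral_mkcond [RHS]integral_mkcond -[RHS]pr.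
- apply: eq_integral => z _; rewrite /patch.
  have -> // : (z \in D) = (rotC a w z \in D).
  by rewrite -{1}DD; apply/idP/idP; rewrite !inE.
- exact/(measurable_restrictT _ mD).
- by move=> z; rewrite /patch; case: ifP => // _; rewrite lee_fin sqr_ge0.
Qed.

(** Convexity of the squared modulus, applied below to a function and a rotation of it. *)
Lemma integral_average_le D f g : measurable D ->
  cmeasurable setT f -> cmeasurable setT g -> N2 D g = N2 D f ->
  (N2 D (fun z => (f z + g z) / 2) <= N2 D f)%E.
Proof.
move=> mD mf mg gf.
have m2 h : cmeasurable setT h -> measurable_fun D (fun z => (nm (h z) ^+ 2)%:E).
  move=> mh; apply/measurable_EFinP; apply: (measurable_funS measurableT) => //.
  exact: measurable_normc_sqr.
have half0 : (0 <= (1 / 2 : R)%:E)%E by rewrite lee_fin divr_ge0.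
have -> : N2 D f = (\int[leb]_(z in D) ((1/2)%:E * (nm (f z) ^+ 2)%:E + (1/2)%:E * (nm (g z) ^+ 2)%:E))%E.
  rewrite ge0_integralD//=; last 4 first.
  - by move=> z _; rewrite -EFinM lee_fin mulr_ge0// sqr_ge0.
  - by apply: measurable_funeM; exact: m2.
  - by move=> z _; rewrite -EFinM lee_fin mulr_ge0// sqr_ge0.
  - by apply: measurable_funeM; exact: m2.
  rewrite !ge0_integralZl//; [|exact: m2|by move=> z _; rewrite lee_fin sqr_ge0|exact: m2|by move=> z _; rewrite lee_fin sqr_ge0].
  rewrite gf -ge0_muleDl// -EFinD.
  by rewrite (_ : 1 / 2 + 1 / 2 = 1) ?mul1e//; field.
apply: ge0_le_integral => //.
- by move=> z _; rewrite lee_fin sqr_ge0.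
- apply: m2; apply: cmeasurableM; last exact: cmeasurable_cst.
  exact: cmeasurableD.
- by apply: emeasurable_funD; apply: measurable_funeM; exact: m2.
- move=> z _; rewrite -!EFinM -EFinD lee_fin.
  rewrite Normc.normcM exprMn Normc.normcV.
  have -> : nm 2 = 2.
    by rewrite -(rmorph_nat (real_complex R)) normc_real ger0_norm.
  have := normc_sqrD (f z) (g z); lra.
Qed.

(* Rotating and averaging removes the terms of a sum of monomials one at a time
   without increasing its norm. *)
Lemma coef_mon_le (I : Type) (m : I -> multinom d) a D al (s : seq I) (c0 : C)
    (c : I -> C) :
  measurable D ->
  (forall w, (forall j, nm (w j) = 1) -> rotC a w @^-1` D = D) ->
  all (fun i => al != m i) s ->
  (N2 D (fun z => c0 * mon a al z)%R <=
   N2 D (fun z => c0 * mon a al z + \sum_(i <- s) c i * mon a (m i) z)%R)%E.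
Proof.
move=> mD DD; elim: s c => [|be s IHs] c.
  by move=> _; under [in leRHS]eq_integral do rewrite big_nil addr0.
move=> /= /andP[abe als].
have [w [w1 wbe]] := separating_rotC abe.
set wal := (\prod_i w i ^+ al i) in wbe.
have walN : nm wal = 1.
  by rewrite normc_prod big1// => i _; rewrite normcX w1 expr1n.
have wal0 : wal != 0.
  by apply/eqP => w0; move: walN; rewrite w0 Normc.normc0 => /eqP; rewrite eq_sym oner_eq0.
pose F z := c0 * mon a al z + \sum_(i <- be :: s) c i * mon a (m i) z.
have mF : cmeasurable setT F.
  apply: cmeasurableD.
    by apply: cmeasurableM; [exact: cmeasurable_cst|exact: cmeasurable_mon].
  apply: cmeasurable_sum => ga.
  by apply: cmeasurableM; [exact: cmeasurable_cst|exact: cmeasurable_mon].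
(* After division by [wal] the term of exponent [al] in [G] is that of [F], while the term of [be]
   is the opposite of that of [F]; the average of [F] and [G] keeps the first and loses the
   second. *)
pose G z := wal^-1 * F (rotC a w z).
have [mr _] := preserves_rotC a w1.
have mFr : cmeasurable setT (F \o rotC a w).
  by case: mF => m1 m2; split; [exact: measurableT_comp m1 mr|exact: measurableT_comp m2 mr].
have mG : cmeasurable setT G.
  by apply: cmeasurableM => //; exact: cmeasurable_cst.
(* The other terms survive with new coefficients, which is why the induction is over all [c]. *)
pose c' ga := c ga * (1 + wal^-1 * \prod_i w i ^+ m ga i) / 2.
apply: (le_trans (IHs c' als)).
have -> : N2 D (fun z => c0 * mon a al z + \sum_(ga <- s) c' ga * mon a (m ga) z) =
    N2 D (fun z => (F z + G z) / 2).
  apply: eq_integral => z _; congr (nm _ ^+ 2)%:E.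
  rewrite /G /F mulrDr.
  rewrite !big_cons !mon_rotC -/wal wbe.
  have -> : \sum_(j <- s) c j * mon a (m j) (rotC a w z) =
     \sum_(j <- s) c j * ((\prod_i w i ^+ m j i) * mon a (m j) z).
    by apply: eq_bigr => j _; rewrite mon_rotC.
  have -> : \sum_(ga <- s) c' ga * mon a (m ga) z =
    (\sum_(j <- s) c j * mon a (m j) z + wal^-1 * \sum_(j <- s) c j * ((\prod_i w i ^+ m j i) * mon a (m j) z)) / 2.
    rewrite mulr_sumr -big_split/= mulr_suml; apply: eq_bigr => j _.
    by rewrite /c'; ring.
  set S1 := \sum_(j <- s) _; set S2 := \sum_(j <- s) _.
  set m1 := mon a al z; set m2 := mon a (m be) z.
  by field.
apply: integral_average_le => //.
rewrite -(integral_rotC w1 mD (DD _ w1) mF).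
by apply: eq_integral => z _; rewrite /G Normc.normcM Normc.normcV walN invr1 mul1r.
Qed.

End monomials.

(** * Power series *)

Section multinom_sums.
Context {d : nat}.

(** As a list, the multi-indices of degree below [n] can be split by degree and have one of them
    removed. *)
Definition multinoms_lt (n : nat) : seq (multinom d) :=
  [seq bmnm m | m <- enum {: bmultinom d n}].

Lemma mem_multinoms_lt n m : (m \in multinoms_lt n) = (mdeg m < n)%N.
Proof.
apply/mapP/idP => [[b _ ->]|mn]; first exact: bmdeg.
by exists (BMultinom mn) => //; rewrite mem_enum.
Qed.

Lemma multinoms_lt_uniq n : uniq (multinoms_lt n).
Proof. by rewrite map_inj_uniq ?enum_uniq//; exact: val_inj. Qed.

Lemma sum_bmultinomE (V : nmodType) n (F : multinom d -> V) :
  \sum_(al : bmultinom d n) F al = \sum_(al <- multinoms_lt n) F al.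
Proof. by rewrite big_map -big_enum. Qed.

Lemma sum_multinoms_lt_split (V : nmodType) (F : multinom d -> V) N n :
  (N <= n)%N ->
  \sum_(al <- multinoms_lt n) F al = \sum_(al <- multinoms_lt N) F al +
    \sum_(al <- multinoms_lt n | (N <= mdeg al)%N) F al.
Proof.
move=> Nn; rewrite (bigID (fun al => mdeg al < N)%N)/=; congr (_ + _).
  rewrite -big_filter; apply: perm_big; apply: uniq_perm.
  - exact/filter_uniq/multinoms_lt_uniq.
  - exact: multinoms_lt_uniq.
  move=> m; rewrite mem_filter !mem_multinoms_lt andbC.
  by case: (ltnP (mdeg m) N) => [mN|_]; rewrite ?andbF// (leq_trans mN).
by apply: eq_bigl => m; rewrite -leqNgt.
Qed.

(** Multi-indices of degree at most [n] embed in a cube of side [n + 1], over which both counting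
    and summing geometric weights factor through the coordinates. *)
Definition cube_of_multinom n (m : multinom d) : {ffun 'I_d -> 'I_n.+1} :=
  [ffun i => inord (m i)].

Lemma cube_of_multinomK n m i : (mdeg m < n.+1)%N -> cube_of_multinom n m i = m i :> nat.
Proof.
move=> mn; rewrite ffunE inordK// (leq_ltn_trans _ mn)// mdegE.
by rewrite (bigD1 i)//= leq_addr.
Qed.

Lemma cube_of_multinom_inj n :
  {in multinoms_lt n.+1 &, injective (cube_of_multinom n)}.
Proof.
move=> m1 m2; rewrite !mem_multinoms_lt => h1 h2 /ffunP E; apply/mnmP => i.
by rewrite -(cube_of_multinomK i h1) E cube_of_multinomK.
Qed.

Lemma multinoms_lt0 : multinoms_lt 0 = [::].
Proof.
case E : multinoms_lt => [//|m s].
have : m \in multinoms_lt 0 by rewrite E inE eqxx.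
by rewrite mem_multinoms_lt.
Qed.

Lemma size_multinoms_lt n : (size (multinoms_lt n) <= n ^ d)%N.
Proof.
case: n => [|n].
  by rewrite multinoms_lt0.
rewrite -(size_map (cube_of_multinom n)).
have -> : (n.+1 ^ d)%N = #|{: {ffun 'I_d -> 'I_n.+1}}| by rewrite card_ffun !card_ord.
rewrite cardE; apply: uniq_leq_size.
  by rewrite map_inj_in_uniq ?multinoms_lt_uniq//; exact: cube_of_multinom_inj.
by move=> x _; rewrite mem_enum.
Qed.

(** Over the enclosing cube the sum is a product of [d] geometric sums, each at most 2. *)
Lemma sum_half_le {R : realFieldType} n :
  \sum_(al <- multinoms_lt n) (1 / 2 : R) ^+ mdeg al <= 2 ^+ d.
Proof.
have geo m : \sum_(j < m) (1 / 2 : R) ^+ j = 2 - 2 * (1/2) ^+ m.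
  elim: m => [|m IHm]; first by rewrite big_ord0 expr0; ring.
  by rewrite big_ord_recr/= IHm exprS; field.
case: n => [|n].
  rewrite big_seq big1 ?exprn_ge0// => m; rewrite mem_multinoms_lt//.
apply: (@le_trans _ _ (\sum_(f : {ffun 'I_d -> 'I_n.+1}) \prod_(i < d) (1 / 2) ^+ f i)).
  rewrite big_seq.
  rewrite (eq_bigr (fun al => \prod_(i < d) (1 / 2 : R) ^+ cube_of_multinom n al i)).
    rewrite -big_seq -(big_map (cube_of_multinom n) xpredT (fun f => \prod_(i < d) (1 / 2 : R) ^+ f i)).
    rewrite big_uniq/=; last first.
      by rewrite map_inj_in_uniq ?multinoms_lt_uniq//; exact: cube_of_multinom_inj.
    rewrite [leRHS](bigID (mem (map (cube_of_multinom n) (multinoms_lt n.+1))))/=.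
    rewrite lerDl sumr_ge0// => f _; apply: prodr_ge0 => i _.
    by rewrite exprn_ge0// divr_ge0.
  move=> al; rewrite mem_multinoms_lt => h.
  rewrite -prod_const_mdeg; apply: eq_bigr => i _.
  by rewrite cube_of_multinomK.
rewrite -(bigA_distr_bigA (fun (_ : 'I_d) (j : 'I_n.+1) => (1 / 2 : R) ^+ j))/=.
rewrite big_const card_ord iter_mulr_1 lerXn2r ?nnegrE//.
  by apply: sumr_ge0 => j _; rewrite exprn_ge0// divr_ge0.
by rewrite geo gerBl mulr_ge0// exprn_ge0// divr_ge0.
Qed.

End multinom_sums.

Lemma cvg0_le {R : realType} (u v : nat -> R) :
  (forall n, 0 <= u n <= v n) -> v @ \oo --> (0 : R) -> u @ \oo --> (0 : R).
Proof.
move=> uv v0; apply: (@squeeze_cvgr _ _ _ _ (cst 0) v) => //; last exact: cvg_cst.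
by near=> n; exact: uv.
Unshelve. all: by end_near. Qed.

Lemma cvg0_sum {R : realType} (I : Type) (r : seq I) (F : I -> nat -> R) :
  (forall i, F i @ \oo --> (0 : R)) ->
  (fun n => \sum_(i <- r) F i n) @ \oo --> (0 : R).
Proof.
move=> F0; elim: r => [|i r IHr].
  rewrite (_ : (fun n => _) = cst 0); first exact: cvg_cst.
  by apply/funext => n; rewrite big_nil.
rewrite (_ : (fun n => _) = F i \+ (fun n => \sum_(j <- r) F j n)); last first.
  by apply/funext => n; rewrite big_cons.
by rewrite -[X in _ --> X](addr0 (0 : R)); exact: cvgD.
Qed.

Section power_series.
Context {R : realType} {d : nat}.
Local Notation C := R[i].
Local Notation nm := (@Normc.normc R).
Implicit Types (a : multinom d -> C) (z : Cspace R d) (al : multinom d)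
  (f : Cspace R d -> C).

Definition partial_sum a n z : C :=
  \sum_(al <- multinoms_lt n) a al * mon 0 al z.

Definition coef_bound a (r K : R) := forall al, nm (a al) * r ^+ mdeg al <= K.

(** The working form of [entire_expansion]: absolute convergence is replaced by a coefficient bound
    at every radius, which is stable under linear combinations and under coefficientwise limits with
    common bounds. *)
Definition expands f a := (forall r, 0 < r -> exists K, coef_bound a r K) /\
  forall z, (fun n => nm (partial_sum a n z - f z)) @ \oo --> (0 : R).

Lemma entire_expansion_expands f a : entire_expansion f a -> expands f a.
Proof.
move=> fa; split=> [r r0|z]; last first.
  have [_ /cvgC_normc] := fa z.
  suff -> : (fun n => nm (partial_sum a n z - f z)) =
    (fun n => nm (\sum_(al : bmultinom d n) a al * mmap1 (fun i => z ord0 i) al - f z)) by [].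
  apply/funext => n; congr (nm (_ - _)).
  rewrite (sum_bmultinomE n (fun al => a al * mmap1 (fun i => z ord0 i) al)).
  by apply: eq_bigr => al _; rewrite mon0E.
(* At the point with all coordinates [r], the term of exponent [al] has modulus
   [nm (a al) * r ^+ mdeg al], and one term is at most the whole absolute sum. *)
have [+ _] := fa (const_mx r%:C).
set E := \esum_(al in _) _ => Eoo.
have E0 : (0 <= E)%E by apply: esum_ge0 => al _; rewrite lee_fin normc_ge0.
have Efin : E \is a fin_num by rewrite ge0_fin_numE.
exists (fine E) => al; rewrite -lee_fin fineK//.
apply: esum_ge; exists [set al].
  by split => //; exact: finite_set1.
rewrite fsbig_set1 lee_fin Normc.normcM -mon0E normc_mon.
rewrite (eq_bigr (fun i => r ^+ al i)) ?prod_const_mdeg// => i _.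
by rewrite !mxE subr0 normc_real ger0_norm// ltW.
Qed.

Lemma expandsD f g a b (c : C) : expands f a -> expands g b ->
  expands (fun z => c * f z + g z) (fun al => c * a al + b al).
Proof.
move=> [ab fa] [bb gb]; split=> [r r0|z].
  have [Ka ha] := ab r r0; have [Kb hb] := bb r r0.
  exists (nm c * Ka + Kb) => al.
  apply: (@le_trans _ _ ((nm c * nm (a al) + nm (b al)) * r ^+ mdeg al)).
    rewrite ler_wpM2r ?exprn_ge0 ?(ltW r0)//.
    by rewrite (le_trans (normc_triangle _ _))// Normc.normcM.
  by rewrite mulrDl lerD// -mulrA ler_wpM2l ?normc_ge0.
apply: (@cvg0_le _ _ (fun n => nm c * nm (partial_sum a n z - f z) + nm (partial_sum b n z - g z))).
- move=> n; rewrite normc_ge0/= -Normc.normcM.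
  apply: le_trans (normc_triangle _ _).
  rewrite le_eqVlt; apply/orP; left; apply/eqP; congr nm; rewrite /partial_sum.
  rewrite (eq_bigr (fun al => c * (a al * mon 0 al z) + b al * mon 0 al z)); last first.
    by move=> al _; ring.
  by rewrite big_split/= -mulr_sumr; ring.
- rewrite -[X in _ --> X](addr0 (0 : R)) -[X in _ --> X + _](mulr0 (nm c)).
  by apply: cvgD => //; exact: cvgMr.
Qed.

Lemma cmeasurable_partial_sum D a n : cmeasurable D (partial_sum a n).
Proof.
apply: cmeasurable_sum => al.
by apply: cmeasurableM; [exact: cmeasurable_cst|exact: cmeasurable_mon].
Qed.

Lemma expands_cmeasurable D f a : expands f a -> cmeasurable D f.
Proof.
by move=> [_ fa]; apply: cmeasurable_cvg => [n|z _]; [exact: cmeasurable_partial_sum|exact: fa].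
Qed.

(** Write [1 / 4] as [1 / 2 * (1 / 2)]: one factor gives the decay [(1 / 2) ^+ N] of the tail, the
    other makes the weights sum to at most [2 ^+ d]. *)
Lemma series_dist (t : multinom d -> C) (K : R) N n :
  (forall al, nm (t al) <= K * (1 / 4) ^+ mdeg al) -> (N <= n)%N ->
  nm (\sum_(al <- multinoms_lt n) t al - \sum_(al <- multinoms_lt N) t al) <=
    K * 2 ^+ d * (1 / 2) ^+ N.
Proof.
move=> tK Nn; rewrite (sum_multinoms_lt_split _ Nn) addrC addKr.
rewrite (le_trans (normc_sum _ _ _))//.
have K0 : 0 <= K.
  have := le_trans (normc_ge0 _) (tK mnm0).
  by rewrite pmulr_lge0// exprn_gt0// divr_gt0.
have h0 m : 0 <= (1 / 2 : R) ^+ m by rewrite exprn_ge0// divr_ge0.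
apply: (@le_trans _ _ (\sum_(al <- multinoms_lt n | (N <= mdeg al)%N) K * (1 / 2) ^+ N * (1 / 2) ^+ mdeg al)).
  apply: ler_sum => al Nal; apply: (le_trans (tK al)).
  have -> : (1 / 4 : R) = 1 / 2 * (1 / 2) by field.
  rewrite exprMn -[leRHS]mulrA ler_wpM2l// ler_wpM2r//.
  by rewrite ler_wiXn2l ?divr_ge0//; lra.
rewrite -mulr_sumr [leRHS]mulrAC ler_wpM2l ?mulr_ge0//.
apply: le_trans (sum_half_le n).
by rewrite [leRHS](bigID (fun al => (N <= mdeg al)%N))/= lerDl sumr_ge0.
Qed.

Lemma series_cvg (t : multinom d -> C) (K : R) :
  (forall al, nm (t al) <= K * (1 / 4) ^+ mdeg al) ->
  exists l : C, (fun n => nm (\sum_(al <- multinoms_lt n) t al - l)) @ \oo --> (0 : R).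
Proof.
move=> tK.
have key (u : nat -> R) : (forall N n, (N <= n)%N -> `|u n - u N| <= K * 2 ^+ d * (1 / 2) ^+ N) ->
    exists l : R, u @ \oo --> l.
  move=> uK; apply/cvg_ex; apply: cauchy_cvg; apply: cauchy_exP => e e0.
  have : (fun N => K * 2 ^+ d * (1 / 2) ^+ N) @ \oo --> (0 : R).
    rewrite -[X in _ --> X](mulr0 (K * 2 ^+ d)); apply: cvgMr.
    by apply: cvg_expr; rewrite ger0_norm ?divr_ge0//; lra.
  move=> /cvgrPdist_lt/(_ e e0)[N _ hN]; exists (u N); exists N => // n /= Nn.
  rewrite -ball_normE/= distrC (le_lt_trans (uK _ _ Nn))// (le_lt_trans _ (hN N (leqnn N)))//.
  by rewrite sub0r normrN ler_norm.
pose S n := \sum_(al <- multinoms_lt n) t al.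
have [x xl] : exists l : R, (fun n => complex.Re (S n)) @ \oo --> l.
  apply: key => N n Nn; rewrite -ReN -ReD (le_trans (normc_Re _))//.
  exact: series_dist.
have [y yl] : exists l : R, (fun n => complex.Im (S n)) @ \oo --> l.
  apply: key => N n Nn; rewrite -ImN -ImD (le_trans (normc_Im _))//.
  exact: series_dist.
exists (x +i* y).
apply: (@cvg0_le _ _ (fun n => `|complex.Re (S n) - x| + `|complex.Im (S n) - y|)).
- move=> n; rewrite normc_ge0/= (le_trans (normc_le_ReIm _))//.
  by rewrite ReD ImD ReN ImN.
- rewrite -[X in _ --> X](addr0 (0 : R)); apply: cvgD.
    by apply/norm_cvg0P; rewrite -(subrr x); apply: cvgB => //; exact: cvg_cst.
  by apply/norm_cvg0P; rewrite -(subrr y); apply: cvgB => //; exact: cvg_cst.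
Qed.

(** This is why coefficient bounds are taken at radius [4 * r] to control a series on the polydisc
    of radius [r]. *)
Lemma coef_term_le a (r K : R) (m : multinom d -> C) : 0 <= r ->
  coef_bound a (4 * r) K -> (forall al, nm (m al) <= r ^+ mdeg al) ->
  forall al, nm (a al * m al) <= K * (1 / 4) ^+ mdeg al.
Proof.
move=> r0 aK mr al; rewrite Normc.normcM.
apply: (@le_trans _ _ (nm (a al) * r ^+ mdeg al)); first by rewrite ler_wpM2l ?normc_ge0.
have -> : nm (a al) * r ^+ mdeg al = nm (a al) * (4 * r) ^+ mdeg al * (1 / 4) ^+ mdeg al.
  by rewrite -mulrA -!exprMn; congr (_ * _ ^+ _); field.
by rewrite ler_wpM2r// exprn_ge0// divr_ge0.
Qed.

Lemma partial_sum_dist a (r K : R) N n z : 0 <= r -> coef_bound a (4 * r) K ->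
  (forall i, nm (z ord0 i) <= r) -> (N <= n)%N ->
  nm (partial_sum a n z - partial_sum a N z) <= K * 2 ^+ d * (1 / 2) ^+ N.
Proof.
move=> r0 aK zr; apply: series_dist; apply: (coef_term_le r0) => // al.
by apply: normc_mon_le => i; rewrite mxE subr0.
Qed.

(** The limit of [partial_sum_dist]. With [N = 0] it bounds [f] on polydiscs; when the coefficients
    of degree below [N] vanish it makes [f] of order [2 ^- N]. *)
Lemma expands_dist f a (r K : R) N z : expands f a -> 0 <= r ->
  coef_bound a (4 * r) K -> (forall i, nm (z ord0 i) <= r) ->
  nm (f z - partial_sum a N z) <= K * 2 ^+ d * (1 / 2) ^+ N.
Proof.
move=> [_ fa] r0 aK zr; apply/ler_addgt0Pr => e e0.
have /cvgrPdist_le/(_ e e0)[n0 _ h] := fa z.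
have := h (maxn n0 N) (leq_maxl _ _).
rewrite sub0r normrN ger0_norm ?normc_ge0// normc_subC => h1.
have := partial_sum_dist r0 aK zr (leq_maxr n0 N) => h2.
rewrite (_ : f z - partial_sum a N z =
  (partial_sum a (maxn n0 N) z - partial_sum a N z) + (f z - partial_sum a (maxn n0 N) z)); last by ring.
by rewrite (le_trans (normc_triangle _ _))// lerD.
Qed.

Lemma expands_exists a : (forall r, 0 < r -> exists K, coef_bound a r K) ->
  exists f, expands f a.
Proof.
move=> ab.
suff H z : exists l : C, (fun n => nm (partial_sum a n z - l)) @ \oo --> (0 : R).
  have [f fP] := choice H; by exists f.
pose r : R := 1 + \sum_i nm (z ord0 i).
have r1 : 0 < r by rewrite ltr_pwDl// sumr_ge0// => i _; rewrite normc_ge0.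
have zr i : nm (z ord0 i) <= r.
  rewrite /r (bigD1 i)//= addrCA lerDl addr_ge0// sumr_ge0// => j _; exact: normc_ge0.
have [K aK] : exists K, coef_bound a (4 * r) K by apply: ab; rewrite mulr_gt0.
apply: (@series_cvg _ K); apply: (coef_term_le (ltW r1)) => // al.
by apply: normc_mon_le => i; rewrite mxE subr0.
Qed.

Lemma normc_lim_le (u : nat -> C) (l : C) (c : R) :
  (fun n => nm (u n - l)) @ \oo --> (0 : R) -> (\forall n \near \oo, nm (u n) <= c) ->
  nm l <= c.
Proof.
move=> ul uc; apply/ler_addgt0Pr => e e0.
have /cvgrPdist_le/(_ e e0) h := ul.
near \oo => n.
have h1 : nm (u n) <= c by near: n.
have h2 : `|0 - nm (u n - l)| <= e by near: n.
rewrite sub0r normrN ger0_norm ?normc_ge0// in h2.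
rewrite (_ : l = u n - (u n - l)); last by ring.
by rewrite (le_trans (normc_triangle _ _))// normc_opp lerD.
Unshelve. all: by end_near. Qed.

End power_series.

(** * Complex differentiability of power series *)

Lemma littleo_differentiable (K : numFieldType) (V W : normedModType K)
    (f : V -> W) (df : {linear V -> W}) x : continuous df ->
  f \o shift x = cst (f x) + df +o_ 0 id -> differentiable f x.
Proof.
move=> cdf E; have dE : 'd f x = df :> (V -> W) by exact: diff_unique.
by apply/diff_locallyP; rewrite dE.
Qed.

Section differentiability.
Context {R : realType} {d : nat}.
Local Notation C := R[i].
Local Notation nm := (@Normc.normc R).
Implicit Types (z h : Cspace R d) (al : multinom d) (f : Cspace R d -> C).

Definition lin_form (g : 'I_d -> C) h : C := \sum_i h ord0 i * g i.

Lemma lin_form_is_linear g : linear (lin_form g).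
Proof.
move=> c u v; rewrite /lin_form scaler_sumr -big_split/=; apply: eq_bigr => i _.
by rewrite !mxE mulrDl -mulrA.
Qed.

HB.instance Definition _ g :=
  GRing.isLinear.Build C (Cspace R d) C *:%R (lin_form g) (lin_form_is_linear g).

Lemma normc_lin_form g h (M e : R) : 0 <= M -> (forall i, nm (g i) <= M) ->
  (forall i, nm (h ord0 i) <= e) -> nm (lin_form g h) <= d%:R * (e * M).
Proof.
move=> M0 gM he; rewrite (le_trans (normc_sum _ _ _))//.
rewrite (@le_trans _ _ (\sum_(i < d) e * M))//.
  by apply: ler_sum => i _; rewrite Normc.normcM ler_pM ?normc_ge0.
by rewrite sumr_const card_ord mulr_natl.
Qed.

Lemma continuous_lin_form g : continuous (lin_form g).
Proof.
apply/linear_bounded_continuous/linear_boundedP.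
pose M : R := \sum_i nm (g i).
have M0 : 0 <= M by apply: sumr_ge0 => i _; exact: normc_ge0.
have gM i : nm (g i) <= M.
  by rewrite /M (bigD1 i)//= lerDl sumr_ge0// => j _; exact: normc_ge0.
exists (d%:R * M)%:C; split.
  by apply/complex_realP; eexists.
move=> x Mx h; rewrite (le_trans _ (ler_wpM2r (normr_ge0 h) (ltW Mx)))//.
rewrite normrE_normc normr_rowE -rmorphM lecR mulrAC -mulrA.
exact: normc_lin_form M0 gM (normc_coord_le h).
Qed.

Lemma normr_lt_nbhs z (P : set (Cspace R d)) (e : R) : 0 < e ->
  (forall w, `|z - w| < e%:C -> P w) -> nbhs z P.
Proof.
move=> e0 eP; apply: nbhs_le_nbhs_norm; exists e%:C => //=.
by rewrite /= ltcR.
Qed.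

(** A remainder with an explicit quadratic constant can be summed over the terms of a series, which
    a bare little-o cannot. *)
Definition quadratically_approximable f z := exists (g : 'I_d -> C) (K : R),
  forall h (e : R), 0 <= e <= 1 -> (forall i, nm (h ord0 i) <= e) ->
    nm (f (h + z) - f z - lin_form g h) <= K * e ^+ 2.

Lemma quadratically_approximable_differentiable f z :
  quadratically_approximable f z -> differentiable f z.
Proof.
move=> [g [K fK]].
pose df : {linear Cspace R d -> C} := lin_form g.
have cdf : continuous df := @continuous_lin_form g.
apply: (littleo_differentiable cdf).
  apply/eqaddoP => e /= e0.
  have er : e = (complex.Re e)%:C by rewrite RRe_real// gtr0_real.
  have re0 : 0 < complex.Re e by rewrite -ltcR -er.
  pose K' := `|K| + 1.
  have K'0 : 0 < K' by rewrite ltr_wpDl.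
  pose del := Num.min 1 (complex.Re e / K').
  have del0 : 0 < del by rewrite lt_min ltr01 divr_gt0.
  apply: (@normr_lt_nbhs 0 _ _ del0) => h; rewrite sub0r normrN => hd.
  have hn : complex.Re `|h| < del by rewrite -ltcR -normr_rowE.
  have hn0 := Re_normr_ge0 h.
  have h1 : 0 <= complex.Re `|h| <= 1.
    by rewrite hn0/= (le_trans (ltW hn))// /del ge_min lexx.
  have := fK h (complex.Re `|h|) h1 (normc_coord_le h).
  rewrite er normr_rowE -rmorphM normrE_normc lecR.
  rewrite (_ : nm ((f \o shift z - (cst (f z) + df)) h) = nm (f (h + z) - f z - lin_form g h)); last first.
    by congr nm; rewrite !fctE /= opprD addrA.
  move=> /le_trans; apply.
  apply: (@le_trans _ _ (K' * complex.Re `|h| * complex.Re `|h|)).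
    rewrite expr2 -mulrA ler_wpM2r ?mulr_ge0// /K' (le_trans (ler_norm _))// lerDl.
    exact: ler01.
  rewrite ler_wpM2r// mulrC -ler_pdivlMr// (le_trans (ltW hn))// /del ge_min.
  by rewrite lexx orbT.
Qed.

(** A monomial is a product over a list of coordinates with repetitions, so the product rule gives
    its first-order expansion by induction on the list. *)
Lemma quadratic_prod (s : seq 'I_d) z (B : R) : (forall i, nm (z ord0 i) + 1 <= B) ->
  1 <= B ->
  nm (\prod_(i <- s) z ord0 i) <= B ^+ size s /\
  exists g : 'I_d -> C, (forall i, nm (g i) <= (size s)%:R * B ^+ size s) /\
    forall h (e : R), 0 <= e <= 1 -> (forall i, nm (h ord0 i) <= e) ->
    nm (\prod_(i <- s) (h + z) ord0 i - \prod_(i <- s) z ord0 i - lin_form g h)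
      <= d%:R * (size s)%:R ^+ 2 * B ^+ size s * e ^+ 2.
Proof.
move=> zB B1; have B0 : 0 <= B by rewrite (le_trans _ B1).
elim: s => [|i s [IH1 [g [gB IH2]]]].
  split; first by rewrite big_nil Normc.normc1.
  exists (fun=> 0); split=> [i|h e e01 he]; first by rewrite Normc.normc0 mul0r.
  rewrite !big_nil /lin_form big1 ?subrr ?subr0 ?Normc.normc0//; last by move=> j _; rewrite mulr0.
  by rewrite mulr_ge0 ?mulr_ge0 ?exprn_ge0//; case/andP: e01.
set n := size s in IH1 gB IH2 *; rewrite /= -/n.
set P := \prod_(j <- s) z ord0 j in IH1 IH2 *.
have ziB : nm (z ord0 i) <= B by rewrite (le_trans _ (zB i))// lerDl.
have Bn0 : 0 <= B ^+ n by exact: exprn_ge0.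
split; first by rewrite big_cons Normc.normcM exprS ler_pM ?normc_ge0.
exists (fun j => z ord0 i * g j + (if j == i then P else 0)); split.
  move=> j; rewrite (le_trans (normc_triangle _ _))// Normc.normcM.
  rewrite (_ : n.+1%:R * B ^+ n.+1 = B * (n%:R * B ^+ n) + B * B ^+ n :> R); last by rewrite exprS -natr1; ring.
  rewrite lerD//; first by rewrite ler_pM ?normc_ge0.
  case: ifP => _; last by rewrite Normc.normc0 mulr_ge0.
  by rewrite (le_trans IH1)// ler_peMl.
move=> h e e01 he; have /andP[e0 e1] := e01.
have -> : lin_form (fun j => z ord0 i * g j + (if j == i then P else 0)) h =
    z ord0 i * lin_form g h + h ord0 i * P.
  rewrite /lin_form mulr_sumr.
  rewrite (eq_bigr (fun j => z ord0 i * (h ord0 j * g j) + (if j == i then h ord0 i * P else 0))).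
    by rewrite big_split/= -big_mkcond/= big_pred1_eq.
  by move=> j _; case: eqP => [->|_]; ring.
rewrite !big_cons -/P mxE.
set Ph := \prod_(j <- s) _.
(* The first product carries the old remainder; the second is of second order, being a product of
   two factors of order [e]. *)
rewrite (_ : _ - _ - _ = (h ord0 i + z ord0 i) * (Ph - P - lin_form g h) + h ord0 i * lin_form g h); last by ring.
rewrite (le_trans (normc_triangle _ _))// !Normc.normcM.
have hzB : nm (h ord0 i + z ord0 i) <= B.
  by rewrite (le_trans (normc_triangle _ _))// (le_trans _ (zB i))// addrC lerD2l (le_trans (he i)).
have nB0 : 0 <= n%:R * B ^+ n by rewrite mulr_ge0.
apply: (@le_trans _ _ (B * (d%:R * n%:R ^+ 2 * B ^+ n * e ^+ 2) + e * (d%:R * (e * (n%:R * B ^+ n))))).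
  rewrite lerD// ler_pM ?normc_ge0//; first exact: IH2.
  exact: normc_lin_form.
have -> : d%:R * n.+1%:R ^+ 2 * B ^+ n.+1 * e ^+ 2 =
   B * (d%:R * n%:R ^+ 2 * B ^+ n * e ^+ 2) + (d%:R * e ^+ 2 * B * B ^+ n) * (n%:R + n%:R + 1) :> R.
  by rewrite [B ^+ n.+1]exprS -natr1; ring.
rewrite lerD2l.
have -> : e * (d%:R * (e * (n%:R * B ^+ n))) = d%:R * e ^+ 2 * 1 * B ^+ n * n%:R by ring.
rewrite ler_pM ?mulr_ge0 ?exprn_ge0//.
- rewrite ler_wpM2r// ler_wpM2l// mulr_ge0// exprn_ge0//.
- by rewrite -addrA lerDl addr_ge0.
Qed.

(** Factors polynomial in the degree are absorbed into [4 ^+ mdeg al], leaving geometric bounds that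
    [coef_bound] can sum. *)
Lemma quadratic_mon al z (B : R) : (forall i, nm (z ord0 i) + 1 <= B) -> 1 <= B ->
  exists g : 'I_d -> C, (forall i, nm (g i) <= (4 * B) ^+ mdeg al) /\
    forall h (e : R), 0 <= e <= 1 -> (forall i, nm (h ord0 i) <= e) ->
    nm (mon 0 al (h + z) - mon 0 al z - lin_form g h)
      <= d%:R * (4 * B) ^+ mdeg al * e ^+ 2.
Proof.
move=> zB B1; have B0 : 0 <= B by rewrite (le_trans _ B1).
pose s := flatten [seq nseq (al i) i | i <- enum 'I_d].
have sE (w : Cspace R d) : \prod_(i <- s) w ord0 i = mon 0 al w.
  rewrite mon0E big_flatten/= big_map big_enum/=; apply: eq_bigr => i _.
  by rewrite big_nseq iter_mulr_1.
have ss : size s = mdeg al.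
  rewrite -sum1_size big_flatten/= big_map big_enum/= mdegE; apply: eq_bigr => i _.
  by rewrite sum1_size size_nseq.
have [_ [g [gB gP]]] := quadratic_prod s zB B1.
rewrite ss in gB gP; set n := mdeg al in gB gP *.
have n4 : (n%:R : R) ^+ 2 <= 4 ^+ n.
  by rewrite -!natrX ler_nat (_ : 4 = 2 ^ 2)%N// -expnM mulnC expnM leq_exp2r// ltnW// ltn_expl.
have n4' : (n%:R : R) <= 4 ^+ n.
  by rewrite (le_trans _ n4)// -natrX ler_nat; case: (n) => // m; rewrite -mulnn leq_pmull.
exists g; split=> [i|h e e01 he].
  by rewrite (le_trans (gB i))// exprMn ler_wpM2r// exprn_ge0.
have /andP[e0 _] := e01.
rewrite -!sE (le_trans (gP h e e01 he))// ler_wpM2r ?exprn_ge0//.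
by rewrite exprMn [leRHS]mulrA ler_wpM2r ?exprn_ge0// ler_wpM2l.
Qed.

Lemma expands_quadratically_approximable f a z :
  expands f a -> quadratically_approximable f z.
Proof.
move=> [ab fa].
pose B : R := 1 + \sum_i nm (z ord0 i).
have sum0 (P : pred 'I_d) : 0 <= \sum_(i | P i) nm (z ord0 i).
  by apply: sumr_ge0 => i _; exact: normc_ge0.
have B1 : 1 <= B by rewrite /B lerDl.
have zB i : nm (z ord0 i) + 1 <= B.
  by rewrite addrC lerD2l (bigD1 i)//= lerDl.
have B0 : 0 <= 4 * B by rewrite mulr_ge0// (le_trans _ B1).
(* The gradients and remainders of the monomials grow like [(4 * B) ^+ mdeg al]; one more factor 4
   makes the series converge geometrically. *)
have [K aK] : exists K, coef_bound a (4 * (4 * B)) K.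
  by apply: ab; rewrite !mulr_gt0// (lt_le_trans _ B1).
have [g gP] := choice (fun al => quadratic_mon al zB B1).
have /choice[G GP] i : exists l, (fun n => nm (\sum_(al <- multinoms_lt n) a al * g al i - l)) @ \oo --> (0 : R).
  apply: (@series_cvg _ _ _ K); apply: (coef_term_le B0) => // al.
  by case: (gP al).
exists G; exists (d%:R * (K * 2 ^+ d)) => h e e01 he.
(* [T n] is the first-order remainder of the [n]-th partial sum. It tends to the remainder of [f]
   with gradient [G], and its bound does not depend on [n]. *)
pose T n := \sum_(al <- multinoms_lt n) a al * (mon 0 al (h + z) - mon 0 al z - lin_form (g al) h).
apply: (@normc_lim_le _ T).
  pose w n := nm (partial_sum a n (h + z) - f (h + z)) + nm (partial_sum a n z - f z)
    + \sum_i nm (h ord0 i) * nm (\sum_(al <- multinoms_lt n) a al * g al i - G i).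
  apply: (@cvg0_le _ _ w).
    move=> n; rewrite normc_ge0/=.
    rewrite (_ : T n - _ = (partial_sum a n (h + z) - f (h + z)) - (partial_sum a n z - f z)
       - \sum_i h ord0 i * (\sum_(al <- multinoms_lt n) a al * g al i - G i)).
      rewrite (le_trans (normc_triangle _ _))// lerD//.
        by rewrite (le_trans (normc_triangle _ _))// normc_opp.
      rewrite normc_opp (le_trans (normc_sum _ _ _))//.
      by under eq_bigr do rewrite Normc.normcM.
    have -> : T n = partial_sum a n (h + z) - partial_sum a n z - \sum_i h ord0 i * \sum_(al <- multinoms_lt n) a al * g al i.
      under [in RHS]eq_bigr do rewrite mulr_sumr.
      rewrite exchange_big/= -!sumrB; apply: eq_bigr => al _.
      rewrite !mulrBr; congr (_ - _); rewrite /lin_form mulr_sumr; apply: eq_bigr => i _.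
      by ring.
    under [in RHS]eq_bigr do rewrite mulrBr.
    by rewrite sumrB -/(lin_form G h); ring.
  rewrite -[X in _ --> X](addr0 (0 : R)) -[X in _ --> X + _](addr0 (0 : R)).
  apply: cvgD; first by apply: cvgD; exact: fa.
  apply: cvg0_sum => i; rewrite -[X in _ --> X](mulr0 (nm (h ord0 i))).
  exact: cvgMr (GP i).
near=> n; rewrite (le_trans (normc_sum _ _ _))//.
apply: (@le_trans _ _ (\sum_(al <- multinoms_lt n) d%:R * K * e ^+ 2 * (1 / 2) ^+ mdeg al)).
  apply: ler_sum => al _; rewrite Normc.normcM.
  have [_ /(_ h e e01 he) hal] := gP al; have /andP[e0 _] := e01.
  rewrite (le_trans (ler_wpM2l (normc_ge0 _) hal))//.
  have -> : nm (a al) * (d%:R * (4 * B) ^+ mdeg al * e ^+ 2) =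
    d%:R * (nm (a al) * (4 * (4 * B)) ^+ mdeg al) * e ^+ 2 * (1 / 4) ^+ mdeg al.
    have -> : (4 * B) ^+ mdeg al = (4 * (4 * B)) ^+ mdeg al * (1 / 4) ^+ mdeg al.
      by rewrite -exprMn; congr (_ ^+ _); field.
    by ring.
  have b4 : 0 <= 4 * (4 * B) by rewrite mulr_ge0.
  rewrite ler_pM ?mulr_ge0 ?exprn_ge0 ?normc_ge0 ?divr_ge0//.
    by rewrite ler_wpM2r ?exprn_ge0// ler_wpM2l.
  by rewrite lerXn2r ?nnegrE ?divr_ge0//; lra.
rewrite -mulr_sumr.
have -> : d%:R * (K * 2 ^+ d) * e ^+ 2 = d%:R * K * e ^+ 2 * 2 ^+ d by ring.
rewrite ler_wpM2l ?sum_half_le//.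
have K0 : 0 <= K by rewrite (le_trans _ (aK mnm0))// mulr_ge0 ?normc_ge0// exprn_ge0// mulr_ge0.
by rewrite mulr_ge0 ?mulr_ge0 ?exprn_ge0//; case/andP: e01.
Unshelve. all: by end_near. Qed.

Lemma expands_holomorphic f a D : expands f a -> holomorphic D f.
Proof.
move=> fa z _; apply: quadratically_approximable_differentiable.
exact: expands_quadratically_approximable fa.
Qed.

End differentiability.

(** * Semi-inner products and L2 spaces *)

Section psd_forms.
Context {R : realType} {V : lmodType R[i]}.
Local Notation C := R[i].
Local Notation nm := (@Normc.normc R).
Implicit Types (F : set V) (B : V -> V -> C).

Definition subspace F := F 0 /\ forall (c : C) u v, F u -> F v -> F (c *: u + v).

(** The laws are asked on [F] only, where the integrals behave well, and without definiteness: a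
    function vanishing on the domain of integration has length 0. *)
Definition psd_form F B := [/\
  forall (c : C) u v w, F u -> F v -> F w -> B (c *: u + v) w = c * B u w + B v w,
  forall u v, F u -> F v -> B v u = (B u v)^* &
  forall u, F u -> 0 <= complex.Re (B u u)].

Section theory.
Variables (F : set V) (B : V -> V -> C).
Hypotheses (sF : subspace F) (pB : psd_form F B).

Lemma subspaceZ c u : F u -> F (c *: u).
Proof. by move=> Fu; rewrite -[c *: u]addr0; apply: sF.2 => //; exact: sF.1. Qed.

Lemma subspaceD u v : F u -> F v -> F (u + v).
Proof. by move=> Fu Fv; rewrite -[u]scale1r; apply: sF.2. Qed.

Lemma subspaceN u : F u -> F (- u).
Proof. by move=> Fu; rewrite -scaleN1r; exact: subspaceZ. Qed.

Lemma subspaceB u v : F u -> F v -> F (u - v).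
Proof. by move=> Fu Fv; apply: subspaceD => //; exact: subspaceN. Qed.

Lemma subspace_sum (I : Type) (r : seq I) (P : pred I) (c : I -> C) (e : I -> V) :
  (forall i, F (e i)) -> F (\sum_(i <- r | P i) c i *: e i).
Proof.
move=> Fe; elim/big_ind: _ => [|u v|i _]; first exact: sF.1.
- exact: subspaceD.
- exact: subspaceZ.
Qed.

Lemma form0l v : F v -> B 0 v = 0.
Proof.
move=> Fv; have := let: And3 l _ _ := pB in l (-1) 0 0 v sF.1 sF.1 Fv.
by rewrite scaler0 addr0 mulN1r addNr.
Qed.

Lemma formDl u v w : F u -> F v -> F w -> B (u + v) w = B u w + B v w.
Proof.
move=> Fu Fv Fw; rewrite -[u in LHS]scale1r.
by case: pB => /(_ 1 u v w Fu Fv Fw) -> _ _; rewrite mul1r.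
Qed.

Lemma formZl c u w : F u -> F w -> B (c *: u) w = c * B u w.
Proof.
move=> Fu Fw; rewrite -[c *: u]addr0.
by case: (pB) => /(_ c u 0 w Fu sF.1 Fw) -> _ _; rewrite form0l// addr0.
Qed.

Lemma formC u v : F u -> F v -> B v u = (B u v)^*.
Proof. by case: pB => _ + _; apply. Qed.

Lemma form0r v : F v -> B v 0 = 0.
Proof. by move=> Fv; rewrite (formC sF.1 Fv) form0l// rmorph0. Qed.

Lemma formDr u v w : F u -> F v -> F w -> B w (u + v) = B w u + B w v.
Proof.
move=> Fu Fv Fw; rewrite (formC (subspaceD Fu Fv) Fw) formDl// rmorphD/=.
by rewrite (formC Fu Fw) (formC Fv Fw).
Qed.

Lemma formZr c u w : F u -> F w -> B w (c *: u) = c^* * B w u.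
Proof.
by move=> Fu Fw; rewrite (formC (subspaceZ c Fu) Fw) formZl// rmorphM/= (formC Fu Fw).
Qed.

Lemma formBr u v w : F u -> F v -> F w -> B w (u - v) = B w u - B w v.
Proof.
move=> Fu Fv Fw; rewrite formDr//; last exact: subspaceN.
by rewrite -scaleN1r formZr// rmorphN1 mulN1r.
Qed.

Lemma formBl u v w : F u -> F v -> F w -> B (u - v) w = B u w - B v w.
Proof.
move=> Fu Fv Fw; rewrite addrC -scaleN1r.
by case: (pB) => /(_ (-1) v u w Fv Fu Fw) -> _ _; rewrite mulN1r addrC.
Qed.

Lemma form_real u : F u -> B u u = (complex.Re (B u u))%:C.
Proof.
move=> Fu; have := formC Fu Fu; case: (B u u) => a b /= [] /eqP.
by rewrite -addr_eq0 -mulr2n mulrn_eq0/= => /eqP ->.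
Qed.

Lemma form_ge0 u : F u -> 0 <= complex.Re (B u u).
Proof. by case: pB => _ _; apply. Qed.

Lemma form_suml (I : Type) (r : seq I) (P : pred I) (c : I -> C) (e : I -> V) v :
  (forall i, F (e i)) -> F v ->
  B (\sum_(i <- r | P i) c i *: e i) v = \sum_(i <- r | P i) c i * B (e i) v.
Proof.
move=> Fe Fv; elim: r => [|i r IHr]; first by rewrite !big_nil form0l.
rewrite !big_cons; case: ifP => // _; rewrite -IHr.
have Fs := subspace_sum r P c Fe.
by case: (pB) => /(_ (c i) _ _ v (Fe i) Fs Fv) ->.
Qed.

Lemma form_sumr (I : Type) (r : seq I) (P : pred I) (c : I -> C) (e : I -> V) v :
  (forall i, F (e i)) -> F v ->
  B v (\sum_(i <- r | P i) c i *: e i) = \sum_(i <- r | P i) (c i)^* * B v (e i).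
Proof.
move=> Fe Fv; rewrite (formC (subspace_sum _ _ _ Fe) Fv) form_suml// rmorph_sum.
by apply: eq_bigr => i _; rewrite rmorphM/= (formC (Fe i) Fv).
Qed.

Lemma form_sqrB (t : C) u v : F u -> F v ->
  complex.Re (B (t *: u - v) (t *: u - v)) =
  nm t ^+ 2 * complex.Re (B u u) - 2 * complex.Re (t * B u v) + complex.Re (B v v).
Proof.
move=> Fu Fv; have Ftu := subspaceZ t Fu.
rewrite formBl//; last exact: subspaceB.
rewrite !formBr// !formZl// !formZr// (formC Fu Fv) mulrA mulr_conj.
rewrite -rmorphM/= (form_real Fu) (form_real Fv).
by rewrite !(ReD, ReN, ReJ)/= ReM/=; ring.
Qed.

Lemma form_cauchy_schwarz u v : F u -> F v ->
  nm (B u v) ^+ 2 <= complex.Re (B u u) * complex.Re (B v v).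
Proof.
move=> Fu Fv; set b := B u v; set x := complex.Re (B u u); set y := complex.Re (B v v).
(* Positivity at [t *: u - v] with [t = s%:C * b^*], which makes the cross term real. The choice
   [s = x^-1] gives the claim; if [x = 0], a large [s] gives a contradiction. *)
have key (s : R) : 0 <= s ^+ 2 * nm b ^+ 2 * x - 2 * s * nm b ^+ 2 + y.
  have := form_ge0 (subspaceB (subspaceZ (s%:C * b^*) Fu) Fv).
  rewrite form_sqrB// -/b -/x -/y -[_ * _ * b]mulrA [b^* * b]mulrC mulr_conj.
  rewrite -rmorphM /= Normc.normcM exprMn normc_conj normc_real real_normK ?num_real//.
  by rewrite [2 * (s * _)]mulrA.
have x0 : 0 <= x by exact: form_ge0.
have y0 : 0 <= y by exact: form_ge0.
have [x00|xn0] := eqVneq x 0.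
  rewrite x00 mul0r leNgt; apply/negP => b0.
  have := key ((y + 1) / nm b ^+ 2); rewrite x00 mulr0 sub0r -mulrA mulfVK ?gt_eqF//.
  by rewrite leNgt => /negP; apply; lra.
have xp : 0 < x by rewrite lt_def xn0.
have := key x^-1; rewrite exprVn.
rewrite (_ : (x ^+ 2)^-1 * nm b ^+ 2 * x - 2 / x * nm b ^+ 2 + y = y - nm b ^+ 2 / x); last by field.
by rewrite subr_ge0 ler_pdivrMr// mulrC.
Qed.

(** A null vector is orthogonal to everything. This identifies [iota f] with [f], and, for the form
    [M G - B], yields the eigenvector equation. *)
Lemma form_eq0 u v : F u -> F v -> complex.Re (B u u) <= 0 -> B u v = 0.
Proof.
move=> Fu Fv uu; apply: Normc.eq0_normc; apply/eqP; rewrite -sqrf_eq0 eq_le sqr_ge0 andbT.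
rewrite (le_trans (form_cauchy_schwarz Fu Fv))//.
by rewrite mulr_le0_ge0// form_ge0.
Qed.

(** The right side minus the left is the form at [e *: u - v], divided by [e]. *)
Lemma form_sqrD_le (e : R) u v : 0 < e -> F u -> F v ->
  complex.Re (B (u + v) (u + v)) <=
  (1 + e) * complex.Re (B u u) + (1 + e^-1) * complex.Re (B v v).
Proof.
move=> e0 Fu Fv.
have E (s : R) : complex.Re (B (s%:C *: u - v) (s%:C *: u - v)) =
  s ^+ 2 * complex.Re (B u u) - 2 * s * complex.Re (B u v) + complex.Re (B v v).
  rewrite form_sqrB// normc_real real_normK ?num_real// ReM/= mul0r subr0.
  by rewrite [2 * (s * _)]mulrA.
have Fuv : F (u + v) by exact: subspaceD.
have -> : complex.Re (B (u + v) (u + v)) =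
   complex.Re (B u u) + 2 * complex.Re (B u v) + complex.Re (B v v).
  by rewrite formDl// !formDr// (formC Fu Fv) !ReD ReJ; ring.
have := form_ge0 (subspaceB (subspaceZ e%:C Fu) Fv); rewrite E.
move: (complex.Re (B u u)) (complex.Re (B u v)) (complex.Re (B v v)) => x p y h.
rewrite -subr_ge0.
rewrite (_ : _ - _ = (e ^+ 2 * x - 2 * e * p + y) / e); last by field; rewrite gt_eqF.
by rewrite divr_ge0// ltW.
Qed.

End theory.

End psd_forms.

Section L2.
Context {R : realType} {d : nat}.
Local Notation C := R[i].
Local Notation nm := (@Normc.normc R).
Local Notation leb := (lebesgue_Cspace R d).
Variables (D : set (Cspace R d)) (w : Cspace R d -> R).
Hypotheses (mD : measurable D) (mw : measurable_fun D w)
  (w0 : forall z, 0 <= w z).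
Implicit Types f g h : Cspace R d -> C.

(** The weight covers both cases: the Gaussian one on the whole space for the Fock space, and the
    constant 1 on [Omega] for the Bergman space. *)
Definition L2 : set (Cspace R d -> C) := [set f | cmeasurable D f /\
  (\int[leb]_(z in D) (nm (f z) ^+ 2 * w z)%:E < +oo)%E].

Definition wip f g : C := Cintegral D (fun z => f z * (g z)^* * (w z)%:C).

Lemma L2_measurable_sqr f : cmeasurable D f ->
  measurable_fun D (fun z => (nm (f z) ^+ 2 * w z)%:E).
Proof.
by move=> mf; apply/measurable_EFinP; apply: measurable_funM => //; exact: measurable_normc_sqr.
Qed.

Lemma L2_sqr_ge0 f z : (0 <= (nm (f z) ^+ 2 * w z)%:E)%E.
Proof. by rewrite lee_fin mulr_ge0// sqr_ge0. Qed.

Lemma L2_integrable_sqr f : L2 f ->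
  leb.-integrable D (fun z => (nm (f z) ^+ 2 * w z)%:E).
Proof.
move=> [mf foo]; apply/integrableP; split; first exact: L2_measurable_sqr.
under eq_integral do rewrite gee0_abs ?L2_sqr_ge0//; exact: foo.
Qed.

Lemma L2_integrable f g : L2 f -> L2 g ->
  leb.-integrable D (fun z => (complex.Re (f z * (g z)^* * (w z)%:C))%:E) /\
  leb.-integrable D (fun z => (complex.Im (f z * (g z)^* * (w z)%:C))%:E).
Proof.
move=> Lf Lg.
have dom : leb.-integrable D (fun z => (nm (f z) ^+ 2 * w z)%:E + (nm (g z) ^+ 2 * w z)%:E)%E.
  by apply: integrableD => //; exact: L2_integrable_sqr.
have [m1 m2] : cmeasurable D (fun z => f z * (g z)^* * (w z)%:C).
  apply: cmeasurableM; last exact: cmeasurable_real.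
  by apply: cmeasurableM; [case: Lf|apply: cmeasurable_conj; case: Lg].
have le z : nm (f z * (g z)^* * (w z)%:C) <= nm (f z) ^+ 2 * w z + nm (g z) ^+ 2 * w z.
  rewrite !Normc.normcM normc_conj normc_real ger0_norm// -mulrDl ler_wpM2r//.
  have := sqr_ge0 (nm (f z) - nm (g z)); have := normc_ge0 (f z); have := normc_ge0 (g z).
  rewrite !expr2; nra.
split; apply: (le_integrable mD _ _ dom).
- exact/measurable_EFinP.
- move=> z _; rewrite -EFinD !abse_EFin lee_fin (le_trans (normc_Re _))//.
  by rewrite (le_trans (le z))// ler_norm.
- exact/measurable_EFinP.
- move=> z _; rewrite -EFinD !abse_EFin lee_fin (le_trans (normc_Im _))//.
  by rewrite (le_trans (le z))// ler_norm.
Qed.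

Lemma L2_subspace : subspace L2.
Proof.
split.
  split; first exact: cmeasurable_cst.
  by under eq_integral do rewrite Normc.normc0 expr0n/= mul0r; rewrite integral0.
move=> c f g [mf foo] [mg goo].
have mfg : cmeasurable D (c *: f + g).
  by apply: cmeasurableD => //; apply: cmeasurableM => //; exact: cmeasurable_cst.
split=> //.
apply: (@le_lt_trans _ _ (\int[leb]_(z in D) ((2 * nm c ^+ 2)%:E * (nm (f z) ^+ 2 * w z)%:E + 2%:E * (nm (g z) ^+ 2 * w z)%:E))%E).
  apply: ge0_le_integral => //.
  - by move=> z _; exact: L2_sqr_ge0.
  - exact: L2_measurable_sqr.
  - apply: emeasurable_funD; apply: measurable_funeM; exact: L2_measurable_sqr.
  - move=> z _; rewrite -!EFinM -EFinD lee_fin.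
    rewrite (_ : _ + _ = (2 * nm (c * f z) ^+ 2 + 2 * nm (g z) ^+ 2) * w z).
      by rewrite ler_wpM2r// normc_sqrD.
    by rewrite Normc.normcM; ring.
rewrite ge0_integralD//=; last 4 first.
- by move=> z _; rewrite mule_ge0 ?L2_sqr_ge0// lee_fin mulr_ge0// sqr_ge0.
- by apply: measurable_funeM; exact: L2_measurable_sqr.
- by move=> z _; rewrite mule_ge0 ?L2_sqr_ge0// lee_fin.
- by apply: measurable_funeM; exact: L2_measurable_sqr.
have m1 := L2_measurable_sqr mf; have m2 := L2_measurable_sqr mg.
have n1 z : D z -> (0 <= (nm (f z) ^+ 2 * w z)%:E)%E by move=> _; exact: L2_sqr_ge0.
have n2 z : D z -> (0 <= (nm (g z) ^+ 2 * w z)%:E)%E by move=> _; exact: L2_sqr_ge0.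
have c0 : (0 <= (2 * nm c ^+ 2)%:E)%E by rewrite lee_fin mulr_ge0// sqr_ge0.
rewrite !ge0_integralZl//.
by rewrite lte_add_pinfty// lte_mul_pinfty// ?lee_fin// mulr_ge0// sqr_ge0.
Qed.

Lemma Re_wip_ff f : complex.Re (wip f f) = fine (\int[leb]_(z in D) (nm (f z) ^+ 2 * w z)%:E)%E.
Proof.
rewrite /wip /Cintegral /= /Rintegral; congr fine; apply: eq_integral => z _.
by rewrite mulr_conj -rmorphM.
Qed.

Lemma wip_ff_integral f : L2 f ->
  (\int[leb]_(z in D) (nm (f z) ^+ 2 * w z)%:E = (complex.Re (wip f f))%:E)%E.
Proof.
move=> [mf foo]; rewrite Re_wip_ff fineK// ge0_fin_numE//.
by apply: integral_ge0 => z _; exact: L2_sqr_ge0.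
Qed.

Lemma wip_psd : psd_form L2 wip.
Proof.
split=> [c f g h Lf Lg Lh|f g Lf Lg|f _]; last first.
- by rewrite Re_wip_ff fine_ge0// integral_ge0// => z _; exact: L2_sqr_ge0.
- apply/eqP; rewrite eq_complex/=; apply/andP; split; apply/eqP.
    rewrite /Rintegral; congr fine; apply: eq_integral => z _.
    by case: (f z) (g z) => [? ?] [? ?] /=; congr EFin; ring.
  have [_ i2] := L2_integrable Lf Lg.
  rewrite -mulN1r -RintegralZl//; apply: eq_Rintegral => z _.
  by case: (f z) (g z) => [? ?] [? ?] /=; ring.
have [f1 f2] := L2_integrable Lf Lh; have [g1 g2] := L2_integrable Lg Lh.
rewrite /wip /Cintegral.
set Fr := fun z => complex.Re (f z * (h z)^* * (w z)%:C) in f1 *.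
set Fi := fun z => complex.Im (f z * (h z)^* * (w z)%:C) in f2 *.
set Gr := fun z => complex.Re (g z * (h z)^* * (w z)%:C) in g1 *.
set Gi := fun z => complex.Im (g z * (h z)^* * (w z)%:C) in g2 *.
case: c => a b.
have iZ (k : R) (F : Cspace R d -> R) : leb.-integrable D (EFin \o F) ->
    leb.-integrable D (EFin \o (fun z => k * F z)).
  by move=> iF; exact: (integrableZl mD k iF).
apply/eqP; rewrite eq_complex/=; apply/andP; split; apply/eqP.
  rewrite -!RintegralZl// -RintegralB//; [|exact: iZ|exact: iZ].
  rewrite -RintegralD//; last first.
    exact: (integrableB mD (iZ a Fr f1) (iZ b Fi f2)).
  apply: eq_Rintegral => z _; rewrite /Fr /Fi /Gr !fctE.
  by case: (f z) (g z) (h z) => [? ?] [? ?] [? ?] /=; ring.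
rewrite -!RintegralZl// -RintegralD//; [|exact: iZ|exact: iZ].
rewrite -RintegralD//; last first.
  exact: (integrableD mD (iZ a Fi f2) (iZ b Fr f1)).
apply: eq_Rintegral => z _; rewrite /Fr /Fi /Gi !fctE.
by case: (f z) (g z) (h z) => [? ?] [? ?] [? ?] /=; ring.
Qed.

End L2.

(** * The Fock space *)

Section compactness_tools.
Context {R : realType}.

Lemma limn_einf_le (u : (\bar R)^nat) (l : \bar R) :
  (forall n, (u n <= l)%E) -> (limn_einf u <= l)%E.
Proof.
move=> ul; rewrite limn_einf_lim; apply: lime_le; first exact: is_cvg_einfs.
apply: nearW => n; apply: le_trans (ul n).
by apply: ereal_inf_lbound; exists n => /=.
Qed.

(** Along one ultrafilter every bounded sequence converges, so the coefficients of all multi-indices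
    acquire limits simultaneously. *)
Lemma ultra_bounded_cvg (T : Type) (U : set_system T) (x : T -> R) (A : R) :
  UltraFilter U -> (forall t, `|x t| <= A) ->
  exists l : R, forall e, 0 < e -> U [set t | `|x t - l| <= e].
Proof.
move=> UU xA.
have UP : ProperFilter U by exact: ultra_proper.
have xP : ProperFilter (x @ U) by exact: fmap_proper_filter.
have [|l [_ lcl]] := @segment_compact R (- A) A (x @ U) xP.
  by apply: (@filterE _ U) => t; rewrite /= in_itv/= -ler_norml; exact: xA.
exists l => e e0.
have [//|Un] := in_ultra_setVsetC [set t | `|x t - l| <= e] UU.
have : (x @ U) [set y | ~ `|y - l| <= e] by [].
have : nbhs l (ball l e) by exact: nbhsx_ballx.
move=> /[swap] /lcl /[apply] -[y [/= nyl]].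
by rewrite -ball_normE/= distrC => /ltW.
Qed.

Lemma ultra_normc_bounded_cvg (T : Type) (U : set_system T) (x : T -> R[i]) (A : R) :
  UltraFilter U -> (forall t, Normc.normc (x t) <= A) ->
  exists l : R[i], forall e, 0 < e -> U [set t | Normc.normc (x t - l) <= e].
Proof.
move=> UU xA.
have [p pP] := ultra_bounded_cvg UU (fun t => le_trans (normc_Re _) (xA t)).
have [q qP] := ultra_bounded_cvg UU (fun t => le_trans (normc_Im _) (xA t)).
exists (p +i* q) => e e0; have e20 : 0 < e / 2 by rewrite divr_gt0.
apply: filterS2 (pP _ e20) (qP _ e20) => t /= h1 h2.
rewrite (le_trans (normc_le_ReIm _))// !(ReD, ImD, ReN, ImN)/=.
by rewrite [leRHS](splitr e) lerD.
Qed.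

End compactness_tools.

Section fock_space.
Context {R : realType} {d : nat}.
Local Notation C := R[i].
Local Notation nm := (@Normc.normc R).
Local Notation leb := (lebesgue_Cspace R d).
Local Notation w := (@fock_weight R d).
Local Notation FL2 := (L2 setT w).
Local Notation fip := (@fock_ip R d).
Implicit Types (f g : Cspace R d -> C) (a : multinom d -> C)
  (D : set (Cspace R d)) (z : Cspace R d).

Lemma fock_weight_ge0 z : 0 <= w z.
Proof. by rewrite mulr_ge0 ?expR_ge0// invr_ge0 exprn_ge0// pi_ge0. Qed.

Lemma measurable_fock_weight D : measurable_fun D w.
Proof.
apply: (measurable_funS measurableT) => //.
apply: measurable_funM => //; apply: measurableT_comp => //.
apply: measurable_funN; apply: measurable_sum => i.
exact/measurable_normc_sqr/cmeasurable_coord.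
Qed.

Lemma fock_weight_ge (z : Cspace R d) (r : R) : (forall i, nm (z ord0 i) <= r) ->
  pi ^- d * expR (- (d%:R * r ^+ 2)) <= w z.
Proof.
move=> zr; rewrite ler_wpM2l ?invr_ge0 ?exprn_ge0 ?pi_ge0//.
rewrite ler_expR lerN2 (@le_trans _ _ (\sum_(i < d) r ^+ 2))//.
  apply: ler_sum => i _; rewrite lerXn2r ?nnegrE ?normc_ge0//.
  by rewrite (le_trans (normc_ge0 _) (zr i)).
by rewrite sumr_const card_ord mulr_natl.
Qed.

Lemma fock_psd : psd_form FL2 fip.
Proof. exact: (wip_psd measurableT (@measurable_fock_weight setT) fock_weight_ge0). Qed.

Lemma FL2_subspace : subspace FL2.
Proof. exact: (L2_subspace measurableT (@measurable_fock_weight setT) fock_weight_ge0). Qed.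

Lemma fock_ip_integral f : FL2 f ->
  (\int[leb]_z (nm (f z) ^+ 2 * w z)%:E = (complex.Re (fip f f))%:E)%E.
Proof. exact: (wip_ff_integral fock_weight_ge0). Qed.

Lemma expands_fock f a : expands f a -> FL2 f -> fock f.
Proof. by move=> fa [_ foo]; split=> //; exact: expands_holomorphic fa. Qed.

Lemma fock_FL2 f a : expands f a -> fock f -> FL2 f.
Proof. by move=> fa [_ foo]; split=> //; exact: expands_cmeasurable fa. Qed.

(** On the polydisc of radius [r] the Gaussian weight is at least the inverse of the constant
    [pi ^+ d * expR (d%:R * r ^+ 2)]. *)
Lemma sqr_integral_le_fock D (r : R) f : measurable D ->
  (forall z, D z -> forall i, nm (z ord0 i) <= r) -> FL2 f ->
  (\int[leb]_(z in D) (nm (f z) ^+ 2)%:E <=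
   (pi ^+ d * expR (d%:R * r ^+ 2) * complex.Re (fip f f))%:E)%E.
Proof.
move=> mD Dr Lf; have mf : cmeasurable D f.
  by case: Lf => mf _; exact: cmeasurableS mf.
have k0 : 0 <= pi ^+ d * expR (d%:R * r ^+ 2) :> R.
  by rewrite mulr_ge0 ?expR_ge0// exprn_ge0// pi_ge0.
rewrite EFinM -fock_ip_integral//.
have n0 z : (0 <= (nm (f z) ^+ 2 * w z)%:E)%E.
  by rewrite lee_fin mulr_ge0 ?sqr_ge0// fock_weight_ge0.
have mfw A : measurable A -> measurable_fun A (fun z => (nm (f z) ^+ 2 * w z)%:E).
  move=> mA; apply/measurable_EFinP; apply: measurable_funM; last exact: measurable_fock_weight.
  by apply: measurable_normc_sqr; case: Lf => mf' _; exact: cmeasurableS mf'.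
rewrite (@le_trans _ _ ((pi ^+ d * expR (d%:R * r ^+ 2))%:E * \int[leb]_(z in D) (nm (f z) ^+ 2 * w z)%:E)%E)//; last first.
  rewrite lee_wpmul2l ?lee_fin//; apply: ge0_subset_integral => //; exact: mfw.
rewrite -ge0_integralZl//; last exact: mfw.
apply: ge0_le_integral => //.
- by move=> z _; rewrite lee_fin sqr_ge0.
- exact/measurable_EFinP/measurable_normc_sqr.
- by apply: measurable_funeM; exact: mfw.
- move=> z Dz; rewrite -EFinM lee_fin [leRHS]mulrCA ler_peMr ?sqr_ge0//.
  rewrite -[leLHS](_ : pi ^+ d * expR (d%:R * r ^+ 2) * (pi ^- d * expR (- (d%:R * r ^+ 2))) = 1).
    by rewrite ler_wpM2l// fock_weight_ge// => i; exact: Dr.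
  rewrite mulrACA divff ?expf_neq0 ?gt_eqF ?pi_gt0// mul1r -expRD subrr expR0//.
Qed.

Lemma sqr_integral_bounded D f (M : R) : measurable D -> cmeasurable D f ->
  (forall z, D z -> nm (f z) <= M) ->
  (\int[leb]_(z in D) (nm (f z) ^+ 2)%:E <= (M ^+ 2)%:E * leb D)%E.
Proof.
move=> mD mf fM; rewrite -integral_cst//; apply: ge0_le_integral => //.
- by move=> z _; rewrite lee_fin sqr_ge0.
- exact/measurable_EFinP/measurable_normc_sqr.
- move=> z Dz; rewrite /= lee_fin lerXn2r ?nnegrE ?normc_ge0 ?fM//.
  by rewrite (le_trans (normc_ge0 _) (fM z Dz)).
Qed.

Lemma sqr_integralD D f g : measurable D -> cmeasurable D f -> cmeasurable D g ->
  (\int[leb]_(z in D) (nm (f z + g z) ^+ 2)%:E <=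
   2%:E * \int[leb]_(z in D) (nm (f z) ^+ 2)%:E +
   2%:E * \int[leb]_(z in D) (nm (g z) ^+ 2)%:E)%E.
Proof.
move=> mD mf mg.
have m2 h : cmeasurable D h -> measurable_fun D (fun z => (nm (h z) ^+ 2)%:E).
  by move=> mh; exact/measurable_EFinP/measurable_normc_sqr.
have mf2 := m2 _ mf; have mg2 := m2 _ mg.
have s0 h z : D z -> (0 <= (nm (h z) ^+ 2)%:E)%E by rewrite lee_fin sqr_ge0.
have t0 h z : D z -> (0 <= 2%:E * (nm (h z) ^+ 2)%:E)%E.
  by rewrite -EFinM lee_fin mulr_ge0// sqr_ge0.
have two0 : (0 <= 2%:E :> \bar R)%E by rewrite lee_fin.
rewrite -(ge0_integralZl leb mD mf2 (s0 f) two0) -(ge0_integralZl leb mD mg2 (s0 g) two0).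
have mf3 := measurable_funeM (2%:E : \bar R) mf2.
have mg3 := measurable_funeM (2%:E : \bar R) mg2.
rewrite -(ge0_integralD leb mD (t0 f) mf3 (t0 g) mg3).
apply: ge0_le_integral => //.
- by move=> z; exact: (s0 (fun z => f z + g z)).
- exact: (m2 (fun z => f z + g z) (cmeasurableD mf mg)).
- by apply: emeasurable_funD; exact: measurable_funeM.
- by move=> z _; rewrite -!EFinM -EFinD lee_fin normc_sqrD.
Qed.

(** Cauchy estimates from integrals: on a polyannulus [coef_mon_le] bounds one term of a partial sum
    by the partial sum, and the latter differs from [f] by a tail that tends to 0 uniformly
    there. *)
Lemma coef_le_fock (r : R) : 0 < r -> exists2 K : R, 0 < K &
  forall f a, expands f a -> FL2 f ->
  forall al, (nm (a al) * r ^+ mdeg al) ^+ 2 <= K * complex.Re (fip f f).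
Proof.
move=> r0; pose D := polyannulus (0 : Cspace R d) r.
have [V V0 DV] := @polyannulus_volume R d 0 r r0.
have mD : measurable D by exact: polyannulus_measurable.
have Dz z : D z -> forall i, nm (z ord0 i) <= 2 * r.
  by move=> Dz i; have := Dz i; rewrite mxE subr0 => /andP[_ /ltW].
have [k k0 kE] : exists2 k : R, 0 < k & k = pi ^+ d * expR (d%:R * (2 * r) ^+ 2).
  by eexists; last reflexivity; rewrite mulr_gt0 ?expR_gt0// exprn_gt0// pi_gt0.
exists (2 * k / V); first by rewrite divr_gt0// mulr_gt0.
move=> f a fa Lf al; set N := complex.Re (fip f f).
have mf : cmeasurable D f by exact: expands_cmeasurable fa.
have [K aK] : exists K, coef_bound a (4 * (2 * r)) K by apply: fa.1; rewrite !mulr_gt0.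
have K0 : 0 <= K.
  by rewrite (le_trans _ (aK mnm0))// mulr_ge0 ?normc_ge0// exprn_ge0// !mulr_ge0// ltW.
have key n : (mdeg al < n)%N ->
    (nm (a al) * r ^+ mdeg al) ^+ 2 * V <= 2 * k * N + 2 * (K * 2 ^+ d * (1 / 2) ^+ n) ^+ 2 * V.
  move=> aln; set E := K * 2 ^+ d * (1 / 2) ^+ n.
  have -> : 2 * k * N + 2 * E ^+ 2 * V = 2 * (k * N) + 2 * (E ^+ 2 * V) by ring.
  rewrite -lee_fin EFinD [X in (X <= _)%E]EFinM [X in (_ <= X + _)%E]EFinM.
  rewrite [X in (_ <= _ + X)%E]EFinM [X in (_ <= _ + _ * X)%E]EFinM -DV.
  have rot w' : (forall j, nm (w' j) = 1) -> rotC 0 w' @^-1` D = D.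
    exact: polyannulus_rotC.
  have nal : all (fun be => al != id be) (rem al (multinoms_lt n)).
    apply/allP => be; rewrite mem_rem_uniq ?multinoms_lt_uniq// inE eq_sym.
    by case/andP.
  have := @coef_mon_le R d _ id 0 D al _ (a al) a mD rot nal.
  have -> : (\int[leb]_(z in D) (nm (a al * mon 0 al z +
      \sum_(be <- rem al (multinoms_lt n)) a be * mon 0 be z) ^+ 2)%:E =
      \int[leb]_(z in D) (nm (partial_sum a n z) ^+ 2)%:E)%E.
    apply: eq_integral => z _; rewrite /partial_sum [in RHS](big_rem al)//.
    by rewrite mem_multinoms_lt.
  move=> lepart.
  have lo : (((nm (a al) * r ^+ mdeg al) ^+ 2)%:E * leb D <=
      \int[leb]_(z in D) (nm (a al * mon 0 al z) ^+ 2)%:E)%E.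
    rewrite -integral_cst//; apply: ge0_le_integral => //.
    - by move=> z _; rewrite /= lee_fin sqr_ge0.
    - apply/measurable_EFinP/measurable_normc_sqr/cmeasurableM.
        exact: cmeasurable_cst.
      exact: cmeasurable_mon.
    - move=> z zD; rewrite lee_fin lerXn2r ?nnegrE ?normc_ge0//.
        by rewrite mulr_ge0 ?normc_ge0// exprn_ge0// ltW.
      rewrite Normc.normcM ler_wpM2l ?normc_ge0//.
      by apply: normc_mon_ge => [|i]; [exact: ltW|case/andP: (zD i)].
  rewrite (le_trans lo)// (le_trans lepart)//.
  have -> : (\int[leb]_(z in D) (nm (partial_sum a n z) ^+ 2)%:E =
    \int[leb]_(z in D) (nm (f z + (partial_sum a n z - f z)) ^+ 2)%:E)%E.
    by apply: eq_integral => z _; rewrite addrCA subrr addr0.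
  have mp : cmeasurable D (fun z => partial_sum a n z - f z).
    by apply: cmeasurableB => //; exact: cmeasurable_partial_sum.
  rewrite (le_trans (sqr_integralD mD mf mp))//.
  rewrite leeD//; rewrite lee_wpmul2l ?lee_fin//.
    by rewrite kE; exact: sqr_integral_le_fock.
  apply: sqr_integral_bounded => // z zD.
  rewrite normc_subC; apply: (expands_dist n fa _ aK (Dz z zD)).
  by rewrite mulr_ge0// ltW.
rewrite -(ler_pM2r V0).
have -> : 2 * k / V * N * V = 2 * k * N by field; rewrite gt_eqF.
apply/ler_addgt0Pr => e e0.
have : (fun n : nat => 2 * (K * 2 ^+ d * (1 / 2) ^+ n) ^+ 2 * V) @ \oo --> (0 : R).
  have h : (fun n : nat => (1 / 2 : R) ^+ n) @ \oo --> (0 : R).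
    by apply: cvg_expr; rewrite ger0_norm ?divr_ge0//; lra.
  have -> : (fun n : nat => 2 * (K * 2 ^+ d * (1 / 2) ^+ n) ^+ 2 * V) =
    (fun n : nat => (2 * (K * 2 ^+ d) ^+ 2 * V * (1 / 2) ^+ n) * (1 / 2) ^+ n).
    by apply/funext => n; ring.
  rewrite -[X in _ --> X](mulr0 (2 * (K * 2 ^+ d) ^+ 2 * V * 0)).
  by apply: cvgM => //; apply: cvgMr.
move=> /cvgrPdist_le/(_ e e0)[n0 _ h].
have := key (maxn n0 (mdeg al).+1) (leq_maxr _ _).
have := h (maxn n0 (mdeg al).+1) (leq_maxl _ _).
rewrite sub0r normrN => h1 h2; rewrite (le_trans h2)// lerD2l.
by rewrite (le_trans (ler_norm _)).
Qed.

End fock_space.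

(** * Montel's theorem in the Fock space *)

Section montel.
Context {R : realType} {d : nat}.
Local Notation C := R[i].
Local Notation nm := (@Normc.normc R).
Local Notation leb := (lebesgue_Cspace R d).
Local Notation w := (@fock_weight R d).
Local Notation FL2 := (L2 setT w).
Local Notation fip := (@fock_ip R d).
Implicit Types (f g : Cspace R d -> C) (a : multinom d -> C) (z : Cspace R d).

Lemma expands_unique f g a : expands f a -> expands g a -> f = g.
Proof.
move=> [_ fa] [_ ga]; apply/funext => z; apply/eqP; rewrite -subr_eq0; apply/eqP.
apply: Normc.eq0_normc; apply/eqP; rewrite eq_le normc_ge0 andbT.
apply: (@normc_lim_le _ (fun n => (partial_sum a n z - g z) - (partial_sum a n z - g z))).
  apply: (@cvg0_le _ _ (fun n => nm (partial_sum a n z - f z) + nm (partial_sum a n z - g z))).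
    move=> n; rewrite normc_ge0/=.
    rewrite (_ : _ - _ - (f z - g z) = (partial_sum a n z - f z) - (partial_sum a n z - g z)); last by ring.
    by rewrite (le_trans (normc_triangle _ _))// normc_opp.
  by rewrite -[X in _ --> X](addr0 (0 : R)); apply: cvgD; [exact: fa|exact: ga].
by apply: nearW => n; rewrite subrr Normc.normc0.
Qed.

Lemma expands0 : expands (0 : Cspace R d -> C) (fun=> 0).
Proof.
split=> [r _|z]; first by exists 0 => al; rewrite Normc.normc0 mul0r.
rewrite (_ : (fun n => _) = cst 0); first exact: cvg_cst.
by apply/funext => n; rewrite /partial_sum big1 ?subrr ?Normc.normc0// => al _; rewrite mul0r.
Qed.

(** The Cauchy estimates at radius 1 make every coefficient vanish, so [f] is zero as a function and
    not only almost everywhere. *)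
Lemma fock_definite f a : expands f a -> FL2 f -> complex.Re (fip f f) <= 0 -> f = 0.
Proof.
move=> fa Lf f0; have [K K0 KP] := @coef_le_fock R d 1 ltr01.
suff a0 : a = (fun=> 0).
  by rewrite a0 in fa; exact: expands_unique fa expands0.
apply/funext => al; apply: Normc.eq0_normc; apply/eqP; rewrite -sqrf_eq0.
have := KP f a fa Lf al; rewrite expr1n mulr1 => h.
rewrite eq_le sqr_ge0 andbT (le_trans h)// mulr_ge0_le0// ltW//.
Qed.

(** Each [phi s] is picked on its own from the ultrafilter: only finitely many multi-indices have
    degree below [s], so one index serves them all. The bound [s <= phi s] makes it tend to
    infinity. *)
Lemma diagonal_extraction (x : nat -> multinom d -> C) (A : multinom d -> R) :
  (forall n al, nm (x n al) <= A al) ->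
  exists (c : multinom d -> C) (phi : nat -> nat),
    (forall s, (s <= phi s)%N) /\
    (forall s al, (mdeg al < s)%N -> nm (x (phi s) al - c al) <= s.+1%:R^-1) /\
    forall al, nm (c al) <= A al.
Proof.
move=> xA.
have [U [UU oU]] := @ultraFilterLemma nat \oo _.
have UP : ProperFilter U by exact: ultra_proper.
have /choice[c cP] al : exists l, forall e, 0 < e -> U [set n | nm (x n al - l) <= e].
  by apply: (ultra_normc_bounded_cvg (A := A al)) => n; exact: xA.
have /choice[phi phiP] s : exists n, (s <= n)%N /\
    forall al, (mdeg al < s)%N -> nm (x n al - c al) <= s.+1%:R^-1.
  have h1 : U [set n | forall al, al \in multinoms_lt s -> nm (x n al - c al) <= s.+1%:R^-1].
    elim: (multinoms_lt s) => [|be l IH]; first by apply: filterE => n al; rewrite in_nil.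
    have s0 : 0 < s.+1%:R^-1 :> R by rewrite invr_gt0.
    apply: filterS2 (cP be _ s0) IH => n h h' al; rewrite inE => /orP[/eqP -> //|].
    exact: h'.
  have h2 : U [set n | (s <= n)%N] by apply: oU; exists s.
  have [n [h3 h4]] := filter_ex (filterI h1 h2).
  by exists n; split => // al als; apply: h3; rewrite mem_multinoms_lt.
exists c, phi; split; first by move=> s; case: (phiP s).
split=> [s|al]; first by case: (phiP s).
apply/ler_addgt0Pr => e e0.
have [n /= hn] := filter_ex (cP al e e0).
rewrite (_ : c al = x n al - (x n al - c al)); last by ring.
by rewrite (le_trans (normc_triangle _ _))// normc_opp lerD.
Qed.

(** By the Cauchy estimates the coefficients are bounded uniformly in [n] at every radius; their
    limits inherit these bounds and define [f]. Beyond a degree [N] all tails are uniformly small on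
    a polydisc, and below it finitely many coefficients converge. Fatou's lemma bounds the norm of
    [f]. *)
Lemma montel (u : nat -> Cspace R d -> C) (b : nat -> multinom d -> C) :
  (forall n, expands (u n) (b n)) -> (forall n, FL2 (u n)) ->
  (forall n, complex.Re (fip (u n) (u n)) <= 1) ->
  exists (f : Cspace R d -> C) (a : multinom d -> C) (phi : nat -> nat),
    [/\ expands f a, FL2 f, complex.Re (fip f f) <= 1,
     forall s, (s <= phi s)%N &
     forall r e : R, 0 < r -> 0 < e -> exists n0, forall n, (n0 <= n)%N ->
       forall z, (forall i, nm (z ord0 i) <= r) -> nm (u (phi n) z - f z) <= e].
Proof.
move=> ub Lu u1.
have bnd (r : R) : 0 < r -> exists2 K : R, 0 < K & forall n al, nm (b n al) * r ^+ mdeg al <= K.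
  move=> r0; have [K K0 KP] := @coef_le_fock R d r r0.
  exists (Num.sqrt K); first by rewrite sqrtr_gt0.
  move=> n al; rewrite -(@ler_pXn2r _ 2)// ?nnegrE ?sqrtr_ge0//; last first.
    by rewrite mulr_ge0 ?normc_ge0// exprn_ge0// ltW.
  rewrite sqr_sqrtr ?(ltW K0)// (le_trans (KP _ _ (ub n) (Lu n) al))//.
  by rewrite ler_piMr// ltW.
have [K1 K10 K1P] := bnd 1 ltr01.
have [c [phi [phis [phic cA]]]] := @diagonal_extraction b (fun=> K1)
  (fun n al => eq_ind _ (fun t => t <= K1) (K1P n al) _ (etrans (congr1 _ (expr1n _ _)) (mulr1 _))).
have cb (r K : R) : 0 < r -> (forall n al, nm (b n al) * r ^+ mdeg al <= K) -> coef_bound c r K.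
  move=> r0 KP al; apply/ler_addgt0Pr => e e0.
  have r1 : 0 < r ^+ mdeg al by exact: exprn_gt0.
  pose s := maxn (mdeg al).+1 (Num.truncn (r ^+ mdeg al / e)).
  have als : (mdeg al < s)%N by rewrite /s leq_max leqnn.
  rewrite (_ : c al = b (phi s) al - (b (phi s) al - c al)); last by ring.
  rewrite (@le_trans _ _ ((nm (b (phi s) al) + s.+1%:R^-1) * r ^+ mdeg al))//.
    rewrite ler_wpM2r ?(ltW r1)// (le_trans (normc_triangle _ _))// normc_opp.
    by rewrite lerD2l phic.
  rewrite mulrDl lerD// mulrC ler_pdivrMr// mulrC -ler_pdivrMr//.
  rewrite (le_trans (ltW (truncnS_gt _)))// ler_nat ltnS /s leq_maxr//.
have [f fc] := @expands_exists R d c (fun r r0 => let: ex_intro2 K _ KP := bnd r r0 in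
  ex_intro _ K (cb r K r0 KP)).
have unif (r e : R) : 0 < r -> 0 < e -> exists n0, forall n, (n0 <= n)%N ->
    forall z, (forall i, nm (z ord0 i) <= r) -> nm (u (phi n) z - f z) <= e.
  move=> r0 e0.
  have r40 : 0 < 4 * r by rewrite mulr_gt0.
  have [K K0 KP] := bnd (4 * r) r40.
  have h0 : (fun N : nat => K * 2 ^+ d * (1 / 2) ^+ N) @ \oo --> (0 : R).
    rewrite -[X in _ --> X](mulr0 (K * 2 ^+ d)); apply: cvgMr.
    by apply: cvg_expr; rewrite ger0_norm ?divr_ge0//; lra.
  have e30 : 0 < e / 3 by rewrite divr_gt0.
  move: h0 => /cvgrPdist_le/(_ _ e30)[N _ /(_ N (leqnn N))].
  rewrite sub0r normrN => /(le_trans (ler_norm _)) hN.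
  pose S : R := \sum_(al <- @multinoms_lt d N) r ^+ mdeg al.
  have S0 : 0 <= S by apply: sumr_ge0 => al _; rewrite exprn_ge0// ltW.
  exists (maxn N (Num.truncn (S / (e / 3)))) => n; rewrite geq_max => /andP[nN nS] z zr.
  rewrite (_ : _ - _ = (u (phi n) z - partial_sum (b (phi n)) N z) +
    (partial_sum (b (phi n)) N z - partial_sum c N z) - (f z - partial_sum c N z)); last by ring.
  have -> : e = e / 3 + e / 3 + e / 3 by field.
  rewrite (le_trans (normc_triangle _ _))// normc_opp lerD//; last first.
    by rewrite (le_trans (expands_dist N fc (ltW r0) (cb _ _ r40 KP) zr)).
  rewrite (le_trans (normc_triangle _ _))// lerD//.
    by rewrite (le_trans (expands_dist N (ub (phi n)) (ltW r0) (KP (phi n)) zr)).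
  rewrite /partial_sum -sumrB (le_trans (normc_sum _ _ _))//.
  apply: (@le_trans _ _ (n.+1%:R^-1 * S)).
    rewrite /S mulr_sumr big_seq [leRHS]big_seq; apply: ler_sum => al.
    rewrite mem_multinoms_lt => alN.
    rewrite -mulrBl Normc.normcM ler_pM ?normc_ge0//.
      by apply: phic; exact: leq_trans nN.
    by apply: normc_mon_le => i; rewrite mxE subr0.
  rewrite mulrC ler_pdivrMr// mulrC -ler_pdivrMr//.
  by rewrite (le_trans (ltW (truncnS_gt _)))// ler_nat ltnS.
have mf : cmeasurable setT f by exact: expands_cmeasurable fc.
have mw := @measurable_fock_weight R d setT.
have fatou_f : (\int[leb]_z (nm (f z) ^+ 2 * w z)%:E <= 1%:E)%E.
  have mh n : measurable_fun setT (fun z => (nm (u (phi n) z) ^+ 2 * w z)%:E).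
    by apply: L2_measurable_sqr => //; exact: expands_cmeasurable (ub _).
  have h0 n z : setT z -> (0 <= (nm (u (phi n) z) ^+ 2 * w z)%:E)%E.
    by move=> _; apply: L2_sqr_ge0; exact: fock_weight_ge0.
  have := fatou leb measurableT mh h0.
  have -> : (\int[leb]_z limn_einf (fun n => (nm (u (phi n) z) ^+ 2 * w z)%:E) =
    \int[leb]_z (nm (f z) ^+ 2 * w z)%:E)%E.
    apply: eq_integral => z _.
    have cv : (fun n => nm (u (phi n) z)) @ \oo --> nm (f z).
      apply/cvgrPdist_le => e e0.
      pose r := 1 + \sum_i nm (z ord0 i).
      have r0 : 0 < r by rewrite ltr_pwDl// sumr_ge0// => i _; exact: normc_ge0.
      have zr i : nm (z ord0 i) <= r.
        rewrite /r (bigD1 i)//= addrCA lerDl addr_ge0// sumr_ge0// => j _; exact: normc_ge0.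
      have [n0 n0P] := unif r e r0 e0; exists n0 => // n /= n0n.
      rewrite ler_distlC; have := n0P n n0n z zr => h; apply/andP; split.
        rewrite lerBlDr (_ : f z = u (phi n) z - (u (phi n) z - f z)); last by ring.
        by rewrite (le_trans (normc_triangle _ _))// normc_opp lerD.
      rewrite [X in nm X](_ : u (phi n) z = f z + (u (phi n) z - f z)); last by ring.
      by rewrite (le_trans (normc_triangle _ _))// lerD.
    have cv2 : (fun n => (nm (u (phi n) z) ^+ 2 * w z)%:E) @ \oo --> (nm (f z) ^+ 2 * w z)%:E.
      apply: cvg_EFin; first by apply: nearW.
      apply: cvgMl; rewrite expr2; under eq_fun do rewrite expr2.
      exact: cvgM.
    by have [-> _] := cvg_limn_einf_sup cv2.
  move=> /le_trans; apply; apply: limn_einf_le => n.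
  by rewrite fock_ip_integral// lee_fin.
have Lf : FL2 f by split => //; exact: le_lt_trans fatou_f (ltry _).
exists f, c, phi; split => //.
by rewrite -lee_fin -fock_ip_integral.
Qed.

End montel.

(** * Gaussian integrals *)

Section gaussian.
Context {R : realType}.
Local Notation mu := (@lebesgue_measure R).
Local Notation mu2 := (prod_measure mu mu).

(** Read off from the normalisation of the standard normal density. The exponent is half that of the
    Fock weight: the other half absorbs polynomial growth in [shifted_poly_norm]. *)
Lemma integral_gauss_half : exists2 J : R, 0 < J &
  (\int[mu]_x (expR (- (x ^+ 2 / 2)))%:E = J%:E)%E.
Proof.
have p0 : 0 < normal_peak (1 : R) by rewrite normal_peak_gt0// oner_eq0.
exists (normal_peak 1)^-1; first by rewrite invr_gt0.
have mN := @measurable_normal_pdf R 0 1.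
transitivity (\int[mu]_x ((normal_peak (1:R))^-1%:E * (normal_pdf 0 1 x)%:E))%E; last first.
  rewrite ge0_integralZl//=.
  - by rewrite integral_normal_pdf mule1.
  - exact/measurable_EFinP.
  - by move=> x _; rewrite lee_fin normal_pdf_ge0.
  - by rewrite lee_fin invr_ge0 ltW.
apply: eq_integral => x _; rewrite -EFinM normal_pdfE ?oner_eq0//=.
rewrite mulrA mulVf ?gt_eqF// mul1r /normal_fun subr0 expr1n mulNr.
by congr (expR (- (_ / _)))%:E.
Qed.

Lemma integral2_gauss_half : exists2 J : R, 0 < J &
  (\int[mu2]_x (expR (- ((x.1 ^+ 2 + x.2 ^+ 2) / 2)))%:E = J%:E)%E.
Proof.
have [J J0 JE] := integral_gauss_half.
exists (J * J); first exact: mulr_gt0.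
pose g (x : R * R) := expR (- ((x.1 ^+ 2 + x.2 ^+ 2) / 2)).
have mg1 : measurable_fun setT (fun x : R => expR (- (x ^+ 2 / 2))).
  apply: measurableT_comp => //; apply: measurable_funN; apply: measurable_funM => //.
have mg : measurable_fun setT (EFin \o g).
  apply/measurable_EFinP; apply: measurableT_comp => //; apply: measurable_funN.
  apply: measurable_funM => //.
  by apply: measurable_funD; apply: measurable_funX.
have g0 x : (0 <= (EFin \o g) x)%E by rewrite lee_fin expR_ge0.
apply: (etrans (prod_measure_tonelli1 mu mu mg g0)).
have m1 : measurable_fun setT (fun x : R => (expR (- (x ^+ 2 / 2)))%:E) by exact/measurable_EFinP.
have p0 (x : R) : setT x -> (0 <= (expR (- (x ^+ 2 / 2)))%:E)%E by rewrite lee_fin expR_ge0.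
have J0' : (0 <= J%:E)%E by rewrite lee_fin ltW.
transitivity (\int[mu]_x ((expR (- (x ^+ 2 / 2)))%:E * J%:E))%E; last first.
  by apply: (etrans (ge0_integralZr mu measurableT m1 p0 J0')); rewrite JE EFinM.
apply: eq_integral => x _; rewrite -JE.
have e0 : (0 <= (expR (- (x ^+ 2 / 2)))%:E)%E by rewrite lee_fin expR_ge0.
apply: (etrans _ (ge0_integralZl mu measurableT m1 p0 e0)).
apply: eq_integral => y _; rewrite -EFinM /= /g/= -expRD; congr (expR _)%:E.
by field.
Qed.

End gaussian.

(** * Polynomials centred at a point *)

Section shifted_polynomials.
Context {R : realType} {d : nat}.
Local Notation C := R[i].
Local Notation nm := (@Normc.normc R).
Local Notation leb := (lebesgue_Cspace R d).
Local Notation w := (@fock_weight R d).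
Local Notation FL2 := (L2 setT w).
Local Notation fip := (@fock_ip R d).
Implicit Types (a z : Cspace R d).

Definition cube_multinom N (f : {ffun 'I_d -> 'I_N}) : multinom d :=
  Multinom [tuple (f i : nat) | i < d].

Lemma cube_multinomE N (f : {ffun 'I_d -> 'I_N}) i : cube_multinom f i = f i.
Proof. by rewrite multinomE tnth_mktuple. Qed.

Lemma cube_multinom_inj N : injective (@cube_multinom N).
Proof.
move=> f g /mnmP fg; apply/ffunP => i; apply: val_inj.
by have := fg i; rewrite !cube_multinomE.
Qed.

Lemma mdeg_cube_multinom N (f : {ffun 'I_d -> 'I_N}) : (mdeg (cube_multinom f) <= d * N)%N.
Proof.
rewrite mdegE (@leq_trans (\sum_(i < d) N))//.
  by apply: leq_sum => i _; rewrite cube_multinomE ltnW.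
by rewrite sum_nat_const card_ord.
Qed.

Definition shifted_poly a N (b : {ffun 'I_d -> 'I_N} -> C) z : C :=
  \sum_f b f * mon a (cube_multinom f) z.

Lemma cmeasurable_shifted_poly D a N (b : {ffun 'I_d -> 'I_N} -> C) :
  cmeasurable D (shifted_poly a b).
Proof.
by apply: cmeasurable_sum => f; apply: cmeasurableM;
  [exact: cmeasurable_cst|exact: cmeasurable_mon].
Qed.

Lemma shifted_poly_holomorphic D a N (b : {ffun 'I_d -> 'I_N} -> C) :
  holomorphic D (shifted_poly a b).
Proof.
move=> z _; apply: quadratically_approximable_differentiable.
have [B B1 zB] : exists2 B : R, 1 <= B & forall i, nm ((z - a) ord0 i) + 1 <= B.
  have s0 (P : pred 'I_d) : 0 <= \sum_(i | P i) nm ((z - a) ord0 i).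
    by apply: sumr_ge0 => i _; exact: normc_ge0.
  exists (1 + \sum_i nm ((z - a) ord0 i)); first by rewrite lerDl.
  by move=> i; rewrite addrC lerD2l (bigD1 i)//= lerDl.
have [g gP] := choice (fun f : {ffun 'I_d -> 'I_N} => quadratic_mon (cube_multinom f) zB B1).
have monE al y : mon a al y = mon 0 al (y - a).
  by apply: eq_bigr => i _; rewrite !mxE subr0.
exists (fun i => \sum_f b f * g f i).
exists (\sum_f nm (b f) * (d%:R * (4 * B) ^+ mdeg (cube_multinom f))) => h e e01 he.
have -> : lin_form (fun i => \sum_f b f * g f i) h = \sum_f b f * lin_form (g f) h.
  rewrite /lin_form; under eq_bigr do rewrite mulr_sumr.
  rewrite exchange_big/=; apply: eq_bigr => f _; rewrite mulr_sumr.
  by apply: eq_bigr => i _; rewrite mulrCA.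
rewrite /shifted_poly -!sumrB (le_trans (normc_sum _ _ _))// mulr_suml.
apply: ler_sum => f _; rewrite -!mulrBr Normc.normcM -mulrA ler_wpM2l ?normc_ge0//.
have [_ /(_ h e e01 he)] := gP f.
by rewrite !monE -[h + z - a]addrA.
Qed.

(** The inequality [1 + y <= expR y] at [y = x / (2 * m%:R)], raised to the power [m]. *)
Lemma expr_le_expR (x : R) m : 0 <= x -> (0 < m)%N ->
  x ^+ m <= (2 * m%:R) ^+ m * expR (x / 2).
Proof.
move=> x0 m0; have m0' : 0 < m%:R :> R by rewrite ltr0n.
have -> : x / 2 = m%:R * (x / (2 * m%:R)) by field; rewrite gt_eqF.
have e0 : 0 <= 2 * m%:R * expR (x / (2 * m%:R)).
  by rewrite mulr_ge0 ?expR_ge0// mulr_ge0// ltW.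
rewrite expRM_natl -exprMn lerXn2r ?nnegrE//.
rewrite mulrC -ler_pdivrMr ?mulr_gt0// (le_trans _ (expR_ge1Dx _))//.
by rewrite lerDr.
Qed.

(** A single quantity [X z >= 1] dominates all [nm (z ord0 i - a ord0 i)], so the polynomial is at
    most the sum of its coefficients times [X z ^+ (d * N)]. Half of the Gaussian weight absorbs the
    square of this power. *)
Lemma shifted_poly_norm a : exists2 G : R, 0 < G &
  forall N (b : {ffun 'I_d -> 'I_N} -> C), (0 < d * N)%N ->
  FL2 (shifted_poly a b) /\
  complex.Re (fip (shifted_poly a b) (shifted_poly a b)) <=
    (\sum_f nm (b f)) ^+ 2 * (4 * (d * N)%:R) ^+ (2 * (d * N)) * G.
Proof.
pose A : R := 1 + \sum_i nm (a ord0 i).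
have sa0 (P : pred 'I_d) : 0 <= \sum_(i | P i) nm (a ord0 i).
  by apply: sumr_ge0 => i _; exact: normc_ge0.
have A1 : 1 <= A by rewrite lerDl.
(* Squares are used so that [expR (X z / 2)] is, up to a constant, the inverse square root of the
   weight; the 1 in [A] gives [x <= 1 + x ^+ 2]. *)
pose X z : R := A + \sum_i nm (z ord0 i) ^+ 2.
have s2 z (P : pred 'I_d) : 0 <= \sum_(i | P i) nm (z ord0 i) ^+ 2.
  by apply: sumr_ge0 => i _; exact: sqr_ge0.
have X1 z : 1 <= X z by rewrite /X (le_trans A1)// lerDl.
have zaX z i : nm (z ord0 i - a ord0 i) <= X z.
  rewrite (le_trans (normc_triangle _ _))// normc_opp /X /A.
  rewrite (bigD1 i)//= [\sum_i0 nm (z _ _) ^+ 2](bigD1 i)//=.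
  have := sa0 (fun j => j != i); have := s2 z (fun j => j != i).
  have := normc_ge0 (z ord0 i); have := sqr_ge0 (nm (z ord0 i) - 1); rewrite !expr2; nra.
have [J J0 JE] := @integral2_gauss_half R.
pose gs (i : 'I_d) (x : R * R) : R := expR (- ((x.1 ^+ 2 + x.2 ^+ 2) / 2)).
have mgs i : measurable_fun setT (gs i).
  apply: measurableT_comp => //; apply: measurable_funN.
  apply: measurable_funM => //.
  by apply: measurable_funD; apply: measurable_funX.
have iG : (\int[leb]_z (expR (- ((\sum_i nm (z ord0 i) ^+ 2) / 2)))%:E = (J ^+ d)%:E)%E.
  have := @ge0_integral_Cspace_prod R d gs (fun=> J) mgs (fun i x => expR_ge0 _) (fun i => JE).
  rewrite prodr_const card_ord => <-; apply: eq_integral => z _; congr EFin.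
  rewrite mulr_suml -sumrN expR_sum; apply: eq_bigr => i _.
  by rewrite /gs /Ccoord/= normc_sqr.
have mH : measurable_fun setT (fun z : Cspace R d => expR (- ((\sum_i nm (z ord0 i) ^+ 2) / 2))).
  apply: measurableT_comp => //; apply: measurable_funN; apply: measurable_funM => //.
  by apply: measurable_sum => i; exact/measurable_normc_sqr/cmeasurable_coord.
exists (expR (A / 2) * pi ^- d * J ^+ d).
  by rewrite mulr_gt0 ?exprn_gt0// mulr_gt0 ?expR_gt0// invr_gt0 exprn_gt0// pi_gt0.
move=> N b dN0; set m := (2 * (d * N))%N; set P := shifted_poly a b.
set S := \sum_f nm (b f).
have S0 : 0 <= S by apply: sumr_ge0 => f _; exact: normc_ge0.
have mP : cmeasurable setT P by exact: cmeasurable_shifted_poly.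
pose k : R := S ^+ 2 * (4 * (d * N)%:R) ^+ m * expR (A / 2) * pi ^- d.
have k0 : 0 <= k.
  rewrite !mulr_ge0 ?sqr_ge0 ?exprn_ge0 ?expR_ge0// ?mulr_ge0// ?invr_ge0 ?exprn_ge0 ?pi_ge0//.
have PX z : nm (P z) ^+ 2 <= S ^+ 2 * X z ^+ m.
  rewrite /m mulnC exprM -exprMn lerXn2r ?nnegrE ?normc_ge0//.
    by rewrite mulr_ge0// exprn_ge0// (le_trans _ (X1 z)).
  rewrite (le_trans (normc_sum _ _ _))// mulr_suml; apply: ler_sum => f _.
  rewrite Normc.normcM ler_wpM2l ?normc_ge0//.
  rewrite (le_trans (normc_mon_le _ (zaX z)))// ler_weXn2l//.
  exact: mdeg_cube_multinom.
have pt z : nm (P z) ^+ 2 * w z <= k * expR (- ((\sum_i nm (z ord0 i) ^+ 2) / 2)).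
  set T := \sum_i nm (z ord0 i) ^+ 2.
  have -> : k * expR (- (T / 2)) = S ^+ 2 * ((4 * (d * N)%:R) ^+ m * expR (X z / 2)) * (pi ^- d * expR (- T)).
    have E : expR (X z / 2) * expR (- T) = expR (A / 2) * expR (- (T / 2)).
      by rewrite -!expRD /X -/T; congr expR; field.
    transitivity (S ^+ 2 * (4 * (d * N)%:R) ^+ m * pi ^- d * (expR (X z / 2) * expR (- T))).
      by rewrite E /k; ring.
    by ring.
  rewrite ler_wpM2r ?fock_weight_ge0// (le_trans (PX z))// ler_wpM2l ?sqr_ge0//.
  (* With [m = 2 * (d * N)] the factor [2 * m%:R] is the [4 * (d * N)%:R] of the statement. *)
  have := @expr_le_expR (X z) m (le_trans ler01 (X1 z)) _.
  rewrite /m natrM mulrA -natrM; apply; rewrite muln_gt0//.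
have le1 : (\int[leb]_z (nm (P z) ^+ 2 * w z)%:E <= (k * J ^+ d)%:E)%E.
  have mH' := proj2 (measurable_EFinP _ _) mH.
  have H0 z : setT z -> (0 <= (EFin \o (fun z : Cspace R d =>
      expR (- ((\sum_i nm (z ord0 i) ^+ 2) / 2)))) z)%E.
    by rewrite lee_fin expR_ge0.
  have k0' : (0 <= k%:E)%E by rewrite lee_fin.
  rewrite EFinM -iG -(ge0_integralZl leb measurableT mH' H0 k0').
  apply: ge0_le_integral => //.
  - by move=> z _; apply: L2_sqr_ge0; exact: fock_weight_ge0.
  - by apply: L2_measurable_sqr => //; exact: measurable_fock_weight.
  - by apply: measurable_funeM; exact/measurable_EFinP.
  - by move=> z _; rewrite -EFinM lee_fin.
have LP : FL2 P by split => //; exact: le_lt_trans le1 (ltry _).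
split=> //; rewrite -lee_fin -fock_ip_integral// (le_trans le1)// lee_fin /k.
by rewrite le_eqVlt; apply/orP; left; apply/eqP; ring.
Qed.

(** Since [r <= 1], every monomial of the cube is at least [r ^+ (d * N)] on the polyannulus,
    whatever its degree; [coef_mon_le] discards the other terms. *)
Lemma shifted_poly_lower a (r : R) : 0 < r <= 1 -> exists2 V : R, 0 < V &
  forall N (b : {ffun 'I_d -> 'I_N} -> C) f,
  ((nm (b f) ^+ 2 * (r ^+ (2 * (d * N)) * V))%:E <=
   \int[leb]_(z in polyannulus a r) (nm (shifted_poly a b z) ^+ 2)%:E)%E.
Proof.
move=> /andP[r0 r1]; have [V V0 DV] := @polyannulus_volume R d a r r0.
set D := polyannulus a r in DV *.
have mD : measurable D by exact: polyannulus_measurable.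
exists V => // N b f.
have rot w' : (forall j, nm (w' j) = 1) -> rotC a w' @^-1` D = D.
  exact: polyannulus_rotC.
pose s := rem f (enum {: {ffun 'I_d -> 'I_N}}).
have sf : all (fun g => cube_multinom f != cube_multinom g) s.
  apply/allP => g; rewrite mem_rem_uniq ?enum_uniq// inE => /andP[/= gf _].
  by rewrite (inj_eq (@cube_multinom_inj N)) eq_sym.
have := @coef_mon_le R d _ (@cube_multinom N) a D (cube_multinom f) s (b f) b mD rot sf.
have -> : (\int[leb]_(z in D) (nm (b f * mon a (cube_multinom f) z +
    \sum_(i <- s) b i * mon a (cube_multinom i) z) ^+ 2)%:E =
    \int[leb]_(z in D) (nm (shifted_poly a b z) ^+ 2)%:E)%E.
  apply: eq_integral => z _; rewrite /shifted_poly -[in RHS]big_enum/=.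
  by rewrite [in RHS](big_rem f) ?mem_enum.
apply: le_trans.
rewrite mulrA EFinM -DV -integral_cst//; apply: ge0_le_integral => //.
- by move=> z _; rewrite /= lee_fin mulr_ge0 ?sqr_ge0// exprn_ge0// ltW.
- apply/measurable_EFinP/measurable_normc_sqr/cmeasurableM.
    exact: cmeasurable_cst.
  exact: cmeasurable_mon.
- move=> z zD; rewrite lee_fin Normc.normcM exprMn ler_wpM2l ?sqr_ge0//.
  rewrite mulnC exprM lerXn2r ?nnegrE ?exprn_ge0 ?normc_ge0 ?(ltW r0)//.
  rewrite (@le_trans _ _ (r ^+ mdeg (cube_multinom f)))//.
    by rewrite ler_wiXn2l ?(ltW r0)// mdeg_cube_multinom.
  by apply: normc_mon_ge => [|i]; [exact: ltW|case/andP: (zD i)].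
Qed.

End shifted_polynomials.

(** * The Bergman space and the operator L *)

Section bergman.
Context {R : realType} {d : nat} (Omega : set (Cspace R d)).
Hypotheses (Omega_open : open Omega) (Omega_bounded : bounded_set Omega).
Local Notation C := R[i].
Local Notation nm := (@Normc.normc R).
Local Notation leb := (lebesgue_Cspace R d).
Local Notation fip := (@fock_ip R d).
Local Notation bip := (@bergman_ip R d Omega).
Local Notation BL2 := (L2 Omega (fun=> 1 : R)).
Implicit Types (f g u v : Cspace R d -> C) (z : Cspace R d) (a : multinom d -> C).

Let mO : measurable Omega. Proof. exact: open_Cspace_measurable. Qed.

Lemma bergman_ipE f g : bip f g = wip Omega (fun=> 1 : R) f g.
Proof.
by rewrite /bergman_ip /wip; congr Cintegral; apply/funext => z; rewrite mulr1.
Qed.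

Lemma bergman_psd : psd_form BL2 bip.
Proof.
have -> : bip = wip Omega (fun=> 1 : R).
  by apply/funext => f; apply/funext => g; exact: bergman_ipE.
exact: wip_psd.
Qed.

Lemma BL2_subspace : subspace BL2.
Proof. exact: L2_subspace. Qed.

Lemma BL2E f : cmeasurable Omega f ->
  (\int[leb]_(z in Omega) (nm (f z) ^+ 2)%:E < +oo)%E -> BL2 f.
Proof.
by move=> mf foo; split => //; under eq_integral do rewrite mulr1.
Qed.

Lemma bergman_BL2 u : bergman Omega u -> BL2 u.
Proof. by move=> [hu uoo]; apply: BL2E => //; exact: holomorphic_cmeasurable. Qed.

Lemma Omega_volume : (leb Omega < +oo)%E.
Proof.
have [M M0 OM] := bounded_set_Cspace Omega_bounded.
pose I : 'I_d -> R := fun=> (2 * M) * (2 * M).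
pose S : set (R * R) := `[- M, M]%classic `*` `[- M, M]%classic.
have mS : measurable S by apply: measurableX; exact: measurable_itv.
pose g (_ : 'I_d) : R * R -> R := \1_S.
have mg i : measurable_fun setT (g i) by exact: measurable_indic.
have g0 i x : 0 <= g i x by rewrite /g indicE.
have gI i : (\int[prod_measure lebesgue_measure lebesgue_measure]_x (g i x)%:E = (I i)%:E)%E.
  rewrite integral_indic ?setIT//.
  have len : (@lebesgue_measure R) `[- M, M]%classic = (2 * M)%:E.
    by rewrite lebesgue_measure_itv/= lte_fin gtrN// -EFinB; congr EFin; ring.
  rewrite /I EFinM -len.
  exact: (@product_measure1E _ _ _ _ R lebesgue_measure lebesgue_measure _ _ (measurable_itv `[- M, M]) (measurable_itv `[- M, M])).
have E := ge0_integral_Cspace_prod mg g0 gI.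
apply: (@le_lt_trans _ _ (\prod_i I i)%:E); last exact: ltry.
rewrite -E -[X in (X <= _)%E]mul1e -integral_cst//.
rewrite integral_mkcond; apply: ge0_le_integral => //.
- by move=> z _; rewrite /patch; case: ifP => // _; rewrite lee_fin.
- by apply/(measurable_restrictT _ mO); exact: measurable_cst.
- apply/measurable_EFinP; apply: measurable_prod => i _.
  exact: measurableT_comp (mg i) (measurable_Ccoord i).
- move=> z _; rewrite /patch; case: ifPn => [|_]; last by rewrite lee_fin prodr_ge0.
  rewrite inE => zO; rewrite lee_fin big1// => i _.
  rewrite /g indicE mem_set//; split; rewrite /= in_itv/= -ler_norml.
    exact: le_trans (normc_Re _) (OM z zO i).
  exact: le_trans (normc_Im _) (OM z zO i).
Qed.

Lemma bergman_sqr_le f (M : R) : cmeasurable Omega f ->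
  (forall z, Omega z -> nm (f z) <= M) ->
  BL2 f /\ complex.Re (bip f f) <= M ^+ 2 * fine (leb Omega).
Proof.
move=> mf fM.
have h := sqr_integral_bounded mO mf fM.
have V0 : leb Omega \is a fin_num by rewrite ge0_fin_numE// Omega_volume.
have Bf : BL2 f.
  by apply: BL2E => //; rewrite (le_lt_trans h)// -(fineK V0) -EFinM ltry.
split=> //; rewrite -lee_fin bergman_ipE -wip_ff_integral//.
rewrite [X in (_ <= X)%E]EFinM fineK//.
by under eq_integral do rewrite mulr1.
Qed.

Lemma bergman_ff_integral f : BL2 f ->
  (\int[leb]_(z in Omega) (nm (f z) ^+ 2)%:E = (complex.Re (bip f f))%:E)%E.
Proof.
move=> Bf; rewrite bergman_ipE -wip_ff_integral//.
by under [RHS]eq_integral do rewrite mulr1.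
Qed.

Lemma expands_bounded f a (r : R) : 0 < r -> expands f a ->
  exists M : R, forall z, (forall i, nm (z ord0 i) <= r) -> nm (f z) <= M.
Proof.
move=> r0 fa; have [K aK] : exists K, coef_bound a (4 * r) K.
  by apply: fa.1; rewrite mulr_gt0.
exists (K * 2 ^+ d) => z zr; have := expands_dist 0 fa (ltW r0) aK zr.
by rewrite expr0 mulr1 /partial_sum multinoms_lt0 big_nil subr0.
Qed.

Lemma expands_BL2 f a : expands f a -> BL2 f.
Proof.
move=> fa; have [r r0 Or] := bounded_set_Cspace Omega_bounded.
have [M fM] := expands_bounded r0 fa.
have mf : cmeasurable Omega f by exact: expands_cmeasurable fa.
by have [] := @bergman_sqr_le f M mf (fun z zO => fM z (Or z zO)).
Qed.

Lemma opow_Mz al : opow (@Mz R d) al (cst 1) = fun z => mmap1 (fun i => z ord0 i) al.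
Proof.
have itE (v : Cspace R d -> C) i n : iter n (Mz i) v = fun z => z ord0 i ^+ n * v z.
  elim: n => [|n IHn]; first by apply/funext => z; rewrite expr0 mul1r.
  by rewrite iterS IHn /Mz; apply/funext => z; rewrite exprS mulrA.
have E (s : seq 'I_d) : foldr (fun i v => iter (al i) (@Mz R d i) v) (cst 1) s =
    fun z => \prod_(i <- s) z ord0 i ^+ al i.
  elim: s => [|i s IHs] /=; first by apply/funext => z; rewrite big_nil.
  by rewrite IHs itE; apply/funext => z; rewrite big_cons.
by rewrite /opow E; apply/funext => z; rewrite big_enum.
Qed.

(* [iota f] is [f] up to a vector of length 0. *)
Lemma iota_ip f u : fock f -> bergman Omega u ->
  is_funcalc bip (@Mz R d) (cst 1) f u -> forall g, BL2 g -> bip u g = bip f g.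
Proof.
move=> ff bu [a fa ua] g Bg.
have fa' := entire_expansion_expands fa.
have Bf := expands_BL2 fa'.
have Bu := bergman_BL2 bu.
have sB := BL2_subspace; have pB := bergman_psd.
pose p n : Cspace R d -> C := partial_sum a n.
have Bp n : BL2 (p n).
  have [r r0 Or] := bounded_set_Cspace Omega_bounded.
  have mp : cmeasurable Omega (p n) by exact: cmeasurable_partial_sum.
  have h z : Omega z -> nm (p n z) <= \sum_(al <- multinoms_lt n) nm (a al) * r ^+ mdeg al.
    move=> zO; rewrite (le_trans (normc_sum _ _ _))//; apply: ler_sum => al _.
    rewrite Normc.normcM ler_wpM2l ?normc_ge0// normc_mon_le// => i.
    by rewrite mxE subr0 Or.
  by have [] := bergman_sqr_le mp h.
have pE n : \sum_(al : bmultinom d n) a al *: opow (@Mz R d) al (cst 1) = p n.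
  apply/funext => z; rewrite fct_sumE.
  rewrite (sum_bmultinomE n (fun al => (a al *: opow (@Mz R d) al (cst 1)) z)).
  by apply: eq_bigr => al _; rewrite opow_Mz mon0E.
have up : (fun n => complex.Re (bip (p n - u) (p n - u))) @ \oo --> (0 : R).
  have -> : (fun n => complex.Re (bip (p n - u) (p n - u))) =
      (fun n => ip_norm bip (p n - u) * ip_norm bip (p n - u)).
    apply/funext => n; rewrite -expr2 sqr_sqrtr//.
    by apply: (form_ge0 pB); exact: (subspaceB sB).
  rewrite -[X in _ --> X](mulr0 (0 : R)).
  by apply: cvgM; under eq_fun do rewrite -pE.
have fp : (fun n => complex.Re (bip (f - p n) (f - p n))) @ \oo --> (0 : R).
  have [r r0 Or] := bounded_set_Cspace Omega_bounded.
  have [K aK] : exists K, coef_bound a (4 * r) K by apply: fa'.1; rewrite mulr_gt0.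
  apply: (@cvg0_le _ _ (fun n => ((K * 2 ^+ d) ^+ 2 * fine (leb Omega) * (1 / 2) ^+ n) * (1 / 2) ^+ n)).
    move=> n; rewrite (form_ge0 pB)/=; last exact: (subspaceB sB).
    have [_ h] := @bergman_sqr_le (f - p n) (K * 2 ^+ d * (1 / 2) ^+ n)
      (cmeasurableB Bf.1 (Bp n).1) (fun z zO => expands_dist n fa' (ltW r0) aK (Or z zO)).
    by rewrite (le_trans h)// le_eqVlt; apply/orP; left; apply/eqP; ring.
  have h : (fun n : nat => (1 / 2 : R) ^+ n) @ \oo --> (0 : R).
    by apply: cvg_expr; rewrite ger0_norm ?divr_ge0//; lra.
  rewrite -[X in _ --> X](mulr0 ((K * 2 ^+ d) ^+ 2 * fine (leb Omega) * 0)).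
  by apply: cvgM => //; apply: cvgMr.
(* The partial sums [p n] tend to [u] by the functional calculus and to [f] by uniform convergence
   on the bounded set [Omega]. *)
have fu0 : complex.Re (bip (f - u) (f - u)) <= 0.
  apply/ler_addgt0Pr => e e0; rewrite add0r.
  have e40 : 0 < e / 4 by rewrite divr_gt0.
  move: up => /cvgrPdist_le/(_ _ e40)[n1 _ h1].
  move: fp => /cvgrPdist_le/(_ _ e40)[n2 _ h2].
  pose n := maxn n1 n2.
  have := h1 n (leq_maxl _ _); have := h2 n (leq_maxr _ _).
  rewrite !sub0r !normrN => /(le_trans (ler_norm _)) h3 /(le_trans (ler_norm _)) h4.
  have -> : f - u = (f - p n) + (p n - u) by rewrite addrA subrK.
  rewrite (le_trans (form_sqrD_le sB pB ltr01 _ _))//; [exact: (subspaceB sB)..|].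
  by rewrite invr1; lra.
apply/eqP; rewrite eq_sym -subr_eq0 -(formBl pB)//; apply/eqP.
by apply: (form_eq0 sB pB) => //; exact: (subspaceB sB).
Qed.

Section operator.
Variable L : (Cspace R d -> C) -> Cspace R d -> C.
Hypothesis hL : is_L (bergman Omega) bip (@Mz R d) (cst 1) L.

(** The functional calculus demanded of [iota] includes an entire expansion of its argument. *)
Lemma fock_expands f : fock f -> exists a, expands f a.
Proof.
move=> ff; have [iota [iotas [hi _ _]]] := hL.
have [_ [a fa _]] := hi f ff.
by exists a; exact: entire_expansion_expands fa.
Qed.

Lemma L_fock f : fock f -> fock (L f).
Proof.
move=> ff; have [iota [iotas [hi hs LE]]] := hL.
rewrite LE//; have [bf _] := hi f ff.
by have [] := hs _ bf.
Qed.

(** The adjoint relation gives the inner product of [iota g] and [iota f], and [iota_ip] replaces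
    each by the function itself. *)
Lemma L_ip f g : fock f -> fock g -> fip g (L f) = bip g f.
Proof.
move=> ff fg; have [iota [iotas [hi hs LE]]] := hL.
have [bf cf] := hi f ff; have [bg cg] := hi g fg.
have [_ /(_ g fg) E] := hs _ bf; rewrite LE// -E.
have [a fa] := fock_expands ff; have [b gb] := fock_expands fg.
have Bf := expands_BL2 fa; have Bg := expands_BL2 gb.
have Buf := bergman_BL2 bf; have Bug := bergman_BL2 bg.
rewrite (iota_ip fg bg cg)//.
have pB := bergman_psd.
by rewrite (formC pB Buf Bg) (iota_ip ff bf cf)// -(formC pB Bf Bg).
Qed.

End operator.
End bergman.

(** * Eigenvectors and eigenvalues *)

Section rayleigh.
Context {R : realType} {V : lmodType R[i]}.
Local Notation C := R[i].
Variables (F : set V) (G B : V -> V -> C) (L : V -> V) (M0 : R).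
Hypotheses (sF : subspace F) (pG : psd_form F G) (pB : psd_form F B)
  (G_definite : forall f, F f -> complex.Re (G f f) <= 0 -> f = 0)
  (FL : forall f, F f -> F (L f))
  (GL : forall f g, F f -> F g -> G g (L f) = B g f)
  (BM : forall f, F f -> complex.Re (B f f) <= M0 * complex.Re (G f f))
  (B_compact : forall u : nat -> V, (forall n, F (u n)) ->
    (forall n, complex.Re (G (u n) (u n)) <= 1) ->
    exists f (phi : nat -> nat), [/\ F f, complex.Re (G f f) <= 1,
      forall s, (s <= phi s)%N &
      (fun n => complex.Re (B (u (phi n) - f) (u (phi n) - f))) @ \oo --> (0 : R)]).

Lemma LG f g : F f -> F g -> G (L f) g = B f g.
Proof. by move=> Ff Fg; rewrite (formC pG Fg (FL Ff)) GL// -(formC pB Fg Ff). Qed.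

(* [f] maximises the Rayleigh quotient on the orthogonal of [e k], [k < K]. *)
Lemma eigenvector_orthogonal (K : nat) (e : nat -> V) (lam : nat -> R) (c : R) (p : V) :
  (forall k, F (e k)) -> (forall k, L (e k) = (lam k)%:C *: e k) ->
  (forall k, lam k != 0) -> 0 < c ->
  F p -> p != 0 -> (forall k, (k < K)%N -> G p (e k) = 0) ->
  c * complex.Re (G p p) <= complex.Re (B p p) ->
  exists (f : V) (M : R), [/\ F f, f != 0, c <= M, L f = M%:C *: f &
    forall k, (k < K)%N -> G f (e k) = 0].
Proof.
move=> Fe eL lam0 c0 Fp p0 pe pc.
pose W f := F f /\ forall k, (k < K)%N -> G f (e k) = 0.
(* As [e k] is an eigenvector with nonzero eigenvalue, orthogonality to it means the same for [G]
   and for [B]. *)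
have Be f k : F f -> B f (e k) = (lam k)%:C * G f (e k).
  by move=> Ff; rewrite -GL// eL (formZr sF pG)// conj_real.
have Gpos f : F f -> f != 0 -> 0 < complex.Re (G f f).
  move=> Ff fn0; rewrite lt_def (form_ge0 pG)// andbT.
  by apply: contraNneq fn0 => E; apply/eqP/G_definite => //; rewrite E.
have Wsub : subspace W.
  split; first by split=> [|k _]; [exact: sF.1|exact: (form0l sF pG)].
  move=> t u v [Fu eu] [Fv ev]; split=> [|k kK]; first exact: sF.2.
  by case: (pG) => /(_ t u v (e k) Fu Fv (Fe k)) -> _ _; rewrite eu// ev// mulr0 addr0.
have WF f : W f -> F f by case.
pose S := [set x : R | exists f, [/\ W f, complex.Re (G f f) <= 1 & x = complex.Re (B f f)]].
have nrm f : F f -> f != 0 -> exists t : R, [/\ 0 < t,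
    complex.Re (G (t%:C *: f) (t%:C *: f)) = 1 &
    complex.Re (B (t%:C *: f) (t%:C *: f)) = complex.Re (B f f) / complex.Re (G f f)].
  move=> Ff fn0; have g0 := Gpos f Ff fn0.
  exists (Num.sqrt (complex.Re (G f f)))^-1.
  have sq : (Num.sqrt (complex.Re (G f f)))^-1 ^+ 2 = (complex.Re (G f f))^-1.
    by rewrite exprVn sqr_sqrtr// ltW.
  have Z H : psd_form F H -> forall t : R, complex.Re (H (t%:C *: f) (t%:C *: f)) = t ^+ 2 * complex.Re (H f f).
    move=> pH t; rewrite (formZl sF pH)//; last exact: (subspaceZ sF).
    by rewrite (formZr sF pH)// conj_real mulrA -rmorphM ReM/= mul0r subr0 expr2.
  split; first by rewrite invr_gt0 sqrtr_gt0.
    by rewrite Z// sq mulVf// gt_eqF.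
  by rewrite Z// sq mulrC.
have S_ub : has_ubound S.
  exists `|M0| => _ [f [[Ff _] f1 ->]].
  rewrite (le_trans (BM Ff))// (@le_trans _ _ (`|M0| * complex.Re (G f f)))//.
    by rewrite ler_wpM2r ?(form_ge0 pG)// ler_norm.
  by rewrite ler_piMr.
have Wp : W p by [].
have S0 : S (complex.Re (B p p) / complex.Re (G p p)).
  have [t [t0 t1 t2]] := nrm p Fp p0.
  exists (t%:C *: p); split => //; last by rewrite t1.
  exact: (subspaceZ Wsub).
have supS : has_sup S by split => //; exists (complex.Re (B p p) / complex.Re (G p p)).
set M := sup S.
have cM : c <= M.
  apply: (@le_trans _ _ (complex.Re (B p p) / complex.Re (G p p))).
    by rewrite ler_pdivlMr// Gpos.
  exact: ub_le_sup.
have M0' : 0 < M by exact: lt_le_trans cM.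
have /choice[u uP] n : exists f, [/\ W f, complex.Re (G f f) <= 1 & M - n.+1%:R^-1 < complex.Re (B f f)].
  have n0 : 0 < n.+1%:R^-1 :> R by rewrite invr_gt0.
  have [x [f [Wf f1 ->]] lt] := sup_adherent n0 supS.
  by exists f.
have [f [phi [Ff f1 phis cv]]] := @B_compact u (fun n => WF _ (let: And3 h _ _ := uP n in h))
  (fun n => let: And3 _ h _ := uP n in h).
have Fu n : F (u n) by case: (uP n) => -[].
have Fuf n : F (u n - f) by exact: (subspaceB sF).
(* The maximising sequence converges for [B] only. Orthogonality passes to the limit for [B] by
   Cauchy-Schwarz, and returns to [G] because [lam k] is nonzero. *)
have Wf : W f.
  split=> // k kK.
  have Bfe : B f (e k) = 0.
    apply: Normc.eq0_normc; apply/eqP; rewrite -sqrf_eq0 eq_le sqr_ge0 andbT.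
    apply/ler_addgt0Pr => eps eps0; rewrite add0r.
    set b := complex.Re (B (e k) (e k)).
    have b0 : 0 <= b by exact: (form_ge0 pB).
    have eb : 0 < eps / (b + 1) by rewrite divr_gt0// ltr_wpDl.
    move: cv => /cvgrPdist_le/(_ _ eb)[n _ /(_ n (leqnn n))].
    rewrite sub0r normrN => /(le_trans (ler_norm _)) h.
    have := form_cauchy_schwarz sF pB (Fuf (phi n)) (Fe k).
    have [[_ uke] _ _] := uP (phi n).
    rewrite (formBl pB)// Be// uke// mulr0 sub0r normc_opp => /le_trans; apply.
    rewrite (le_trans (ler_wpM2r b0 h))// mulrAC ler_pdivrMr ?ltr_wpDl//.
    by rewrite ler_pM2l// lerDl.
  move: Bfe; rewrite Be// => /eqP; rewrite mulf_eq0 => /orP[|/eqP//].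
  by rewrite -[0]/(0%:C) eq_complex/= eqxx andbT (negbTE (lam0 k)).
(* Writing [u] as [f + (u - f)] costs the factors [1 + t] and [1 + t^-1]; the second term disappears
   in the limit, and then [t] tends to 0. *)
have Bff : M <= complex.Re (B f f).
  have key (t : R) : 0 < t -> M <= (1 + t) * complex.Re (B f f).
    move=> t0; apply/ler_addgt0Pr => eps eps0.
    have e0 : 0 < eps / 2 / (1 + t^-1) by rewrite !divr_gt0// addr_gt0// invr_gt0.
    have e20 : 0 < eps / 2 by rewrite divr_gt0.
    move: cv => /cvgrPdist_le/(_ _ e0)[n1 _ h1].
    pose n := maxn n1 (Num.truncn (eps / 2)^-1).
    have := h1 n (leq_maxl _ _).
    rewrite sub0r normrN => /(le_trans (ler_norm _)) h.
    have [_ _ Mu] := uP (phi n).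
    have := form_sqrD_le sF pB t0 Ff (Fuf (phi n)).
    rewrite addrC subrK => h2.
    have h3 : (phi n).+1%:R^-1 <= eps / 2.
      rewrite invf_ple ?posrE// (le_trans (ltW (truncnS_gt _)))// ler_nat ltnS.
      by rewrite (leq_trans _ (phis n))// leq_maxr.
    have h4 : (1 + t^-1) * complex.Re (B (u (phi n) - f) (u (phi n) - f)) <= eps / 2.
      by rewrite mulrC -ler_pdivlMr// addr_gt0// invr_gt0.
    move: (complex.Re (B (u (phi n)) (u (phi n)))) Mu h2 => x Mu h2.
    move: (complex.Re (B (u (phi n) - f) (u (phi n) - f))) h2 h4 => y h2 h4.
    move: (complex.Re (B f f)) h2 => q h2.
    move: ((phi n).+1%:R^-1) h3 Mu => v h3 Mu.
    move: ((1 + t^-1) * y) h2 h4 => y' h2 h4; move: ((1 + t) * q) h2 => q' h2.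
    lra.
  have q0 : 0 <= complex.Re (B f f) by exact: (form_ge0 pB).
  apply/ler_addgt0Pr => eps eps0.
  have t0 : 0 < eps / (complex.Re (B f f) + 1) by rewrite divr_gt0// ltr_wpDl.
  rewrite (le_trans (key _ t0))// mulrDl mul1r lerD2l mulrAC.
  by rewrite ler_pdivrMr ?ltr_wpDl// ler_pM2l// lerDl.
have fn0 : f != 0.
  apply: contraTneq Bff => ->; rewrite -ltNge (form0l sF pB)//; exact: sF.1.
have Gle g : W g -> complex.Re (B g g) <= M * complex.Re (G g g).
  move=> Wg; have Fg := WF _ Wg.
  have [->|gn0] := eqVneq g 0.
    by rewrite (form0l sF pB) ?(form0l sF pG)//=; [rewrite mulr0|exact: sF.1|exact: sF.1].
  have [t [t0 t1 t2]] := nrm g Fg gn0.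
  rewrite -ler_pdivrMr ?Gpos// -t2; apply: ub_le_sup => //.
  exists (t%:C *: g); split => //; last by rewrite t1.
  exact: (subspaceZ Wsub).
(* [Q] is semidefinite on [W] because [M] is the supremum, and the maximiser [f] is null for it.
   Hence [Q f] vanishes on [W], in particular at [L f - M%:C *: f], which lies in [W] since [L f]
   does. *)
pose Q u v := M%:C * G u v - B u v.
have pQ : psd_form W Q.
  split=> [t x y z Wx Wy Wz|x y Wx Wy|x Wx].
  - have [Fx Fy Fz] : [/\ F x, F y & F z] by split; exact: WF.
    rewrite /Q; case: (pG) => /(_ t x y z Fx Fy Fz) -> _ _.
    by case: (pB) => /(_ t x y z Fx Fy Fz) -> _ _; ring.
  - have [Fx Fy] : F x /\ F y by split; exact: WF.
    rewrite /Q (formC pG Fx Fy) (formC pB Fx Fy).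
    move: (G x y) (B x y) => [p1 q1] [p2 q2]; apply/eqP; rewrite eq_complex/=.
    by apply/andP; split; apply/eqP; ring.
  - rewrite /Q ReD ReN ReM/= mul0r subr0 subr_ge0; exact: Gle.
have Qff : complex.Re (Q f f) <= 0.
  rewrite /Q ReD ReN ReM/= mul0r subr0 subr_le0 (le_trans _ Bff)// ler_piMr// ltW//.
have WL : W (L f).
  split=> [|k kK]; first exact: FL.
  by rewrite LG// Be//; have [_ ->] := Wf; rewrite ?mulr0.
exists f, M; split => //; last by case: Wf.
apply/eqP; rewrite -subr_eq0; apply/eqP.
set g := L f - M%:C *: f.
have Wg : W g by apply: (subspaceB Wsub) => //; exact: (subspaceZ Wsub).
have Fg := WF _ Wg.
apply: G_definite => //.
have := form_eq0 Wsub pQ Wf Wg Qff; rewrite /Q => /eqP; rewrite subr_eq0 => /eqP E.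
have -> : G g g = 0; last by [].
rewrite {1}/g (formBl pG)//; [|exact: FL|exact: (subspaceZ sF)].
by rewrite LG// (formZl sF pG)// E subrr.
Qed.

End rayleigh.

(** The linear algebra behind both dimension counts. *)
Lemma row_kernel (K : fieldType) (n m : nat) (A : 'M[K]_(n, m)) : (m < n)%N ->
  exists2 u : 'rV[K]_n, u != 0 & u *m A = 0.
Proof.
move=> mn; have : kermx A != 0.
  by rewrite -mxrank_eq0 mxrank_ker subn_eq0 -ltnNge (leq_ltn_trans (rank_leq_col A)).
by case/rowV0Pn => u /sub_kermxP uA u0; exists u.
Qed.

Lemma psd_formS {R : realType} (V : lmodType R[i]) (F F' : set V) (B : V -> V -> R[i]) :
  F `<=` F' -> psd_form F' B -> psd_form F B.
Proof.
move=> FF' [h1 h2 h3]; split=> *; [apply: h1|apply: h2|apply: h3]; exact: FF'.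
Qed.

(** * Eigenvectors attached to the eigenvalue sequence *)

Section eigenvectors.
Context {R : realType} {V : lmodType R[i]}.
Local Notation C := R[i].
Variables (F : set V) (L : V -> V) (lambda : R^nat).
Hypotheses (F0 : F 0) (L0 : L 0 = 0).
Hypothesis lambda_neq0 : forall k, lambda k != 0.
Hypothesis eigen_dim : forall mu : C, mu != 0 -> exists2 n,
  has_dim [set f | F f /\ L f = mu *: f] n &
  ([set k | (lambda k)%:C = mu] #= `I_n)%card.

Lemma eigenvector_enumeration : exists e : nat -> V, [/\
  forall k, F (e k),
  forall k, L (e k) = (lambda k)%:C *: e k,
  forall (mu : C) f, mu != 0 -> F f -> L f = mu *: f ->
    exists (s : seq nat) (c : nat -> C), (forall k, k \in s -> (lambda k)%:C = mu) /\
      f = \sum_(k <- s) c k *: e k &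
  forall (mu : C) (s : seq nat) (c : nat -> C), mu != 0 -> uniq s ->
    (forall k, k \in s -> (lambda k)%:C = mu) ->
    \sum_(k <- s) c k *: e k = 0 -> forall k, k \in s -> c k = 0].
Proof.
(* For nonzero [mu], [D mu] packs the dimension of the eigenspace, a basis of it, and a bijection
   from the basis indices onto the [k] with [lambda k = mu]. *)
have /choice[D DP] (mu : C) : exists t : nat * (nat -> V) * (nat -> nat), mu != 0 ->
    [/\ forall i, (i < t.1.1)%N -> F (t.1.2 i) /\ L (t.1.2 i) = mu *: t.1.2 i,
     forall f, F f -> L f = mu *: f -> exists c : nat -> C, f = \sum_(i < t.1.1) c i *: t.1.2 i,
     forall c : nat -> C, \sum_(i < t.1.1) c i *: t.1.2 i = 0 -> forall i, (i < t.1.1)%N -> c i = 0 &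
     set_bij `I_(t.1.1) [set k | (lambda k)%:C = mu] t.2].
  have [->|mu0] := eqVneq mu 0; first by exists (0%N, fun=> 0, id).
  have [n [b Fb bP] /card_esym/card_set_bijP[j jP]] := eigen_dim mu0.
  pose b' i := if insub i is Some o then b o else 0.
  have b'E (i : 'I_n) : b' i = b i by rewrite /b' valK.
  exists (n, b', j) => _ /=; split => //.
  - move=> i ilt; have -> : b' i = b (Ordinal ilt) by rewrite -b'E.
    exact: Fb.
  - move=> f Ff Lf; have [c [fc _]] := bP f (conj Ff Lf).
    exists (fun i => if insub i is Some o then c o else 0).
    by rewrite fc; apply: eq_bigr => i _; rewrite valK b'E.
  - move=> c c0 i ilt.
    (* Uniqueness of the coordinates of 0 is the linear independence of the basis. *)
    have [c' [_ cu]] := bP 0 (conj F0 (etrans L0 (esym (scaler0 _ _)))).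
    have E1 := cu [ffun i : 'I_n => c i]; have E2 := cu [ffun=> 0].
    have : [ffun i : 'I_n => c i] = [ffun=> 0].
      rewrite -E1 ?E2//.
        by rewrite big1// => o _; rewrite ffunE scale0r.
      by rewrite -[LHS]c0; apply: eq_bigr => o _; rewrite ffunE b'E.
    by move=> /ffunP/(_ (Ordinal ilt)); rewrite !ffunE.
have lam0 k : (lambda k)%:C != 0 :> C by rewrite eq_complex/= eqxx andbT.
have /choice[q qP] k : exists i, (i < (D (lambda k)%:C).1.1)%N /\ (D (lambda k)%:C).2 i = k.
  have [_ _ _ [_ _ sj]] := DP _ (lam0 k).
  by have [i ilt E] := sj k erefl; exists i.
(* [q k] is the position of [k] among the indices sharing its eigenvalue. *)
pose e k := (D (lambda k)%:C).1.2 (q k).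
have eD mu i : mu != 0 -> (i < (D mu).1.1)%N -> e ((D mu).2 i) = (D mu).1.2 i /\
    q ((D mu).2 i) = i.
  move=> mu0 ilt; have [_ _ _ [fj ij _]] := DP _ mu0.
  have lE : (lambda ((D mu).2 i))%:C = mu by exact: fj.
  have [q1 q2] := qP ((D mu).2 i).
  have qE : q ((D mu).2 i) = i.
    by move: q1 q2; rewrite lE => q1 q2; apply: ij => //; rewrite inE.
  by rewrite /e qE lE.
exists e; split.
- by move=> k; have [h _ _ _] := DP _ (lam0 k); case: (h (q k) (qP k).1).
- by move=> k; have [h _ _ _] := DP _ (lam0 k); case: (h (q k) (qP k).1).
- move=> mu f mu0 Ff Lf; have [_ h _ [fj _ _]] := DP _ mu0.
  have [c fc] := h f Ff Lf.
  exists [seq (D mu).2 i | i <- iota 0 (D mu).1.1], (fun k => c (q k)); split.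
    move=> k /mapP[x]; rewrite mem_iota/= add0n => xlt ->; exact: fj.
  rewrite big_map fc; have -> : iota 0 (D mu).1.1 = index_iota 0 (D mu).1.1 by rewrite /index_iota subn0.
  rewrite big_mkord; apply: eq_bigr => i _.
  by have [-> ->] := eD mu i mu0 (ltn_ord i).
- move=> mu s c mu0 us sl s0.
  have [_ _ h [fj ij sj]] := DP _ mu0.
  pose n := (D mu).1.1; pose j := (D mu).2.
  have sE : \sum_(i < n) (if j i \in s then c (j i) else 0) *: (D mu).1.2 i = 0.
    rewrite -[RHS]s0.
    have pe : perm_eq s [seq j i | i <- iota 0 n & j i \in s].
      apply: uniq_perm => //.
        rewrite map_inj_in_uniq ?filter_uniq ?iota_uniq// => x y.
        by rewrite !mem_filter !mem_iota !add0n /= => /andP[_ xn] /andP[_ yn]; apply: ij; rewrite inE.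
      move=> k; apply/idP/mapP => [ks|[x]].
        have [i ilt E] := sj k (sl k ks).
        by exists i => //; rewrite mem_filter mem_iota add0n /j E ks.
      by rewrite mem_filter => /andP[ji _] ->.
    rewrite (perm_big _ pe) big_map big_filter.
    have -> : iota 0 n = index_iota 0 n by rewrite /index_iota subn0.
    rewrite big_mkord.
    rewrite [RHS]big_mkcond/=; apply: eq_bigr => i _.
    case: ifP => _; last by rewrite scale0r.
    by have [-> _] := eD mu i mu0 (ltn_ord i).
  move=> k ks; have [i ilt E] := sj k (sl k ks).
  by have := h (fun i => if j i \in s then c (j i) else 0) sE i ilt; rewrite /j E ks.
Qed.

End eigenvectors.

Section eigenvalue_bounds.
Context {R : realType} {V : lmodType R[i]}.
Local Notation C := R[i].
Variables (F : set V) (G B : V -> V -> C) (L : V -> V) (M0 : R) (lambda : R^nat).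
Hypotheses (sF : subspace F) (pG : psd_form F G) (pB : psd_form F B)
  (G_definite : forall f, F f -> complex.Re (G f f) <= 0 -> f = 0)
  (FL : forall f, F f -> F (L f))
  (GL : forall f g, F f -> F g -> G g (L f) = B g f)
  (BM : forall f, F f -> complex.Re (B f f) <= M0 * complex.Re (G f f))
  (B_compact : forall u : nat -> V, (forall n, F (u n)) ->
    (forall n, complex.Re (G (u n) (u n)) <= 1) ->
    exists f (phi : nat -> nat), [/\ F f, complex.Re (G f f) <= 1,
      forall s, (s <= phi s)%N &
      (fun n => complex.Re (B (u (phi n) - f) (u (phi n) - f))) @ \oo --> (0 : R)])
  (lambda_noninc : nonincreasing_seq lambda)
  (lambda_neq0 : forall k, lambda k != 0)
  (eigen_dim : forall mu : C, mu != 0 -> exists2 n,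
    has_dim [set f | F f /\ L f = mu *: f] n &
    ([set k | (lambda k)%:C = mu] #= `I_n)%card).

Lemma operator0 : L 0 = 0.
Proof.
have F0 := sF.1; apply: G_definite; first exact: FL.
by rewrite (GL F0 (FL F0)) (form0r sF pB)//; exact: FL.
Qed.

Lemma eigenvector_system : exists e : nat -> V, [/\
  forall k, F (e k),
  forall k, 0 < lambda k,
  forall K c p, 0 < c -> F p -> p != 0 -> (forall k, (k < K)%N -> G p (e k) = 0) ->
    c * complex.Re (G p p) <= complex.Re (B p p) -> c <= lambda K &
  forall K (c : 'I_K.+1 -> C), (exists k, c k != 0) ->
    let f := \sum_(k < K.+1) c k *: e k in
    0 < complex.Re (G f f) /\ lambda K * complex.Re (G f f) <= complex.Re (B f f)].
Proof.
have [e [Fe eL e_span e_free]] := eigenvector_enumeration sF.1 operator0 lambda_neq0 eigen_dim.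
have lamC0 k : (lambda k)%:C != 0 :> C by rewrite eq_complex/= eqxx andbT.
have Gpos f : F f -> f != 0 -> 0 < complex.Re (G f f).
  move=> Ff fn0; rewrite lt_def (form_ge0 pG)// andbT.
  by apply: contraNneq fn0 => E; apply/eqP/G_definite => //; rewrite E.
have e0 k : e k != 0.
  apply/eqP => ek0; have /eqP := oner_neq0 C; apply.
  apply: (e_free (lambda k)%:C [:: k] (fun=> 1) (lamC0 k) erefl _ _ k); rewrite ?mem_head//.
    by move=> j; rewrite inE => /eqP ->.
  by rewrite big_seq1 ek0 scaler0.
have Be j k : B (e j) (e k) = (lambda k)%:C * G (e j) (e k).
  by rewrite -GL// eL (formZr sF pG)// conj_real.
have Be' j k : B (e j) (e k) = (lambda j)%:C * G (e j) (e k).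
  by rewrite -(LG pG pB FL GL)// eL (formZl sF pG).
have orth j k : lambda j != lambda k -> G (e j) (e k) = 0.
  move=> jk; apply/eqP; have /eqP := Be j k; rewrite Be' -subr_eq0 -mulrBl mulf_eq0 subr_eq0.
  by case/orP => //; rewrite -subr_eq0 -rmorphB/= => /eqP/complexI/eqP; rewrite subr_eq0 (negbTE jk).
have lam0 k : 0 < lambda k.
  rewrite lt_def lambda_neq0/= leNgt; apply/negP => lk.
  have := form_ge0 pB (Fe k); rewrite Be [G _ _](form_real pG)// -rmorphM/= leNgt.
  by rewrite nmulr_rlt0// Gpos.
exists e; split => //.
- move=> K c p c0 Fp p0 pe pc; rewrite leNgt; apply/negP => lc.
  have [f [M [Ff f0 cM fL fe]]] :=
    eigenvector_orthogonal sF pG pB G_definite FL GL BM B_compact Fe eL lambda_neq0 c0 Fp p0 pe pc.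
  have MC0 : M%:C != 0 :> C.
    by rewrite eq_complex/= eqxx andbT gt_eqF// (lt_le_trans c0).
  (* [f] is a combination of vectors [e k] with [lambda k = M]. As [M >= c > lambda K], monotonicity
     puts these [k] below [K], where [f] is orthogonal to [e k]; so [G f f] would be 0. *)
  have [s [b [sM fE]]] := e_span _ f MC0 Ff fL.
  have := Gpos f Ff f0; rewrite {2}fE (form_sumr sF pG)// big1_seq ?ltxx// => k /andP[_ ks].
  rewrite fe ?mulr0// ltnNge; apply/negP => Kk.
  have /complexI lkM := sM k ks.
  by have := le_lt_trans (lambda_noninc Kk) lc; rewrite lkM ltNge cM.
- move=> K c [k0 ck0] f.
  have Ff : F f by exact: subspace_sum.
  split.
    apply: Gpos => //; apply/eqP => f0.
    have /eqP := ck0; apply.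
    pose c' k := if insub k is Some o then c o else 0.
    (* The part [g] of [f] in the eigenspace of [lambda k0] satisfies [G g g = G f g = 0], since
       distinct eigenspaces are orthogonal; independence inside that eigenspace then kills
       [c k0]. *)
    pose s := [seq k <- iota 0 K.+1 | lambda k == lambda k0].
    have sE : \sum_(k <- s) c' k *: e k = \sum_(k < K.+1 | lambda k == lambda k0) c k *: e k.
      rewrite /s; have -> : iota 0 K.+1 = index_iota 0 K.+1 by rewrite /index_iota subn0.
      by rewrite big_filter big_mkord; apply: eq_bigr => k _; rewrite /c' valK.
    have -> : c k0 = c' k0 by rewrite /c' valK.
    apply: (e_free (lambda k0)%:C s c' (lamC0 k0)).
    + by rewrite filter_uniq// iota_uniq.
    + by move=> k; rewrite mem_filter => /andP[/eqP -> _].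
    + rewrite sE; set g := \sum_(k < _ | _) _.
      have Fg : F g by exact: subspace_sum.
      apply: G_definite => //.
      suff -> : G g g = G f g by rewrite f0 (form0l sF pG).
      rewrite {1}/g /f !(form_suml sF pG)// [RHS](bigID (fun k : 'I_K.+1 => lambda k == lambda k0))/=.
      rewrite [X in _ = _ + X]big1 ?addr0// => k kk0.
      rewrite (form_sumr sF pG)// big1 ?mulr0// => j /eqP jk0.
      by rewrite orth ?mulr0// jk0.
    + by rewrite mem_filter eqxx mem_iota/= add0n.
  (* Rescaling the coefficients by these roots turns [B f f - (lambda K)%:C * G f f] into the square
     [G g g], with no orthonormalisation inside an eigenspace. *)
  pose s k := Num.sqrt (lambda k - lambda K).
  have s2 (k : 'I_K.+1) : s k * s k = lambda k - lambda K.
    by rewrite -expr2 sqr_sqrtr// subr_ge0; apply: lambda_noninc; rewrite -ltnS.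
  pose g := \sum_(k < K.+1) (c k * (s k)%:C) *: e k.
  have Fg : F g by exact: subspace_sum.
  have E : G g g = B f f - (lambda K)%:C * G f f.
    rewrite {1}/g {1 3}/f !(form_suml sF pG)// (form_suml sF pB)// mulr_sumr -sumrB.
    apply: eq_bigr => j _.
    rewrite /g /f !(form_sumr sF pG)// (form_sumr sF pB)// !mulr_sumr -sumrB.
    apply: eq_bigr => k _; rewrite Be rmorphM/= conj_real.
    have [jk|/orth ->] := eqVneq (lambda j) (lambda k); last by rewrite !mulr0 subrr.
    have -> : c j * (s j)%:C * ((c k)^* * (s k)%:C * G (e j) (e k)) =
      c j * (c k)^* * ((s j * s k)%:C * G (e j) (e k)) by rewrite rmorphM/=; ring.
    have -> : s j = s k by rewrite /s jk.
    by rewrite s2 rmorphB/=; ring.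
  have := form_ge0 pG Fg; rewrite E [G f f](form_real pG)//.
  by rewrite -rmorphM ReD ReN/= subr_ge0.
Qed.

End eigenvalue_bounds.

(** * The eigenvalue system of L on the Fock space *)

Section fock_eigenvalues.
Context {R : realType} {d : nat} (Omega : set (Cspace R d)).
Local Notation C := R[i].
Local Notation leb := (lebesgue_Cspace R d).
Local Notation FL2 := (L2 setT (@fock_weight R d)).
Local Notation fip := (@fock_ip R d).
Local Notation bip := (@bergman_ip R d Omega).
Variables (L : (Cspace R d -> C) -> Cspace R d -> C) (lambda : R^nat).
Hypotheses (Omega_open : open Omega) (Omega_bounded : bounded_set Omega)
  (hL : is_L (bergman Omega) bip (@Mz R d) (cst 1) L)
  (hlambda : is_eigenvalue_seq L lambda).

Let mO : measurable Omega. Proof. exact: open_Cspace_measurable. Qed.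

Let fockP f : fock f -> FL2 f.
Proof. by move=> ff; have [a fa] := fock_expands hL ff; exact: fock_FL2 fa ff. Qed.

Let fock_BL2 f : fock f -> L2 Omega (fun=> 1 : R) f.
Proof. by move=> ff; have [a fa] := fock_expands hL ff; exact: expands_BL2 fa. Qed.

Lemma fock_subspace : subspace (@fock R d).
Proof.
have [FL0 FL2D] : subspace FL2 := FL2_subspace.
split; first exact: expands_fock expands0 FL0.
move=> c f g ff fg.
have [a fa] := fock_expands hL ff; have [b gb] := fock_expands hL fg.
apply: (expands_fock (expandsD c fa gb)).
exact: (FL2D c f g (fockP ff) (fockP fg)).
Qed.

Let pG : psd_form (@fock R d) fip.
Proof. by apply: psd_formS fock_psd => f; exact: fockP. Qed.

Let pB : psd_form (@fock R d) bip.
Proof. by apply: psd_formS (bergman_psd Omega_open) => f; exact: fock_BL2. Qed.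

Lemma bergman_le_fock : exists M, forall f, fock f ->
  complex.Re (bip f f) <= M * complex.Re (fip f f).
Proof.
have [r r0 Or] := bounded_set_Cspace Omega_bounded.
exists (pi ^+ d * expR (d%:R * r ^+ 2)) => f ff.
rewrite -lee_fin -bergman_ff_integral//; last exact: fock_BL2.
by apply: sqr_integral_le_fock => //; exact: fockP.
Qed.

Lemma bergman_compact (u : nat -> Cspace R d -> C) : (forall n, fock (u n)) ->
  (forall n, complex.Re (fip (u n) (u n)) <= 1) ->
  exists f (phi : nat -> nat), [/\ fock f, complex.Re (fip f f) <= 1,
    forall s, (s <= phi s)%N &
    (fun n => complex.Re (bip (u (phi n) - f) (u (phi n) - f))) @ \oo --> (0 : R)].
Proof.
move=> fu u1.
have /choice[b ub] n := fock_expands hL (fu n).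
have [f [a [phi [fa Ff f1 phi_ge conv]]]] := montel ub (fun n => fockP (fu n)) u1.
have ff := expands_fock fa Ff.
exists f, phi; split=> //.
have [r r0 Or] := bounded_set_Cspace Omega_bounded.
set vol := fine (leb Omega).
have vol0 : 0 <= vol by exact: fine_ge0.
have fB n : fock (u n - f) by exact: (subspaceB fock_subspace).
apply/cvgrPdist_le => e e0.
(* Uniform distance at most this root on [Omega] makes the squared Bergman distance at most [e];
   adding 1 avoids a division by a possibly zero volume. *)
have d0 : 0 < Num.sqrt (e / (vol + 1)) by rewrite sqrtr_gt0 divr_gt0// ltr_wpDl.
have [n0 hn] := conv r _ r0 d0.
exists n0 => // n /= n0n; rewrite sub0r normrN ger0_norm ?(form_ge0 pB)//.
have [_] := bergman_sqr_le Omega_open Omega_bounded (fock_BL2 (fB (phi n))).1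
  (fun z zO => hn n n0n z (Or z zO)).
move/le_trans; apply.
rewrite sqr_sqrtr; last by rewrite divr_ge0 ?ltW// ltr_wpDl.
rewrite -/vol -mulrA; apply: ler_piMr; first exact: ltW.
rewrite [leLHS]mulrC ler_pdivrMr ?ltr_wpDl// mul1r.
by rewrite lerDl.
Qed.

Lemma fock_eigenvector_system : exists e : nat -> Cspace R d -> C, [/\
  forall k, fock (e k),
  forall k, 0 < lambda k,
  forall K c p, 0 < c -> fock p -> p != 0 ->
    (forall k, (k < K)%N -> fip p (e k) = 0) ->
    c * complex.Re (fip p p) <= complex.Re (bip p p) -> c <= lambda K &
  forall K (c : 'I_K.+1 -> C), (exists k, c k != 0) ->
    let f := \sum_(k < K.+1) c k *: e k in
    0 < complex.Re (fip f f) /\ lambda K * complex.Re (fip f f) <= complex.Re (bip f f)].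
Proof.
have [M BM] := bergman_le_fock.
have [lam_noninc lam0 dim] := hlambda.
apply: (eigenvector_system fock_subspace pG pB _ (L_fock hL)
  (L_ip Omega_open Omega_bounded hL) BM bergman_compact lam_noninc lam0 dim).
move=> f ff f0; have [a fa] := fock_expands hL ff.
exact: fock_definite fa (fockP ff) f0.
Qed.

End fock_eigenvalues.

(** * Upper and lower estimates of the eigenvalues *)

Section eigenvalue_estimates.
Context {R : realType} {d : nat} (Omega : set (Cspace R d)).
Local Notation C := R[i].
Local Notation nm := (@Normc.normc R).
Local Notation leb := (lebesgue_Cspace R d).
Local Notation FL2 := (L2 setT (@fock_weight R d)).
Local Notation fip := (@fock_ip R d).
Local Notation bip := (@bergman_ip R d Omega).
Variables (L : (Cspace R d -> C) -> Cspace R d -> C) (lambda : R^nat).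
Hypotheses (d_gt0 : (0 < d)%N) (Omega_nonempty : Omega !=set0)
  (Omega_open : open Omega) (Omega_bounded : bounded_set Omega)
  (hL : is_L (bergman Omega) bip (@Mz R d) (cst 1) L)
  (hlambda : is_eigenvalue_seq L lambda).

Let mO : measurable Omega. Proof. exact: open_Cspace_measurable. Qed.

Lemma expands_sum (I : Type) (s : seq I) (c : I -> C) (e : I -> Cspace R d -> C)
    (a : I -> multinom d -> C) : (forall i, expands (e i) (a i)) ->
  expands (\sum_(i <- s) c i *: e i) (fun al => \sum_(i <- s) c i * a i al).
Proof.
move=> ea; elim: s => [|i s IHs].
  rewrite big_nil (_ : (fun al => _) = fun=> 0); first exact: expands0.
  by apply/funext => al; rewrite big_nil.
rewrite big_cons; have := expandsD (c i) (ea i) IHs.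
by congr expands; apply/funext => al; rewrite big_cons.
Qed.

(* Among [K.+1] eigenvectors there is a combination without Taylor coefficients
   of degree [< N]; it is [O(2 ^- N)] on the bounded set [Omega]. *)
Lemma eigenvalue_upper : exists2 M : R, 0 < M &
  forall N K, (N ^ d <= K)%N -> lambda K <= M * (1 / 4) ^+ N.
Proof.
have [e [fe lam0 _ comb]] :=
  fock_eigenvector_system Omega_open Omega_bounded hL hlambda.
have /choice[a ea] k := fock_expands hL (fe k).
have [r r0 Or] := bounded_set_Cspace Omega_bounded.
have r40 : 0 < 4 * r by rewrite mulr_gt0.
have [Q Q0 aQ] := coef_le_fock (d := d) r40.
set vol := fine (leb Omega).
have vol0 : 0 <= vol by exact: fine_ge0.
(* The product of the Cauchy constant, the square of the tail constant and the volume; the added 1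
   makes it positive. *)
exists (Q * (2 ^+ d) ^+ 2 * vol + 1).
  by rewrite ltr_wpDl// mulr_ge0// mulr_ge0 ?sqr_ge0// ltW.
move=> N K NK; set ms := @multinoms_lt d N.
have sK : (size ms < K.+1)%N by rewrite ltnS (leq_trans (size_multinoms_lt _)).
have [u u0 uA] := row_kernel (\matrix_(k < K.+1, j < size ms) a k (nth mpoly.mnm0 ms j)) sK.
have c0 : exists k, u ord0 k != 0 by apply/rV0Pn.
have [] := comb K (fun k => u ord0 k) c0.
set f := \sum_(k < _) _ => f0 lamf.
have := expands_sum (index_enum 'I_K.+1) (fun k => u ord0 k) (fun k : 'I_K.+1 => ea k).
rewrite -/f; set b := fun al => _ => fb.
have ff : fock f by exact: (subspace_sum (fock_subspace hL)).
have b0 al : al \in ms -> b al = 0.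
  move=> alm; have ilt : (index al ms < size ms)%N by rewrite index_mem.
  have /matrixP/(_ ord0 (Ordinal ilt)) := uA; rewrite !mxE => uE; rewrite -[RHS]uE /b.
  by apply: eq_bigr => k _; rewrite mxE/= nth_index.
set g := complex.Re (fip f f) in f0 lamf.
have bQ : coef_bound b (4 * r) (Num.sqrt (Q * g)).
  move=> al; apply: le_trans (ler_norm _) _; rewrite -sqrtr_sqr; apply: ler_wsqrtr.
  by apply: aQ => //; exact: fock_FL2 fb ff.
have fle z : Omega z -> nm (f z) <= Num.sqrt (Q * g) * 2 ^+ d * (1 / 2) ^+ N.
  move=> zO; have := expands_dist N fb (ltW r0) bQ (Or z zO).
  by rewrite /partial_sum big1_seq ?subr0// => al /andP[_ /b0 ->]; rewrite mul0r.
have [_] := bergman_sqr_le Omega_open Omega_bounded (expands_cmeasurable Omega fb) fle.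
have Qg : 0 <= Q * g by rewrite mulr_ge0// ltW.
rewrite -/vol 2!exprMn sqr_sqrtr// => h.
suff : lambda K * g <= (Q * (2 ^+ d) ^+ 2 * vol + 1) * (1 / 4) ^+ N * g by rewrite ler_pM2r.
apply: le_trans lamf _; apply: le_trans h _.
have -> : ((1 / 2 : R) ^+ N) ^+ 2 = (1 / 4) ^+ N by rewrite exprAC; congr (_ ^+ _); field.
rewrite -subr_ge0.
have -> : (Q * (2 ^+ d) ^+ 2 * vol + 1) * (1 / 4) ^+ N * g -
  Q * g * (2 ^+ d) ^+ 2 * (1 / 4) ^+ N * vol = (1 / 4) ^+ N * g by ring.
by rewrite mulr_ge0 ?exprn_ge0 ?ltW// divr_ge0.
Qed.

Let polyannulus_integral_le a r f : polyannulus a r `<=` Omega -> 0 < r -> fock f ->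
  (\int[leb]_(z in polyannulus a r) (nm (f z) ^+ 2)%:E <= (complex.Re (bip f f))%:E)%E.
Proof.
move=> aO r0 ff; have [b fb] := fock_expands hL ff.
have BL := expands_BL2 Omega_open Omega_bounded fb.
rewrite -bergman_ff_integral//.
apply: ge0_subset_integral => //; first exact: polyannulus_measurable.
  by apply/measurable_EFinP; exact: measurable_normc_sqr BL.1.
by move=> z _; rewrite lee_fin sqr_ge0.
Qed.

(* Among the [N ^ d] monomials centred at a point of [Omega] there is a
   combination orthogonal to [K] eigenvectors; its Rayleigh quotient is a lower
   bound for [lambda K]. *)
Lemma eigenvalue_lower : exists2 Q : R, 1 <= Q &
  forall N K, (0 < N)%N -> (K < N ^ d)%N ->
  1 <= lambda K * (Q * N%:R) ^+ (4 * (d * N)).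
Proof.
have [e [fe lam0 big _]] :=
  fock_eigenvector_system Omega_open Omega_bounded hL hlambda.
have [a aO] := Omega_nonempty.
have [e0 e00 ballO] : exists2 e0 : R, 0 < e0 & polyball a e0 `<=` Omega.
  by apply: nbhs_polyball; exact: open_nbhs_nbhs.
(* The outer radius of the polyannulus is [2 * r], hence [e0 / 2]; the bound 1 is for
   [shifted_poly_lower]. *)
pose r := Num.min 1 (e0 / 2).
have r0 : 0 < r by rewrite lt_min ltr01 divr_gt0.
have r1 : r <= 1 by rewrite ge_min lexx.
have annO : polyannulus a r `<=` Omega.
  apply: subset_trans ballO => z zr i; have /andP[_ /lt_le_trans] := zr i; apply.
  by rewrite mulrC -ler_pdivlMr// ge_min lexx orbT.
have [G G0 PG] := shifted_poly_norm a.
have [V V0 PV] := @shifted_poly_lower R d a r (introT andP (conj r0 r1)).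
(* The three factors answer for the constants [G] and [V], the Gaussian moments and the inner
   radius. Each is at least 1, so exponents may be raised freely. *)
pose Q := (1 + G / V) * (4 * d%:R) * r^-1.
have Q1 : 1 <= 1 + G / V by rewrite lerDl divr_ge0 ?ltW.
have Q2 : 1 <= 4 * d%:R :> R by rewrite -natrM ler1n muln_gt0.
have Q3 : 1 <= r^-1 by rewrite invf_ge1.
have Q0 : 1 <= Q by apply: mulr_ege1 => //; exact: mulr_ege1.
exists Q => // N K N0 KN.
have dN0 : (0 < d * N)%N by rewrite muln_gt0 d_gt0.
pose T := {ffun 'I_d -> 'I_N}.
pose m (f : T) : Cspace R d -> C := shifted_poly a (fun g => (g == f)%:R).
have mL2 f : FL2 (m f) by have [] := PG N (fun g => (g == f)%:R) dN0.
have KT : (K < #|T|)%N by rewrite card_ffun !card_ord.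
have [u u0 uA] := row_kernel (\matrix_(i < #|T|, k < K) fip (m (enum_val i)) (e k)) KT.
pose b (f : T) : C := u ord0 (enum_rank f).
pose P := shifted_poly a b.
have PE : P = \sum_f b f *: m f.
  apply/funext => z; rewrite fct_sumE /P /shifted_poly.
  apply: eq_bigr => f _ /=; rewrite /m /shifted_poly.
  rewrite [X in _ = _ *: X](bigD1 f)//= eqxx mul1r big1 ?addr0//.
  by move=> g /negbTE ->; rewrite mul0r.
have [PL2 Pnorm] := PG N b dN0; rewrite -/P in PL2 Pnorm.
have fP : fock P by split; [exact: shifted_poly_holomorphic|case: PL2].
have Pe k : (k < K)%N -> fip P (e k) = 0.
  move=> kK; have [c ec] := fock_expands hL (fe k).
  have ekL := fock_FL2 ec (fe k).
  rewrite PE (form_suml FL2_subspace fock_psd)//.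
  have /matrixP/(_ ord0 (Ordinal kK)) := uA; rewrite !mxE => uE; rewrite -[RHS]uE.
  rewrite (reindex _ (onW_bij _ (@enum_val_bij T)))/=; apply: eq_bigr => i _.
  by rewrite mxE /b enum_valK.
have [f0 bf0] : exists f, b f != 0.
  have [i ui] : exists i, u ord0 i != 0 by apply/rV0Pn.
  by exists (enum_val i); rewrite /b enum_valK.
(* The largest coefficient serves both sides: alone it bounds the Bergman norm from below, and
   [N ^ d] times it bounds the coefficient sum in the Fock norm. *)
have [f1 _ f1max] := @Order.TotalTheory.arg_maxP _ _ T f0 xpredT (fun f => nm (b f)) erefl.
set x := nm (b f1) in f1max.
have x0 : 0 < x.
  rewrite (lt_le_trans _ (f1max f0 erefl))// lt_def normc_ge0 andbT.
  by apply: contra bf0 => /eqP/Normc.eq0_normc ->.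
have low : x ^+ 2 * (r ^+ (2 * (d * N)) * V) <= complex.Re (bip P P).
  rewrite -lee_fin (le_trans (PV N b f1))//; exact: polyannulus_integral_le.
set k := (2 * (d * N))%N in low Pnorm; pose n : R := (N ^ d)%:R; set W := (4 * _) ^+ k in Pnorm.
have k0 : (0 < k)%N by rewrite muln_gt0.
have W0 : 0 < W by rewrite exprn_gt0// mulr_gt0// ltr0n.
have n0 : 0 < n by rewrite ltr0n expn_gt0 N0.
have upp : complex.Re (fip P P) <= x ^+ 2 * (n ^+ 2 * W * G).
  apply: le_trans Pnorm _; rewrite 2!mulrA ler_pM2r// ler_pM2r// -exprMn.
  rewrite ler_pXn2r// ?nnegrE; first last.
  - by rewrite mulr_ge0// ltW.
  - by apply: sumr_ge0 => f _; exact: normc_ge0.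
  have -> : x * n = \sum_(f : T) x by rewrite sumr_const card_ffun !card_ord mulr_natr.
  by apply: ler_sum => f _; exact: f1max.
pose c := r ^+ k * V / (n ^+ 2 * W * G).
have D0 : 0 < n ^+ 2 * W * G by apply: mulr_gt0 => //; apply: mulr_gt0 => //; exact: exprn_gt0.
have c0 : 0 < c by rewrite divr_gt0// mulr_gt0// exprn_gt0.
have P0 : P != 0.
  apply/eqP => P0; move: low; rewrite leNgt => /negP; apply.
  have [sB1 sB2] := BL2_subspace Omega_open.
  rewrite P0 (form0l (conj sB1 sB2) (bergman_psd Omega_open))//.
  by rewrite !mulr_gt0 ?exprn_gt0.
have lamc : c <= lambda K.
  apply: (big K c P) => //; apply: le_trans low.
  rewrite (le_trans (ler_wpM2l (ltW c0) upp))// /c le_eqVlt; apply/orP; left; apply/eqP.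
  by field; rewrite !gt_eqF.
pose t : R := N%:R.
have t1 : 1 <= t by rewrite ler1n.
apply: le_trans (ler_wpM2r _ lamc); last first.
  by apply: exprn_ge0; apply: mulr_ge0; [exact: le_trans Q0|exact: ler0n].
(* One power [t ^+ k] pays for the Gaussian moments in [W], the other for [n ^+ 2], the squared
   number of monomials. *)
have -> : (4 * (d * N) = k + k)%N by rewrite /k addnn -mul2n [in RHS]mulnA.
rewrite /c mulrAC ler_pdivlMr// mul1r -/t.
have WE : W = (4 * d%:R) ^+ k * t ^+ k by rewrite /W natrM mulrA exprMn.
have nE : n ^+ 2 <= t ^+ k.
  rewrite /n natrX -exprM ler_weXn2l// /k mulnC leq_mul2l/= leq_pmulr//.
have QE : (4 * d%:R) ^+ k * (1 + G / V) ^+ k <= r ^+ k * Q ^+ (k + k).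
  have -> : r ^+ k * Q ^+ (k + k) = ((4 * d%:R) * (1 + G / V)) ^+ k * Q ^+ k.
    rewrite exprD mulrA -[in LHS]exprMn; congr (_ ^+ k * _).
    by rewrite /Q; field; rewrite !gt_eqF.
  rewrite -exprMn ler_peMr ?exprn_ege1//.
  by apply: exprn_ge0; apply: mulr_ge0; [exact: le_trans Q2|exact: le_trans Q1].
have GE : G <= V * (1 + G / V) ^+ k.
  apply: (@le_trans _ _ (V * (1 + G / V))).
    have -> : V * (1 + G / V) = V + G by field; rewrite gt_eqF.
    by rewrite lerDr ltW.
  by rewrite ler_pM2l// ler_eXnr.
have tk : 0 < t ^+ k by rewrite exprn_gt0// (lt_le_trans ltr01).
have Dk : 0 < (4 * d%:R : R) ^+ k by rewrite exprn_gt0// (lt_le_trans ltr01).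
apply: (@le_trans _ _ (t ^+ k * W * (V * (1 + G / V) ^+ k))).
  apply: ler_pM => //; [|exact: ltW|by rewrite ler_pM2r].
  by rewrite mulr_ge0 ?exprn_ge0// ltW.
rewrite WE [(Q * t) ^+ _]exprMn [t ^+ (k + k)]exprD.
have -> : t ^+ k * ((4 * d%:R) ^+ k * t ^+ k) * (V * (1 + G / V) ^+ k) =
  ((4 * d%:R) ^+ k * (1 + G / V) ^+ k) * (t ^+ k * t ^+ k * V) by ring.
have -> : r ^+ k * V * (Q ^+ (k + k) * (t ^+ k * t ^+ k)) =
  (r ^+ k * Q ^+ (k + k)) * (t ^+ k * t ^+ k * V) by ring.
apply: ler_wpM2r => //.
by rewrite mulr_ge0 ?(ltW V0)// mulr_ge0 ?ltW.
Qed.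

End eigenvalue_estimates.

(** * Asymptotics *)

Section asymptotics.
Context {R : realType}.

(** [Y] stands for [ln N]: an error of order [Num.sqrt (Y + C)] is negligible against [X], which is
    at least [Y - C]. *)
Lemma ratio_cvg (D C : R) (A X Y : R^nat) (n0 : nat) : 0 <= C ->
  (forall B, exists m, forall n, (m <= n)%N -> B <= Y n) ->
  (forall n, (n0 <= n)%N -> Y n - C <= X n /\
    `|A n - D * X n| <= C * (1 + Num.sqrt (Y n + C))) ->
  (fun n => A n / X n) @ \oo --> D.
Proof.
move=> C0 Yoo AX; apply/cvgrPdist_le => e e0.
(* Chosen so that [s >= S] implies [C * (1 + s) <= e * (s ^+ 2 - 2 * C)], where [s ^+ 2 = Y n + C]
   and thus [X n >= s ^+ 2 - 2 * C]. *)
pose S := 1 + (C * (1 + 2 * e) + C) / e.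
have S1 : 1 <= S by rewrite lerDl divr_ge0 ?(ltW e0)//; nra.
have [m Ym] := Yoo (S ^+ 2 + 2 * C).
exists (maxn n0 m) => // n /=; rewrite geq_max => /andP[n0n /Ym Yn].
have [XY AXn] := AX n n0n.
set s := Num.sqrt (Y n + C) in AXn.
have S2 := sqr_ge0 S.
have YC : 0 <= Y n + C by lra.
have s2 : s ^+ 2 = Y n + C by rewrite sqr_sqrtr.
have Ss : S <= s.
  rewrite -(@ler_pXn2r _ 2)// ?nnegrE ?sqrtr_ge0 ?(le_trans ler01)// s2.
  by lra.
have s1 : 1 <= s := le_trans S1 Ss.
have X0 : 0 < X n.
  by apply: lt_le_trans XY; nra.
have -> : D - A n / X n = - (A n - D * X n) / X n by field; rewrite gt_eqF.
rewrite normrM normrN normfV (gtr0_norm X0) ler_pdivrMr//.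
apply: (le_trans AXn); apply: (@le_trans _ _ (e * (s ^+ 2 - 2 * C))).
  have es : C * (1 + 2 * e) + C <= e * s.
    have : (C * (1 + 2 * e) + C) / e <= s by apply: le_trans Ss; rewrite lerDr.
    by rewrite ler_pdivrMr// [s * e]mulrC.
  have : (C * (1 + 2 * e) + C) * s <= e * s * s by rewrite ler_wpM2r// (le_trans ler01).
  have : C * (1 + 2 * e) * 1 <= C * (1 + 2 * e) * s.
    by rewrite ler_wpM2l//; nra.
  by rewrite expr2; lra.
by rewrite ler_pM2l// (le_trans _ XY)// s2; lra.
Qed.

(** Applied to [ln (Q * N.+1%:R)], this trades the iterated logarithm for the square root that
    [ratio_cvg] tolerates. *)
Lemma ln_le_sqrt (x : R) : 0 < x -> ln x <= 2 * Num.sqrt x.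
Proof.
move=> x0; have s0 : 0 < Num.sqrt x by rewrite sqrtr_gt0.
have {1}-> : x = Num.sqrt x ^+ 2 by rewrite sqr_sqrtr// ltW.
by rewrite lnXn// mulr_natl lerMn2r/= ltW// ln_sublinear.
Qed.

Lemma root_bracket (d K : nat) : (0 < d)%N -> exists N, (N ^ d <= K < N.+1 ^ d)%N.
Proof.
move=> d0; have ex : exists N, (N ^ d <= K)%N by exists 0%N; rewrite exp0n.
have ub N : (N ^ d <= K)%N -> (N <= K)%N.
  case: N => [//|N] NK; apply: leq_trans NK.
  by rewrite -[X in (X <= _)%N]expn1 leq_pexp2l.
case: (ex_maxnP ex ub) => N NK Nmax; exists N; rewrite NK/= ltnNge.
by apply/negP => /Nmax; rewrite ltnn.
Qed.

(* With [N ^ d <= K < N.+1 ^ d], both [ln K / d] and [ln (ln (1 / lambda K))]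
   are [ln N + O(ln (ln N))]. *)
Lemma counting_limit (d : nat) (M Q : R) (lambda : R^nat) : (0 < d)%N ->
  0 < M -> 1 <= Q -> (forall K, 0 < lambda K) ->
  (forall N K, (N ^ d <= K)%N -> lambda K <= M * (1 / 4) ^+ N) ->
  (forall N K, (0 < N)%N -> (K < N ^ d)%N ->
    1 <= lambda K * (Q * N%:R) ^+ (4 * (d * N))) ->
  (fun k : nat => ln (k.+1%:R : R) / ln (ln (1 / lambda k))) @ \oo --> (d%:R : R).
Proof.
move=> d0 M0 Q1 lam0 up lo.
have Q0 : 0 < Q by exact: lt_le_trans Q1.
have /choice[r rP] K := root_bracket K d0.
have r_ge m K : (m ^ d <= K)%N -> (m <= r K)%N.
  move=> mK; rewrite leqNgt; apply/negP => rm.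
  have /andP[_] := rP K; rewrite ltnNge => /negP; apply.
  by rewrite (leq_trans _ mK)// leq_exp2r.
pose c : R := ln 4 / 2.
have ln4 : 0 < ln 4 :> R by rewrite ln_gt0// ltr1n.
have c0 : 0 < c by rewrite divr_gt0.
have ln2 : 0 <= ln 2 :> R by rewrite ln_ge0// ler1n.
have lnd : 0 <= ln (4 * d%:R) :> R by rewrite ln_ge0// -natrM ler1n muln_gt0.
have lnQ : 0 <= ln (2 * Q).
  by rewrite ln_ge0// mulr_ege1// ler1n.
pose D : R := d%:R.
have D0 : 0 <= D by rewrite ler0n.
pose C := D * (ln 2 + `|ln c| + ln (4 * D) + 2) + ln (2 * Q) + `|ln c|.
have C0 : 0 <= C by rewrite !addr_ge0// mulr_ge0// !addr_ge0.
(* From here on [ln M] is at most half of [ln 4 * N%:R]; the other half is the rate [c]. The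
   successor ensures [N > 0]. *)
pose n1 := (Num.bound `|2 * ln M / ln 4|).+1.
apply: (@ratio_cvg D C _ _ (fun K => ln (r K)%:R) (n1 ^ d)) => //.
  move=> B; exists ((Num.bound (expR B)).+1 ^ d)%N => n /r_ge rn.
  rewrite -[B]expRK ler_ln ?posrE ?expR_gt0 ?ltr0n ?(leq_trans _ rn)//.
  rewrite (le_trans (ltW (archi_boundP (expR_ge0 _))))// ler_nat.
  exact: ltnW.
(* Since [lambda] is indexed from 0, the count is [K.+1], which lies between [N ^ d] and
   [N.+1 ^ d]. *)
move=> K /r_ge n1r; set N := r K in n1r *; set Y := ln N%:R; set A := ln K.+1%:R.
have N0 : (0 < N)%N by exact: leq_trans n1r.
have NR : 1 <= N%:R :> R by rewrite ler1n.
have N0R : 0 < N%:R :> R by rewrite ltr0n.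
have Y0 : 0 <= Y by rewrite ln_ge0.
have /andP[NK KN] := rP K; rewrite -/N in NK KN.
have lnN1 : ln (N.+1%:R : R) <= Y + ln 2.
  rewrite -lnM ?posrE// ler_ln ?posrE ?ltr0n// ?mulr_gt0//.
  by rewrite -natrM ler_nat muln2 -addnn -addn1 leq_add2l.
have AY : D * Y <= A.
  rewrite mulr_natl -lnXn// -natrX ler_ln ?posrE ?ltr0n// ?expn_gt0 ?N0//.
  by rewrite ler_nat ltnW.
have AY' : A <= D * (Y + ln 2).
  apply: (@le_trans _ _ (D * ln (N.+1%:R : R))); last by rewrite ler_wpM2l.
  rewrite mulr_natl -lnXn// -natrX ler_ln ?posrE ?ltr0n// ?expn_gt0//.
  by rewrite ler_nat.
pose l := ln (1 / lambda K).
have lE : l = - ln (lambda K) by rewrite /l div1r lnV ?posrE.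
have l_ge : c * N%:R <= l.
  have : ln (lambda K) <= ln M - ln 4 * N%:R.
    have -> : ln M - ln 4 * N%:R = ln (M * (1 / 4) ^+ N).
      by rewrite div1r exprVn ln_div ?posrE ?exprn_gt0// lnXn// mulr_natr.
    rewrite ler_ln ?posrE ?up//.
    by rewrite mulr_gt0// exprn_gt0// divr_gt0.
  have : 2 * ln M / ln 4 <= N%:R.
    apply: (@le_trans _ _ (Num.bound `|2 * ln M / ln 4|)%:R).
      exact: le_trans (ler_norm _) (ltW (archi_boundP (normr_ge0 _))).
    by rewrite ler_nat ltnW.
  by rewrite ler_pdivrMr// lE /c => h1 h2; lra.
have l0 : 0 < l by apply: lt_le_trans l_ge; rewrite mulr_gt0.
have X_ge : Y + ln c <= ln l.
  by rewrite addrC -lnM ?posrE// ler_ln ?posrE// mulr_gt0.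
have L0 : 0 < ln (Q * N.+1%:R) by rewrite ln_gt0// (lt_le_trans _ (ler_wpM2r _ Q1))// ?mul1r ?ltr1n.
have LY : ln (Q * N.+1%:R) <= Y + ln (2 * Q).
  rewrite lnM ?posrE ?ltr0n// lnM ?posrE//.
  by rewrite [ln 2 + _]addrC addrCA lerD2l.
have l_le : l <= 4 * D * N.+1%:R * ln (Q * N.+1%:R).
  have := lo N.+1 K isT KN.
  have QN0 : 0 < Q * N.+1%:R by rewrite mulr_gt0.
  rewrite -[1 <= _]ler_ln ?posrE//; last by rewrite mulr_gt0// exprn_gt0.
  rewrite ln1 lnM ?posrE ?exprn_gt0 ?mulr_gt0// lnXn ?mulr_gt0//.
  by rewrite lE -[_ *+ (4 * _)]mulr_natl !natrM -/D !mulrA => h; lra.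
have X_le : ln l <= ln (4 * D) + (Y + ln 2) + 2 * Num.sqrt (Y + C).
  apply: (@le_trans _ _ (ln (4 * D) + ln (N.+1%:R : R) + ln (ln (Q * N.+1%:R)))).
    rewrite -!lnM ?posrE ?mulr_gt0 ?ltr0n// ler_ln ?posrE// ?mulr_gt0 ?ltr0n//.
  rewrite lerD// ?lerD2l//.
  rewrite (le_trans (ln_le_sqrt L0))// ler_pM2l// ler_wsqrtr// (le_trans LY)// lerD2l.
  rewrite /C -addrA addrCA lerDl.
  by rewrite addr_ge0// mulr_ge0// !addr_ge0.
split.
  have : - ln c <= `|ln c| by rewrite -normrN ler_norm.
  have : 0 <= D * (ln 2 + `|ln c| + ln (4 * D) + 2) by rewrite mulr_ge0// !addr_ge0.
  by rewrite /C; lra.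
set s := Num.sqrt _ in X_le *.
have s0 : 0 <= s by exact: sqrtr_ge0.
have CD : D * (ln 2 + `|ln c| + ln (4 * D) + 2) <= C.
  by have := normr_ge0 (ln c); rewrite /C; lra.
have CDs : D * (ln 2 + `|ln c| + ln (4 * D) + 2) * (1 + s) <= C * (1 + s).
  by rewrite ler_wpM2r// addr_ge0.
apply: le_trans CDs; rewrite ler_norml -/A -/l.
have h1 := ler_wpM2l D0 X_ge; have h2 := ler_wpM2l D0 X_le.
have h3 : - ln c <= `|ln c| by rewrite -normrN ler_norm.
have h4 := ler_wpM2l D0 h3.
have h5 : 0 <= D * s by rewrite mulr_ge0.
have h6 : 0 <= D * ln 2 by rewrite mulr_ge0.
have h7 : 0 <= D * ln (4 * D) by rewrite mulr_ge0.
have h8 : 0 <= D * `|ln c| by rewrite mulr_ge0.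
have h9 := mulr_ge0 h6 s0; have h10 := mulr_ge0 h7 s0; have h11 := mulr_ge0 h8 s0.
by apply/andP; split; lra.
Qed.

End asymptotics.

Local Close Scope complex_scope.

Theorem proposition3p1 (R : realType) (d : nat) (hd : (0 < d)%N)
  (Omega : set (Cspace R d))
  (Omega_nonempty : Omega !=set0)
  (Omega_bounded : bounded_set Omega)
  (Omega_open : open Omega)
  (polynomials_dense : forall f, bergman Omega f -> forall e : R, 0 < e ->
    exists p, ip_norm (bergman_ip Omega) (f - poly_fun p) < e)
  (L : (Cspace R d -> R[i]) -> Cspace R d -> R[i])
  (hL : is_L (bergman Omega) (bergman_ip Omega) (@Mz R d) (cst 1) L)
  (lambda : R^nat)
  (hlambda : is_eigenvalue_seq L lambda) :
  (fun k : nat => ln (k.+1%:R : R) / ln (ln (1 / lambda k))) @ \oo --> (d%:R : R).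
Proof.
have [M M0 up] := eigenvalue_upper Omega_open Omega_bounded hL hlambda.
have [Q Q1 lo] := eigenvalue_lower hd Omega_nonempty Omega_open Omega_bounded hL hlambda.
have [e [_ lam0 _ _]] := fock_eigenvector_system Omega_open Omega_bounded hL hlambda.
exact: (counting_limit hd M0 Q1 lam0 up lo).
Qed.
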